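(* Let $X$ and $Y$ be two Banach spaces, consider $S\in L(X)$ and $T\in L(Y)$, and let $\tau_{ST}\in L(L(Y,X))$ be the elementary operator $\tau_{ST}(A)=SAT$, $A\in L(Y,X)$. Set $\mathbb{D}=\sigma(S)\sigma_{DR}(T)\cup\sigma_{DR}(S)\sigma(T)$. Then the following statements hold. (i) If $\sigma(S)=\Pi(S)$ and $\sigma(T)=\Pi(T)$, then $\mathbb{D}=\emptyset=\sigma_{DR}(\tau_{ST})$. (ii) If $\sigma_{DR}(S)\neq\emptyset$ or $\sigma_{DR}(T)\neq\emptyset$, then $\sigma_{DR}(\tau_{ST})\setminus\{0\}=\mathbb{D}\setminus\{0\}$, $\sigma_{DR}(\tau_{ST})\subseteq\mathbb{D}$, and if $\sigma_{DR}(\tau_{ST})\subsetneq\mathbb{D}$, then $\mathbb{D}=\sigma_{DR}(\tau_{ST})\cup\{0\}$ and $0\notin\sigma_{DR}(\tau_{ST})$. (iii) If $\sigma(S)=\Pi(S)\neq\{0\}$ and $\sigma_{DR}(T)\neq\emptyset$, then $\sigma_{DR}(\tau_{ST})=\mathbb{D}$ if and only if $0\notin\Pi(S)$ or $0\notin\rho_{DR}(T)$. (iv) If $\sigma_{DR}(S)\neq\emptyset$ and $\sigma(T)=\Pi(T)\neq\{0\}$, then $\sigma_{DR}(\tau_{ST})=\mathbb{D}$ if and only if $0\notin\rho_{DR}(S)$ or $0\notin\Pi(T)$. (v) Suppose that $\sigma_{DR}(S)\neq\emptyset$ and $\sigma_{DR}(T)\neq\emptyset$. Then the following statements are equivalent: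 (va) $\mathbb{D}=\sigma_{DR}(\tau_{ST})$; (vb) both $S$ and $T$ are invertible, or $\tau_{ST}$ is not Drazin invertible; (vc) both $S$ and $T$ are invertible, or $0\notin(\Pi(S)\cap\rho_{DR}(T))\cup(\rho_{DR}(S)\cap\Pi(T))$.
   Context: Banach spaces are complex. $L(Y,X)$ is the Banach space of bounded linear maps from $Y$ into $X$, and $L(X)=L(X,X)$. For $K,L\subseteq\mathbb{C}$, $KL=\{kl: k\in K,\ l\in L\}$ (empty if $K$ or $L$ is empty). An element $x$ of a unital Banach algebra $C$ is Drazin invertible if there exist $y\in C$ and $m\in\mathbb{N}$ (with $m\ge0$ allowed) such that $x^myx=x^m$, $yxy=y$ and $xy=yx$. The Drazin spectrum of $x$ is $\sigma_{DR}(x)=\{\lambda\in\mathbb{C}: x-\lambda\text{ is not Drazin invertible in }C\}$, and $\rho_{DR}(x)=\mathbb{C}\setminus\sigma_{DR}(x)$. $\sigma(x)$ is the usual spectrum and $\mathrm{iso}\,\sigma(x)$ is the set of its isolated points. $\Pi(x)\subseteq\mathrm{iso}\,\sigma(x)$ is the set of poles of $x$: those $\lambda_0\in\mathrm{iso}\,\sigma(x)$ that are poles of some finite order $p\ge1$ of the resolvent function $R(\cdot,x)$, i.e. in the Laurent expansion $R(\lambda,x)=\sum_{n\ge0}a_n(\lambda-\lambda_0)^n+\sum_{n\ge1}b_n(\lambda-\lambda_0)^{-n}$ around $\lambda_0$ one has $b_p\ne0$ and $b_m=0$ for all $m\ge p+1$. These notions are applied to $S$, $T$ and $\tau_{ST}$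 as elements of the Banach algebras $L(X)$, $L(Y)$ and $L(L(Y,X))$ respectively. *)

(* Defs.v *)
From HB Require Import structures.
From mathcomp Require Import all_boot all_order all_algebra.
From mathcomp Require Import complex.
From mathcomp Require Import all_classical all_reals all_analysis.

Set Implicit Arguments.
Unset Strict Implicit.
Unset Printing Implicit Defensive.

Import Order.TTheory GRing.Theory Num.Theory.
Import numFieldNormedType.Exports.

Local Open Scope classical_set_scope.
Local Open Scope ring_scope.
Local Open Scope complex_scope.

#[export, non_forgetful_inheritance]
HB.instance Definition _ (R : realType) := NormedModule.copy R[i] R[i]^o.

Section BoundedLinear.
Context {R : realType} {U V : normedModType R[i]}.

Definition is_bounded_linear (f : U -> V) : Prop :=
  linear f /\ exists M : R[i], forall x, `|f x| <= M * `|x|.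

Definition bounded_linear_pred : {pred U -> V} :=
  fun f => `[< is_bounded_linear f >].

Record blin := Blin {
  blin_fun :> U -> V ;
  blin_funP : blin_fun \in bounded_linear_pred }.

Lemma bounded_linear_submod_closed : submod_closed bounded_linear_pred.
Proof.
split.
  apply/asboolP; split; first by move=> k x y; rewrite scaler0 addr0.
  by exists 0 => x; rewrite normr0 mul0r.
move=> k f g /asboolP[fl [Mf fM]] /asboolP[gl [Mg gM]]; apply/asboolP; split.
  move=> c x y; rewrite !fctE fl gl !scalerDr !scalerA addrACA.
  by rewrite [c * k]mulrC.
exists (`|k| * Mf + Mg) => x; rewrite !fctE mulrDl.
by rewrite (le_trans (ler_normD _ _))// lerD// normrZ -mulrA ler_wpM2l.
Qed.

HB.instance Definition _ := GRing.isSubmodClosed.Build R[i] (U -> V)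
  bounded_linear_pred bounded_linear_submod_closed.

HB.instance Definition _ := [isSub for blin_fun].
HB.instance Definition _ := [Choice of blin by <:].
HB.instance Definition _ := [SubChoice_isSubLmodule of blin by <:].

Lemma blinP (f g : blin) : f =1 g -> f = g.
Proof. by move=> fg; apply/val_inj/funext. Qed.

Lemma blin_linear (f : blin) : linear f.
Proof. by have /asboolP[] := blin_funP f. Qed.

Lemma blin_bounded (f : blin) : exists M : R[i], forall x, `|f x| <= M * `|x|.
Proof. by have /asboolP[] := blin_funP f. Qed.

HB.instance Definition _ (f : blin) :=
  GRing.isLinear.Build R[i] U V *:%R f (blin_linear f).

Lemma blin0E x : (0 : blin) x = 0. Proof. by []. Qed.
Lemma blinDE (f g : blin) x : (f + g) x = f x + g x. Proof. by []. Qed.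
Lemma blinNE (f : blin) x : (- f) x = - f x. Proof. by []. Qed.
Lemma blinZE k (f : blin) x : (k *: f) x = k *: f x. Proof. by []. Qed.

(* Norms take values in [R[i]], and [sup] lives in [R]. *)
Definition opnorm (f : blin) : R[i] :=
  (sup [set complex.Re `|f x| | x in [set x | `|x| <= 1]])%:C.

Let ReK (z : R[i]) : 0 <= z -> (complex.Re z)%:C = z.
Proof. by move=> z0; rewrite [RHS]complexE (ger0_Im z0) /= mulr0 addr0. Qed.

Let set_n0 (f : blin) : [set complex.Re `|f x| | x in [set x | `|x| <= 1]] !=set0.
Proof. by exists (complex.Re `|f 0|); exists 0 => //=; rewrite normr0. Qed.

Lemma opnorm_le (f : blin) (M : R[i]) :
  0 <= M -> (forall x, `|x| <= 1 -> `|f x| <= M) -> opnorm f <= M.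
Proof.
move=> M0 fM; rewrite -(ReK M0) lecR; apply: ge_sup; first exact: set_n0.
by move=> _ [x /= x1 <-]; rewrite -lecR !ReK// fM.
Qed.

Lemma opnorm_unit (f : blin) x : `|x| <= 1 -> `|f x| <= opnorm f.
Proof.
move=> x1; rewrite -(ReK (normr_ge0 _)) lecR; apply: ub_le_sup; last by exists x.
have [M fM] := blin_bounded f.
have [N N0 fN] : exists2 N : R[i], 0 <= N & forall y, `|f y| <= N * `|y|.
  exists `|M| => [|y]; first exact: normr_ge0.
  have My : 0 <= M * `|y| by exact: le_trans (fM y).
  by rewrite (le_trans (fM y))// -(ger0_norm My) normrM normr_id.
exists (complex.Re N) => _ [y /= y1 <-].
by rewrite -lecR !ReK// (le_trans (fN y))// ler_piMr.
Qed.

Lemma opnorm_ge0 (f : blin) : 0 <= opnorm f.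
Proof. by rewrite (le_trans _ (@opnorm_unit f 0 _))// normr0. Qed.

Lemma opnorm_bound (f : blin) x : `|f x| <= opnorm f * `|x|.
Proof.
have [->|x0] := eqVneq x 0; first by rewrite linear0 !normr0 mulr0.
have nx : 0 < `|x| by rewrite normr_gt0.
have := @opnorm_unit f (`|x|^-1 *: x).
rewrite linearZ !normrZ normfV normr_id mulVf ?normr_eq0// => /(_ (lexx _)).
by rewrite mulrC ler_pdivrMr.
Qed.

Lemma ler_opnormD (f g : blin) : opnorm (f + g) <= opnorm f + opnorm g.
Proof.
apply: opnorm_le => [|x x1]; first by rewrite addr_ge0// opnorm_ge0.
by rewrite blinDE (le_trans (ler_normD _ _))// lerD// opnorm_unit.
Qed.

Let opnormZ_le k (f : blin) : opnorm (k *: f) <= `|k| * opnorm f.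
Proof.
apply: opnorm_le => [|x x1]; first by rewrite mulr_ge0// opnorm_ge0.
by rewrite blinZE normrZ ler_wpM2l// opnorm_unit.
Qed.

Lemma opnormZ k (f : blin) : opnorm (k *: f) = `|k| * opnorm f.
Proof.
apply/eqP; rewrite eq_le opnormZ_le/=.
have [->|k0] := eqVneq k 0; first by rewrite normr0 mul0r opnorm_ge0.
rewrite -ler_pdivlMl ?normr_gt0// -normfV (le_trans _ (opnormZ_le _ _))//.
by rewrite scalerA mulVf// scale1r.
Qed.

Lemma opnorm0_eq0 (f : blin) : opnorm f = 0 -> f = 0.
Proof.
move=> f0; apply: blinP => x; apply/eqP; rewrite -normr_le0.
by rewrite (le_trans (opnorm_bound f x))// f0 mul0r.
Qed.

HB.instance Definition _ :=
  Lmodule_isNormed.Build R[i] blin ler_opnormD opnormZ opnorm0_eq0.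

Lemma blin_normE (f : blin) : `|f| = opnorm f. Proof. by []. Qed.

End BoundedLinear.
Arguments blin {R} U V.

Section Completeness.
Context {R : realType} {U : normedModType R[i]} {V : completeNormedModType R[i]}.

Let le_eps (x y : R[i]) : 0 <= x -> 0 <= y ->
  (forall e : R[i], 0 < e -> x <= y + e) -> x <= y.
Proof.
move=> /ger0_real xr /ger0_real yr xy.
have [//|yx] := real_leP xr yr.
have := xy ((x - y) / 2); rewrite divr_gt0 ?subr_gt0// => /(_ isT).
rewrite -lerBlDl ler_pdivlMr// mulr2n mulrDr mulr1 gerDl subr_le0 => xy'.
by have := le_lt_trans xy' yx; rewrite ltxx.
Qed.

Lemma blin_complete (F : set_system (blin U V)) :
  ProperFilter F -> cauchy F -> cvg F.
Proof.
move=> FF /cauchy_ballP Fc.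
have Fc' (e : R[i]) : 0 < e -> exists2 A, F A & forall f h, A f -> A h -> `|f - h| < e.
  move=> e0; have [[A B] /= [FA FB] AB] := Fc e e0.
  exists (A `&` B); first exact: filterI.
  move=> f h [Af _] [_ Bh]; have := AB (f, h) (conj Af Bh).
  by rewrite /= -ball_normE.
have Fx x : cvg ((fun f : blin U V => f x) @ F).
  apply: cauchy_cvg; apply/cauchy_ballP => e e0.
  have nx : 0 < `|x| + 1 by rewrite ltr_wpDl.
  have [A FA Ae] := Fc' (e / (`|x| + 1)) (divr_gt0 e0 nx).
  pose ev (f : blin U V) := f x.
  have FevA : F (ev @^-1` (ev @` A)) by apply: filterS FA; exact: preimage_image.
  exists (ev @` A, ev @` A) => //=.
  move=> [_ _] /= [[f Af <-] [h Ah <-]]; rewrite -ball_normE /=.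
  rewrite /ev -blinNE -blinDE (le_lt_trans (opnorm_bound _ _))//.
  rewrite (@le_lt_trans _ _ (opnorm (f - h) * (`|x| + 1)))//.
    by rewrite ler_wpM2l ?opnorm_ge0// lerDl.
  by rewrite -ltr_pdivlMr// -blin_normE Ae.
pose g x := lim ((fun f : blin U V => f x) @ F).
have gE x : (fun f : blin U V => f x) @ F --> g x by exact: Fx.
have glin : linear g.
  move=> k x y; apply: (@cvg_unique _ (@norm_hausdorff _ V) _ _ _ _ (gE _)).
  have -> : (fun f : blin U V => f (k *: x + y)) = fun f => k *: f x + f y.
    by apply/funext => f; rewrite linearP.
  by apply: cvgD => //; apply: cvgZr.
have gclose (e : R[i]) : 0 < e -> exists2 A, F A &
    forall f, A f -> forall x, `|f x - g x| <= e * `|x|.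
  move=> e0; have [A FA Ae] := Fc' e e0; exists A => // f Af x.
  apply: le_eps; rewrite ?mulr_ge0 ?(ltW e0)// => d d0.
  have /cvgrPdist_lt/(_ d d0) Fd := gE x.
  have [h [/= hd Ah]] := filter_ex (filterI Fd FA).
  rewrite -(subrK (h x) (f x)) -addrA (le_trans (ler_normD _ _))// lerD//.
    rewrite -blinNE -blinDE (le_trans (opnorm_bound _ _))// ler_wpM2r//.
    by rewrite ltW// -blin_normE Ae.
  by rewrite distrC ltW.
have gbd : is_bounded_linear g.
  split=> //; have [A FA Ag] := gclose 1 ltr01.
  have [f Af] := filter_ex FA; exists (opnorm f + 1) => x.
  rewrite -(subrK (f x) (g x)) (le_trans (ler_normD _ _))// mulrDl addrC.
  by rewrite lerD ?opnorm_bound// distrC Ag.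
pose G := @Blin R U V g (asboolT gbd).
apply/cvg_ex; exists G; apply/cvgrPdist_lt => e e0.
have e20 : 0 < e / 2 by rewrite divr_gt0.
have [A FA Ag] := gclose (e / 2) e20.
apply: filterS FA => f Af; rewrite distrC blin_normE.
apply: (@le_lt_trans _ _ (e / 2)); last by rewrite ltr_pdivrMr// ltr_pMr// ltr1n.
apply: opnorm_le => [|x x1]; first exact: ltW.
by rewrite blinDE blinNE (le_trans (Ag _ Af _))// ler_piMr// ltW.
Qed.

HB.instance Definition _ := Uniform_isComplete.Build (blin U V) blin_complete.

End Completeness.

Section Composition.
Context {R : realType}.

Lemma blin_comp_subproof (U V W : normedModType R[i])
  (g : blin V W) (f : blin U V) : g \o f \in bounded_linear_pred.
Proof.
apply/asboolP; split; first by move=> k x y /=; rewrite !linearP.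
exists (opnorm g * opnorm f) => x /=.
rewrite (le_trans (opnorm_bound _ _))// -mulrA.
by rewrite ler_wpM2l ?opnorm_ge0// opnorm_bound.
Qed.

Definition blin_comp (U V W : normedModType R[i])
  (g : blin V W) (f : blin U V) : blin U W := Blin (blin_comp_subproof g f).

Lemma opnorm_comp (U V W : normedModType R[i]) (g : blin V W) (f : blin U V) :
  opnorm (blin_comp g f) <= opnorm g * opnorm f.
Proof.
apply: opnorm_le => [|x x1]; first by rewrite mulr_ge0// opnorm_ge0.
rewrite /= (le_trans (opnorm_bound _ _))//.
by rewrite ler_wpM2l ?opnorm_ge0// opnorm_unit.
Qed.

Lemma blin_id_subproof (U : normedModType R[i]) :
  (idfun : U -> U) \in bounded_linear_pred.
Proof.
apply/asboolP; split; first by move=> k x y.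
by exists 1 => x; rewrite mul1r.
Qed.

Definition blin_id (U : normedModType R[i]) : blin U U :=
  Blin (blin_id_subproof U).

End Composition.

Section Algebra.
Context {R : realType} {E : normedModType R[i]}.

Let mulA : associative (@blin_comp R E E E). Proof. by move=> f g h; apply: blinP. Qed.
Let mul1l : left_id (blin_id E) (@blin_comp R E E E). Proof. by move=> f; apply: blinP. Qed.
Let mul1r : right_id (blin_id E) (@blin_comp R E E E). Proof. by move=> f; apply: blinP. Qed.
Let mulDl : left_distributive (@blin_comp R E E E) +%R.
Proof. by move=> f g h; apply: blinP. Qed.
Let mulDr : right_distributive (@blin_comp R E E E) +%R.
Proof. by move=> f g h; apply: blinP => x; rewrite /= linearD. Qed.

(* [blin E E] is trivial when [E] is the zero space, so it cannot be an
   [algType], which requires [1 != 0]. *)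
HB.instance Definition _ :=
  GRing.Zmodule_isPzRing.Build (blin E E) mulA mul1l mul1r mulDl mulDr.

Lemma blin1E x : (1 : blin E E) x = x. Proof. by []. Qed.
Lemma blinME (f g : blin E E) x : (f * g) x = f (g x). Proof. by []. Qed.

Lemma blin_scalerAl k (f g : blin E E) : k *: (f * g) = (k *: f) * g.
Proof. exact: blinP. Qed.

Lemma blin_scalerAr k (f g : blin E E) : k *: (f * g) = f * (k *: g).
Proof. by apply: blinP => x; rewrite !(blinZE, blinME) linearZ. Qed.

Lemma blin_normM (f g : blin E E) : `|f * g| <= `|f| * `|g|.
Proof. exact: opnorm_comp. Qed.

End Algebra.

Section Invertibility.
Context {A : pzRingType}.
Implicit Types x y : A.

Definition inverse_pair x y := x * y = 1 /\ y * x = 1.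

Definition invertible x := exists y, inverse_pair x y.

Definition drazin_invertible x := exists (y : A) (m : nat),
  [/\ x ^+ m * y * x = x ^+ m, y * x * y = y & x * y = y * x].

End Invertibility.

Section Spectra.
Context {R : realType} {E : completeNormedModType R[i]}.
Implicit Types x : blin E E.

Definition spectrum x : set R[i] := [set l | ~ invertible (x - l *: (1 : blin E E))].

(* [(l - x)^-1], with junk value 0 for [l] in the spectrum *)
Definition resolvent x (l : R[i]) : blin E E :=
  xget 0 [set y | inverse_pair (l *: (1 : blin E E) - x) y].

(* [f l = \sum_(n >= 0) a n (l - l0)^n + \sum_(n >= 1) b n (l - l0)^-n], with
   both series converging in norm, for every [l] in some punctured disc around
   [l0]; [b 0] plays no role. *)
Definition laurent_expansion (f : R[i] -> blin E E) (l0 : R[i])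
    (a b : nat -> blin E E) :=
  \forall l \near l0^', exists u v : blin E E,
    [/\ series (fun n => (l - l0) ^+ n *: a n) @ \oo --> u,
        series (fun n => (l - l0) ^- n.+1 *: b n.+1) @ \oo --> v
      & f l = u + v].

Definition pole_of_order (p : nat) (f : R[i] -> blin E E) (l0 : R[i]) :=
  exists a b : nat -> blin E E,
    [/\ laurent_expansion f l0 a b, b p <> 0
      & forall m, (p.+1 <= m)%N -> b m = 0].

Definition poles x : set R[i] :=
  [set l0 | isolated (spectrum x) l0 /\
            exists2 p, (1 <= p)%N & pole_of_order p (resolvent x) l0].

Definition drazin_spectrum x : set R[i] :=
  [set l | ~ drazin_invertible (x - l *: (1 : blin E E))].

Definition drazin_resolvent_set x : set R[i] := ~` drazin_spectrum x.

End Spectra.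

Definition set_mul {R : realType} (K L : set R[i]) : set R[i] :=
  [set k * l | k in K & l in L].

Section ElementaryOperator.
Context {R : realType} {X Y : completeNormedModType R[i]}.
Variables (S : blin X X) (T : blin Y Y).

Definition elem_op_fun (A : blin Y X) : blin Y X := blin_comp S (blin_comp A T).

Lemma elem_op_subproof : elem_op_fun \in bounded_linear_pred.
Proof.
apply/asboolP; split.
  by move=> k A B; apply: blinP => x; exact: blin_linear.
exists (opnorm S * opnorm T) => A.
rewrite !blin_normE (le_trans (opnorm_comp _ _))// -mulrA.
by rewrite ler_wpM2l ?opnorm_ge0// mulrC opnorm_comp.
Qed.

Definition elem_op : blin (blin Y X) (blin Y X) := Blin elem_op_subproof.

End ElementaryOperator.

(* Main.v *)
Require Import Defs.
From HB Require Import structures.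
From mathcomp Require Import all_boot all_order all_algebra.
From mathcomp Require Import complex.
From mathcomp Require Import all_classical all_reals all_analysis.
From mathcomp Require Import ring lra.

Set Implicit Arguments.
Unset Strict Implicit.
Unset Printing Implicit Defensive.

Import Order.TTheory GRing.Theory Num.Theory.
Import numFieldNormedType.Exports.

Local Open Scope classical_set_scope.
Local Open Scope ring_scope.

(* Write [lam = mu nu] for the ways of factoring [lam] over the two spectra.

   Upper bound.  In the bicommutant of the commuting operators [A |-> S A] and
   [A |-> A T], the elements [r] with [r c^k \in c^(k+1) C], [c = tau - lam], form
   an ideal, proper unless [c] is Drazin invertible.  By Gelfand-Mazur, a larger
   proper ideal contains [S - mu] and [T - nu] for some [mu nu = lam]; if both are
   Drazin invertible, their spectral complements multiply [c] to a nilpotent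
   element, which forces 1 into the ideal.

   Lower bound.  If [tau - lam] is Drazin invertible of index [p], evaluating
   [|c^p A| <= M |c^(p+1) A|] at rank-one operators built on approximate
   eigenvectors of [S] gives [|f (T - nu)^p| <= M' |f (T - nu)^(p+1)|] for all
   functionals [f], whence [(T - nu)^p (T - nu - k)^(-m)] stays bounded as [k]
   tends to 0 and [T - nu] is Drazin invertible; symmetrically for [S].  Boundary
   points of the spectrum provide the approximate eigenvectors, and
   [sigma(S) sigma(T)] lies in [sigma(tau)] away from 0 by moving [(mu, nu)] along
   [(t mu, nu / t)] until one of the points is on a boundary.

   At [lam = 0] only the product rule for commuting Drazin invertible elements and
   the quasinilpotent case have to be added. *)

(** * Real-valued norms *)

(** The ideals that occur need not be closed, because the exponent in their definition varies, so
    Gelfand-Mazur cannot simply be applied in a quotient Banach algebra. Its proof is carried out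
    with congruences modulo an arbitrary proper ideal; what it takes from completeness is that
    [1 - v] is invertible for [v] of norm below 1. The power bound alone does not give Drazin
    invertibility: the unilateral shift on a Hilbert space satisfies it with [p = 0], yet 0 is
    interior to its spectrum. A punctured disc of regular points must be added. This is why ordinary
    spectra enter: a disc around [mu nu] that misses [sigma(tau)] off its centre yields such discs
    around [mu] and [nu], and isolated spectral points are boundary points, with approximate
    eigenvectors for the operator and for its adjoint. The value 0 is genuinely exceptional: if 0 is
    a pole of [S] and [T] is Drazin invertible with non-empty Drazin spectrum, then 0 lies in [D]
    while [tau] is Drazin invertible. *)

Section RealNorm.
Local Open Scope complex_scope.
Context {R : realType}.

(* Norms of [R[i]]-modules take values in [R[i]]; [rn] is the same norm in [R]. *)
Definition rn {V : normedZmodType R[i]} (x : V) : R := complex.Re `|x|.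

Lemma rnE {V : normedZmodType R[i]} (x : V) : (rn x)%:C = `|x|.
Proof. by rewrite [RHS]complexE /rn (ger0_Im (normr_ge0 x)) /= mulr0 addr0. Qed.

Lemma rn_ge0 {V : normedZmodType R[i]} (x : V) : 0 <= rn x.
Proof. by rewrite -lecR rnE; exact: normr_ge0. Qed.

Lemma ler_rnD {V : normedZmodType R[i]} (x y : V) : rn (x + y) <= rn x + rn y.
Proof. by rewrite -lecR rmorphD /= !rnE ler_normD. Qed.

Lemma rn0 {V : normedZmodType R[i]} : rn (0 : V) = 0.
Proof. by rewrite /rn normr0. Qed.

Lemma rn0_eq0 {V : normedZmodType R[i]} (x : V) : rn x = 0 -> x = 0.
Proof. by move=> h; apply/normr0_eq0; rewrite -rnE h. Qed.

Lemma rnN {V : normedZmodType R[i]} (x : V) : rn (- x) = rn x.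
Proof. by rewrite /rn normrN. Qed.

Lemma rnB {V : normedZmodType R[i]} (x y : V) : rn (x - y) = rn (y - x).
Proof. by rewrite /rn distrC. Qed.

Lemma ler_rnB {V : normedZmodType R[i]} (x y : V) : rn (x - y) <= rn x + rn y.
Proof. by rewrite -[rn y]rnN ler_rnD. Qed.

Lemma rn_gt0 {V : normedZmodType R[i]} (x : V) : (0 < rn x) = (x != 0).
Proof.
rewrite lt_def rn_ge0 andbT; congr (~~ _); apply/eqP/eqP => [/rn0_eq0 //|->].
exact: rn0.
Qed.

Lemma rn_dist3 {V : normedZmodType R[i]} (z x y : V) :
  rn (x - y) <= rn (x - z) + rn (z - y).
Proof. by rewrite -lecR rmorphD /= !rnE ler_distD. Qed.

Lemma rn_sum {V : normedZmodType R[i]} n (F : nat -> V) :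
  rn (\sum_(i < n) F i) <= \sum_(i < n) rn (F i).
Proof.
elim: n => [|n IH]; first by rewrite !big_ord0 rn0.
by rewrite !big_ord_recr /= (le_trans (ler_rnD _ _))// lerD2r.
Qed.

Lemma rnZ {V : normedModType R[i]} (k : R[i]) (x : V) : rn (k *: x) = rn k * rn x.
Proof. by apply/complexI; rewrite rmorphM /= !rnE normrZ. Qed.

Lemma rnM (k l : R[i]) : rn (k * l) = rn k * rn l.
Proof. by apply/complexI; rewrite rmorphM /= !rnE normrM. Qed.

Lemma rnX (k : R[i]) n : rn (k ^+ n) = rn k ^+ n.
Proof. by apply/complexI; rewrite rmorphXn /= !rnE normrX. Qed.

Lemma rnV (k : R[i]) : rn k^-1 = (rn k)^-1.
Proof. by apply/complexI; rewrite fmorphV /= !rnE normfV. Qed.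

Lemma rnR (r : R) : rn r%:C = `|r|.
Proof.
apply/complexI; rewrite rnE normc_def /= expr0n /= addr0.
by rewrite sqrtr_sqr.
Qed.

Lemma rn_nat n : rn (n%:R : R[i]) = n%:R.
Proof. by rewrite -(rmorph_nat (real_complex R)) rnR normr_nat. Qed.

Lemma rn1 : rn (1 : R[i]) = 1.
Proof. by rewrite /rn normr1. Qed.

Lemma blin_app0 {U V : normedModType R[i]} (f : blin U V) : f 0 = 0.
Proof. exact: linear0. Qed.

Lemma blin_appD {U V : normedModType R[i]} (f : blin U V) x y :
  f (x + y) = f x + f y.
Proof. exact: linearD. Qed.

Lemma blin_appB {U V : normedModType R[i]} (f : blin U V) x y :
  f (x - y) = f x - f y.
Proof. exact: linearB. Qed.

Lemma blin_appZ {U V : normedModType R[i]} (f : blin U V) k x :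
  f (k *: x) = k *: f x.
Proof. exact: linearZ. Qed.

Lemma rn_blin {U V : normedModType R[i]} (f : blin U V) x :
  rn (f x) <= rn f * rn x.
Proof. by rewrite -lecR rmorphM /= !rnE; exact: opnorm_bound. Qed.

Lemma rn_blin_le {U V : normedModType R[i]} (f : blin U V) (M : R) :
  0 <= M -> (forall x, rn (f x) <= M * rn x) -> rn f <= M.
Proof.
move=> M0 fM; rewrite -lecR rnE blin_normE; apply: opnorm_le; first by rewrite lecR.
move=> x; rewrite -!rnE !lecR => x1; apply: le_trans (fM x) _.
by rewrite -[leRHS]mulr1 ler_wpM2l.
Qed.

Lemma rn_blin_lt {U V : normedModType R[i]} (f : blin U V) (t : R) :
  0 <= t -> t < rn f -> exists x, t * rn x < rn (f x).
Proof.
move=> t0 tf; apply: contrapT => /forallNP h.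
move: tf; rewrite ltNge rn_blin_le// => x.
by rewrite leNgt; apply/negP/h.
Qed.

Lemma rn_comp {U V W : normedModType R[i]} (g : blin V W) (f : blin U V) :
  rn (blin_comp g f) <= rn g * rn f.
Proof. by rewrite -lecR rmorphM /= !rnE; exact: opnorm_comp. Qed.

Lemma rn_blinM {E : normedModType R[i]} (f g : blin E E) :
  rn (f * g) <= rn f * rn g.
Proof. exact: rn_comp. Qed.

Lemma rn_blin1 {E : normedModType R[i]} : rn (1 : blin E E) <= 1.
Proof. by apply: rn_blin_le => // x; rewrite blin1E mul1r. Qed.

Lemma rn_blinX {E : normedModType R[i]} (f : blin E E) n :
  rn (f ^+ n) <= rn f ^+ n.
Proof.
elim: n => [|n IH]; first by rewrite !expr0 rn_blin1.
by rewrite !exprS (le_trans (rn_blinM _ _))// ler_wpM2l// rn_ge0.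
Qed.

Lemma exprn_lt (q e : R) : 0 <= q -> q < 1 -> 0 < e ->
  exists N, forall n, (N <= n)%N -> q ^+ n < e.
Proof.
move=> q0 q1 e0; have /cvgrPdist_lt/(_ e e0) : (fun n => q ^+ n) @ \oo --> (0 : R).
  by apply: cvg_expr; rewrite ger0_norm.
move=> [N _ h]; exists N => n /h /=.
by rewrite sub0r normrN ger0_norm ?exprn_ge0.
Qed.

Lemma cvg_rnP {V : normedModType R[i]} (u : nat -> V) (l : V) :
  u @ \oo --> l <->
  forall e : R, 0 < e -> exists N, forall n, (N <= n)%N -> rn (u n - l) < e.
Proof.
split.
  move=> /cvgrPdist_lt h e e0.
  have [|N _ hN] := h e%:C; first by rewrite ltcR.
  by exists N => n /hN /=; rewrite -rnE ltcR rnB.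
move=> h; apply/cvgrPdist_lt => e e0.
have eE : (complex.Re e)%:C = e.
  by rewrite [RHS]complexE (ger0_Im (ltW e0)) /= mulr0 addr0.
have [|N hN] := h (complex.Re e); first by rewrite -ltcR eE.
by exists N => // n /= /hN; rewrite -ltcR rnE eE distrC.
Qed.

Lemma cauchy_rn_cvg {V : completeNormedModType R[i]} (u : nat -> V) :
  (forall e : R, 0 < e -> exists N, forall m n, (N <= m)%N -> (m <= n)%N ->
    rn (u n - u m) <= e) ->
  exists l, forall e : R, 0 < e -> exists N, forall n, (N <= n)%N -> rn (u n - l) < e.
Proof.
move=> h; suff uc : cvg (u @ \oo) by exists (lim (u @ \oo)); apply/cvg_rnP; exact: uc.
apply: cauchy_cvg; apply/cauchy_ballP => e e0.
have eE : (complex.Re e)%:C = e.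
  by rewrite [RHS]complexE (ger0_Im (ltW e0)) /= mulr0 addr0.
have e'0 : 0 < complex.Re e by rewrite -ltcR eE.
have [|N hN] := h (complex.Re e / 4%:R); first by lra.
pose A := [set u n | n in [set n | (N <= n)%N]].
have FA : (u @ \oo) A by exists N => // n /= Nn; exists n.
exists (A, A) => //= -[_ _] [/= [m Nm <-] [n Nn <-]].
rewrite -ball_normE /= -rnE -eE ltcR (le_lt_trans (rn_dist3 (u N) _ _))//.
have := hN N m (leqnn _) Nm; have := hN N n (leqnn _) Nn.
by rewrite [rn (u n - _)]rnB; lra.
Qed.

End RealNorm.

(** * Drazin inverses, bicommutants and Neumann series *)

Section DrazinAlgebra.
Context {A : pzRingType}.
Implicit Types x y d w : A.

Lemma drazin_criterion x d p : x * d = d * x -> x ^+ p = x ^+ p.+1 * d ->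
  drazin_invertible x.
Proof.
move=> xd xp.
have cX n m : x ^+ n * d ^+ m = d ^+ m * x ^+ n.
  by apply/commrX/commr_sym/commrX.
have e n : x ^+ (p + n) * d ^+ n = x ^+ p.
  elim: n => [|n IH]; first by rewrite addn0 expr0 mulr1.
  rewrite addnS -addSn addnC exprD [d ^+ _]exprS mulrA -[_ * d]mulrA -xp -exprD.
  by rewrite addnC.
have cx m : d ^+ m * x = x * d ^+ m by rewrite -[x in LHS]expr1 -cX expr1.
exists (x ^+ p * d ^+ p.+1), p; split.
- by rewrite mulrA -mulrA cx mulrA -exprD -exprSr -addnS e.
- rewrite -!mulrA [d ^+ _ * (_ * _)]mulrA cx -mulrA [d ^+ _ * (_ * _)]mulrA -cX.
  by rewrite !mulrA -exprSr -exprD addSnnS e.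
- by rewrite -mulrA cx !mulrA -exprS -exprSr.
Qed.

Lemma drazin_invP x : drazin_invertible x -> exists d p,
  [/\ x * d = d * x, x ^+ p = x ^+ p.+1 * d, d * x * d = d
    & forall w, x * w = w * x -> d * w = w * d].
Proof.
move=> [y [m [xm yxy xy]]]; exists y, m; split => //.
  by rewrite exprSr -mulrA xy mulrA.
move=> w xw; pose q := x * y.
have qX n : q ^+ n.+1 = q.
  elim: n => [|n IH]; first by rewrite expr1.
  by rewrite exprS IH /q -!mulrA [y * _]mulrA yxy.
have xmq : x ^+ m * q = x ^+ m by rewrite /q xy mulrA.
have qE : q = x ^+ m * (y ^+ m * q) /\ q = q * y ^+ m * x ^+ m.
  have h n : x ^+ n * y ^+ n * q = q.
    elim: n => [|n IH]; first by rewrite !expr0 !mul1r.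
    have e : x ^+ n.+1 * y ^+ n.+1 = q ^+ n.+1 by rewrite exprMn_comm.
    by rewrite e qX -expr2 qX.
  split; first by rewrite mulrA h.
  rewrite -[LHS](h m) -exprMn_comm//.
  have -> : q * y ^+ m * x ^+ m = q * (x * y) ^+ m.
    by rewrite exprMn_comm// -mulrA; congr (_ * _); apply/commrX/commr_sym/commrX.
  exact/commr_sym/commrX.
have cw n : x ^+ n * w = w * x ^+ n by exact/commr_sym/commrX/commr_sym.
have [e1 e2] := qE.
have qxm : q * x ^+ m = x ^+ m.
  by rewrite -[RHS]xmq; apply: commrX; rewrite /GRing.comm /q -mulrA -xy.
have qwq1 : q * w = q * w * q.
  transitivity (q * y ^+ m * x ^+ m * w); first by rewrite -e2.
  transitivity (q * y ^+ m * x ^+ m * w * q); last by rewrite -e2.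
  by rewrite -!mulrA [x ^+ m * (w * q)]mulrA cw -mulrA xmq.
have qwq2 : w * q = q * w * q.
  transitivity (w * (x ^+ m * (y ^+ m * q))); first by rewrite -e1.
  transitivity (q * w * (x ^+ m * (y ^+ m * q))); last by rewrite -e1.
  by rewrite !mulrA -[q * w * _]mulrA -cw mulrA qxm.
have qw : q * w = w * q by rewrite qwq2.
have yq : y * q = y by rewrite /q mulrA.
have qy : q * y = y by rewrite /q xy.
transitivity (y * (w * q)); first by rewrite -qw mulrA yq.
transitivity (y * x * (w * y)); last by rewrite -xy -/q mulrA qw -mulrA qy.
by rewrite /q -!mulrA; congr (_ * _); rewrite !mulrA xw.
Qed.

Lemma inverse_comm x y w : inverse_pair x y -> x * w = w * x -> y * w = w * y.
Proof.
move=> [xy yx] xw; rewrite -[LHS]mulr1 -xy -!mulrA [w * (x * _)]mulrA -xw.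
by rewrite -!mulrA mulrA yx mul1r.
Qed.

Lemma inverse_unique x y y' : inverse_pair x y -> inverse_pair x y' -> y = y'.
Proof. by move=> [_ yx] [xy' _]; rewrite -[y]mulr1 -xy' mulrA yx mul1r. Qed.

Lemma invertible_drazin x : invertible x -> drazin_invertible x.
Proof. by move=> [y [xy yx]]; exists y, 0; rewrite !expr0 !mul1r yx mul1r xy. Qed.

Definition bicommutes a b : {pred A} :=
  fun z => `[< forall w, a * w = w * a -> b * w = w * b -> z * w = w * z >].

Lemma bicommutes_subring_closed a b : subring_closed (bicommutes a b).
Proof.
split; first by apply/asboolP => w _ _; rewrite mulr1 mul1r.
  move=> u v /asboolP hu /asboolP hv; apply/asboolP => w aw bw.
  by rewrite mulrBl mulrBr hu// hv.
move=> u v /asboolP hu /asboolP hv; apply/asboolP => w aw bw.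
by rewrite -mulrA hv// mulrA hu// mulrA.
Qed.

(* A commutative ring, since [a] and [b] commute, containing the inverses and the
   Drazin inverses of its elements. *)
Record bicomm a b (ab : a * b = b * a) := Bicomm {
  bicomm_val :> A ; bicomm_valP : bicomm_val \in bicommutes a b }.

End DrazinAlgebra.
Arguments bicomm {A a b} ab.
Arguments Bicomm {A a b} ab {bicomm_val}.
Arguments bicomm_val {A a b ab}.

Section BicommRing.
Context {A : pzRingType} (a b : A) (ab : a * b = b * a).

HB.instance Definition _ := GRing.isSubringClosed.Build A
  (bicommutes a b) (bicommutes_subring_closed a b).

HB.instance Definition _ := [isSub for (@bicomm_val A a b ab)].
HB.instance Definition _ := [Choice of (bicomm ab) by <:].
HB.instance Definition _ :=
  GRing.SubChoice_isSubPzRing.Build A (bicommutes a b) (bicomm ab)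
  (bicommutes_subring_closed a b).

Lemma bicommP (u : bicomm ab) (w : A) :
  a * w = w * a -> b * w = w * b -> bicomm_val u * w = w * bicomm_val u.
Proof. by case: u => u /= /asboolP; apply. Qed.

Lemma bicomm_mulC : commutative (@GRing.mul (bicomm ab)).
Proof.
move=> u v; apply: val_inj; apply: bicommP.
  by apply/esym/bicommP => //.
by apply/esym/bicommP => //.
Qed.

HB.instance Definition _ :=
  GRing.PzRing_hasCommutativeMul.Build (bicomm ab) bicomm_mulC.

Lemma bicomm_valM (u v : bicomm ab) :
  bicomm_val (u * v) = bicomm_val u * bicomm_val v.
Proof. by []. Qed.

Lemma bicomm_valX (u : bicomm ab) n : bicomm_val (u ^+ n) = bicomm_val u ^+ n.
Proof. by elim: n => [|n IH]; rewrite ?expr0// !exprS bicomm_valM IH. Qed.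

Lemma bicomm_l_subproof : a \in bicommutes a b.
Proof. by apply/asboolP. Qed.
Lemma bicomm_r_subproof : b \in bicommutes a b.
Proof. by apply/asboolP. Qed.
Definition bicomm_l : bicomm ab := Bicomm ab bicomm_l_subproof.
Definition bicomm_r : bicomm ab := Bicomm ab bicomm_r_subproof.

Lemma bicomm_inv (u : bicomm ab) : invertible (bicomm_val u) ->
  exists v : bicomm ab, u * v = 1 /\ inverse_pair (bicomm_val u) (bicomm_val v).
Proof.
move=> [y uy].
have yP : y \in bicommutes a b.
  by apply/asboolP => w aw bw; apply: (inverse_comm uy); exact: bicommP.
by exists (Bicomm ab yP); split => //; apply: val_inj => /=; case: uy.
Qed.

Lemma bicomm_drazin (u : bicomm ab) : drazin_invertible (bicomm_val u) <->
  exists (d : bicomm ab) p, u ^+ p = u ^+ p.+1 * d.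
Proof.
split.
  move=> /drazin_invP [d [p [ud up _ dw]]].
  have dP : d \in bicommutes a b.
    by apply/asboolP => w aw bw; apply: dw; exact: bicommP.
  exists (Bicomm ab dP), p; apply: val_inj.
  change (bicomm_val (u ^+ p) = bicomm_val (u ^+ p.+1 * Bicomm ab dP)).
  by rewrite bicomm_valM !bicomm_valX.
move=> [d [p up]]; apply: (@drazin_criterion _ _ (bicomm_val d) p).
  by rewrite -!bicomm_valM mulrC.
by rewrite -!bicomm_valX -bicomm_valM up.
Qed.

End BicommRing.

Section Neumann.
Local Open Scope complex_scope.
Context {R : realType}.

Lemma blin_cst_comm {E : normedModType R[i]} k (f : blin E E) :
  (k *: (1 : blin E E)) * f = f * (k *: (1 : blin E E)).
Proof. by rewrite -blin_scalerAl -blin_scalerAr mul1r mulr1. Qed.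

Lemma eq_rn_lt {V : normedZmodType R[i]} (x y : V) :
  (forall e : R, 0 < e -> rn (x - y) <= e) -> x = y.
Proof.
move=> h; apply/eqP; rewrite -subr_eq0 -[_ == _]negbK -rn_gt0; apply/negP => d0.
have := h (rn (x - y) / 2); rewrite divr_gt0// => /(_ isT).
by rewrite leNgt ltr_pdivrMr// ltr_pMr// ltr1n.
Qed.

Lemma neumann {E : completeNormedModType R[i]} (v : blin E E) : rn v < 1 ->
  exists w, inverse_pair (1 - v) w /\ rn w * (1 - rn v) <= 1.
Proof.
move=> v1; pose s n := \sum_(i < n) v ^+ i.
have q0 := rn_ge0 v; have q1 : 0 < 1 - rn v by rewrite subr_gt0.
have sB m k : rn (s (m + k)%N - s m) * (1 - rn v) <= rn v ^+ m.
  have -> : s (m + k)%N - s m = v ^+ m * s k.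
    rewrite /s big_split_ord /= addrAC subrr add0r mulr_sumr.
    by apply: eq_bigr => i _; rewrite exprD.
  have h : rn (s k) * (1 - rn v) <= 1.
    apply: (@le_trans _ _ ((\sum_(i < k) rn v ^+ i) * (1 - rn v))).
      rewrite ler_wpM2r//; first exact: ltW.
      by apply: le_trans (rn_sum _ _) _; apply: ler_sum => i _; exact: rn_blinX.
    rewrite mulrC -opprB mulNr -subrX1 opprB gerBl; exact: exprn_ge0.
  apply: (@le_trans _ _ (rn v ^+ m * (rn (s k) * (1 - rn v)))).
    rewrite mulrA ler_wpM2r ?(ltW q1)// (le_trans (rn_blinM _ _))//.
    by rewrite ler_wpM2r ?rn_ge0// rn_blinX.
  by rewrite -[leRHS]mulr1 ler_wpM2l// exprn_ge0.
have [|w sw] := @cauchy_rn_cvg R (blin E E) s.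
  move=> e e0; have [|||N hN] := @exprn_lt _ (rn v) (e * (1 - rn v)) => //.
    by rewrite mulr_gt0.
  exists N => m n Nm /subnKC <-; rewrite -(ler_pM2r q1).
  by apply: le_trans (sB _ _) _; rewrite ltW// hN.
have comm n : v * s n = s n * v.
  by rewrite mulr_sumr mulr_suml; apply: eq_bigr => i _; rewrite -exprS exprSr.
have sE n : (1 - v) * s n = 1 - v ^+ n.
  by rewrite -[1 - v ^+ n]opprB subrX1 -mulNr opprB.
(* [F] will be left or right multiplication by [1 - v]; being Lipschitz, it lets [F (s n) = 1 - v^n]
   pass to the limit. *)
have key (F : blin E E -> blin E E) (K : R) : 0 <= K ->
    (forall f g, rn (F f - F g) <= K * rn (f - g)) ->
    (forall n, F (s n) = 1 - v ^+ n) -> F w = 1.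
  move=> K0 FK Fs; apply: eq_rn_lt => e e0.
  have K1 : 0 < K + 1 by rewrite ltr_wpDl.
  have [|N1 h1] := sw (e / 2 / (K + 1)); first by rewrite !divr_gt0.
  have [|||N2 h2] := @exprn_lt _ (rn v) (e / 2) => //; first by rewrite divr_gt0.
  have {}h1 := h1 _ (leq_maxl N1 N2); have {}h2 := h2 _ (leq_maxr N1 N2).
  move: (maxn N1 N2) h1 h2 => n h1 h2.
  apply: le_trans (rn_dist3 (F (s n)) _ _) _.
  have -> : e = e / 2 + e / 2 by rewrite -splitr.
  apply: lerD.
    apply: le_trans (FK _ _) _; rewrite rnB.
    move: h1; rewrite ltr_pdivlMr// => /ltW; apply: le_trans.
    by rewrite mulrC ler_wpM2l ?rn_ge0// lerDl.
  by rewrite Fs addrAC subrr add0r rnN ltW// (le_lt_trans (rn_blinX _ _)).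
have iw : inverse_pair (1 - v) w.
  split; first apply: (key (fun f => (1 - v) * f) (rn (1 - v))) => //.
  - exact: rn_ge0.
  - by move=> f g; rewrite -mulrBr rn_blinM.
  apply: (key (fun f => f * (1 - v)) (rn (1 - v))) => //.
  - exact: rn_ge0.
  - by move=> f g; rewrite -mulrBl mulrC rn_blinM.
  - by move=> n; rewrite mulrBr mulr1 -comm -{1}[s n]mul1r -mulrBl.
exists w; split => //.
have : w = 1 + v * w by case: iw => <- _; rewrite mulrBl mul1r subrK.
move=> /(congr1 rn) wE; have := @ler_rnD R (blin E E) 1 (v * w); rewrite -wE.
have := rn_blinM v w; have := @rn_blin1 R E; nra.
Qed.

Lemma invertible_perturb {E : completeNormedModType R[i]} (c r : blin E E) k :
  inverse_pair c r -> 2 * (rn k * rn r) <= 1 ->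
  exists r', inverse_pair (c - k *: (1 : blin E E)) r' /\ rn r' <= 2 * rn r.
Proof.
move=> cr kr.
have [|w [w1 w2]] := @neumann E (k *: r); first by rewrite rnZ; lra.
have rw : r * w = w * r.
  apply/esym/(inverse_comm w1).
  by rewrite mulrBl mulrBr mul1r mulr1 -blin_scalerAl -blin_scalerAr.
have cE : c - k *: (1 : blin E E) = (1 - k *: r) * c.
  by rewrite mulrBl mul1r -blin_scalerAl; case: cr => _ ->.
have cE' : c - k *: (1 : blin E E) = c * (1 - k *: r).
  by rewrite mulrBr mulr1 -blin_scalerAr; case: cr => -> _.
exists (r * w); split.
  case: w1 => w1 w1'; case: cr => cr rc; split.
    by rewrite cE -mulrA [c * _]mulrA cr mul1r.
  by rewrite rw cE' -mulrA [r * (c * _)]mulrA rc mul1r.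
rewrite (le_trans (rn_blinM _ _))// mulrC ler_wpM2r ?rn_ge0//.
move: w2; rewrite rnZ; have := rn_ge0 w; have := rn_ge0 k; have := rn_ge0 r; nra.
Qed.

End Neumann.

(** * The Gelfand-Mazur theorem modulo an ideal *)

Section Mazur.
Local Open Scope complex_scope.
Context {R : realType} {C : comPzRingType}.
Variables (iota : {rmorphism R[i] -> C}) (N : C -> R).
Hypothesis N_ge0 : forall u, 0 <= N u.
Hypothesis N_D : forall u v, N (u + v) <= N u + N v.
Hypothesis N_M : forall u v, N (u * v) <= N u * N v.
Hypothesis N_opp : forall u, N (- u) = N u.
Hypothesis N_1 : N 1 <= 1.
Hypothesis N_iota : forall k, N (iota k) <= rn k.
Hypothesis neumann : forall v, N v < 1 ->
  exists w, (1 - v) * w = 1 /\ N w * (1 - N v) <= 1.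

Variable J : C -> Prop.
Hypothesis J0 : J 0.
Hypothesis JD : forall u v, J u -> J v -> J (u + v).
Hypothesis JM : forall u v, J u -> J (u * v).

Let N_X u n : N (u ^+ n) <= N u ^+ n.
Proof.
elim: n => [|n IH]; first by rewrite !expr0.
by rewrite !exprS (le_trans (N_M _ _))// ler_wpM2l.
Qed.

Let JN u : J u -> J (- u). Proof. by move=> /(@JM _ (-1)); rewrite mulrN1. Qed.

Variable x : C.

(** [F] represents the inverse of [1 - z x^n] modulo [J]. A relation, since representatives are not
    unique. *)
Let G n z F := J ((1 - iota z * x ^+ n) * F - 1).

(* Averaging over [z] and [- z] replaces Cauchy's integral: iterated, it averages
   the resolvent over the [2^k]-th roots of unity, as in Rickart's proof that the
   spectrum is not empty. *)
Let halving n z F1 F2 : G n z F1 -> G n (- z) F2 ->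
  G (n * 2) (z ^+ 2) (iota 2^-1 * (F1 + F2)).
Proof.
rewrite /G exprM; move: (x ^+ n) => u j1 j2.
have h : iota 2^-1 + iota 2^-1 = 1.
  by rewrite -rmorphD -(rmorph1 iota) /=; congr (iota _); field.
move: (iota _) h => h hh; rewrite rmorphN/= in j2; rewrite rmorphXn/=.
move: (iota z) j1 j2 => t j1 j2.
have -> : (1 - t ^+ 2 * u ^+ 2) * (h * (F1 + F2)) - 1 =
  ((1 - t * u) * F1 - 1) * (h * (1 + t * u)) +
  ((1 - - t * u) * F2 - 1) * (h * (1 - t * u)).
  by rewrite -[X in _ - X = _]hh; ring.
by apply: JD; exact: JM.
Qed.

Hypothesis J1 : ~ J 1.
Hypothesis resolvent : forall al, exists j c, J j /\ j + (x - iota al) * c = 1.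

Let G_ex z : exists F, G 1 z F.
Proof.
rewrite /G; have [->|z0] := eqVneq z 0.
  by exists 1; rewrite rmorph0 mul0r subr0 mulr1 subrr.
have [j [c [Jj jc]]] := resolvent z^-1; exists (- iota z^-1 * c).
have : iota z * iota z^-1 = 1 by rewrite -rmorphM mulfV// rmorph1.
move: (iota z) (iota z^-1) jc => t t' jc tt.
suff -> : (1 - t * x ^+ 1) * (- t' * c) - 1 = - j by exact: JN.
transitivity ((x - t') * c - 1 + (t * t' - 1) * x * c); first by ring.
by rewrite tt subrr !mul0r addr0 -jc; ring.
Qed.

Let perturb z F v w : G 1 z F -> iota v * x * F = w -> N w <= 2^-1 ->
  exists F', G 1 (z + v) F' /\ N F' <= 2 * N F.
Proof.
rewrite /G !expr1 => j wE w2.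
have [|w' [w1 w'2]] := @neumann w; first by lra.
have {}w'2 : N w' <= 2 by have := N_ge0 w'; nra.
exists (F * w'); split; last first.
  by rewrite (le_trans (N_M _ _))// mulrC ler_wpM2r.
rewrite rmorphD /=; move: wE; move: (iota z) (iota v) j => t t' j wE.
suff -> : (1 - (t + t') * x) * (F * w') - 1 = ((1 - t * x) * F - 1) * w' by exact: JM.
by rewrite -[X in _ - X = _]w1 -wE; ring.
Qed.

(** Representatives chosen at different points need not fit together continuously. By [perturb],
    near each point some choice has at most twice the norm of the one at that point, and compactness
    of a square containing the disc makes the bound uniform. *)
Let G_bounded (rho : R) : exists2 K, 0 < K & forall z, rn z <= rho ->
  exists F, G 1 z F /\ N F <= K.
Proof.
pose P (K : R) (p : R * R) := exists F, G 1 (p.1%:C + 'i * p.2%:C) F /\ N F <= K.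
have cS : compact (`[- rho, rho]%classic `*` `[- rho, rho]%classic : set (R * R)).
  by apply: compact_setX; exact: segment_compact.
have H : forall p : R * R,
    (`[- rho, rho]%classic `*` `[- rho, rho]%classic) p ->
    \forall p' \near p & K \near +oo, P K p'.
  move=> [a b] _; have [F FG] := G_ex (a%:C + 'i * b%:C).
  have xF : 0 <= N x * N F by rewrite mulr_ge0.
  (* A shift with both coordinates below [d] has modulus at most [2 d], so the perturbation has norm
     at most 1/2. *)
  have [d d0 dF] : exists2 d : R, 0 < d & d * (N x * N F + 1) = 4^-1.
    exists (4^-1 / (N x * N F + 1)); first by rewrite divr_gt0// ltr_wpDl.
    by rewrite divfK// gt_eqF// ltr_wpDl.
  exists (ball (a, b) d, [set K | 2 * N F < K]) => /=.
    split; first exact: nbhsx_ballx.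
    by exists (2 * N F); split => //; rewrite num_real.
  move=> [[a' b'] K] /= [[aa bb] FK].
  move: aa bb; rewrite -!ball_normE /= => aa bb.
  pose v := (a' - a)%:C + 'i * (b' - b)%:C : R[i].
  have v2 : rn v <= d * 2.
    rewrite (le_trans (ler_rnD _ _))// rnM !rnR.
    have -> : rn ('i : R[i]) = 1.
      by rewrite /rn normc_def /= expr0n /= add0r expr1n sqrtr1.
    by rewrite mul1r [`|a' - a|]distrC [`|b' - b|]distrC mulr_natr mulr2n lerD// ltW.
  have [|F' [F'1 F'2]] := @perturb _ F v (iota v * x * F) FG erefl.
    apply: le_trans (N_M _ _) _; apply: le_trans (ler_wpM2r _ (N_M _ _)) _ => //.
    rewrite -mulrA; apply: le_trans (ler_wpM2r xF (N_iota _)) _.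
    by apply: le_trans (ler_wpM2r xF v2) _; nra.
  exists F'; split; last by rewrite (le_trans F'2)// ltW.
  suff -> : a'%:C + 'i * b'%:C = a%:C + 'i * b%:C + v by [].
  by rewrite /v !rmorphB /=; ring.
have [K0 [_ KK]] := iffLR (compact_near_coveringP _) cS _ _ P _ H.
pose K := Num.max 1 (K0 + 1); exists K; first by rewrite lt_max ltr01.
move=> z zr; have [||F FG] := KK K _ (complex.Re z, complex.Im z).
- by rewrite lt_max ltrDl ltr01 orbT.
- split; rewrite /= in_itv /= -ler_norml (le_trans _ zr)// -lecR rnE.
    exact: normc_ge_Re.
  have := normc_ge_Re (z * 'i); rewrite normrM ReiNIm normrN.
  by rewrite (_ : `|'i%C| = 1) ?mulr1// normc_def /= expr0n /= add0r expr1n sqrtr1.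
by exists F; rewrite [z in G 1 z]complexE.
Qed.

(** An average of differences is no larger than the differences themselves, so the estimate for
    single resolvents at radii [s] and [s'] survives all halvings, uniformly in [k]. The unit factor
    [ze] is there because halving needs both square roots of it. *)
Let radial (rho K s s' : R) :
    (forall z, rn z <= rho -> exists F, G 1 z F /\ N F <= K) ->
    0 <= s <= rho -> 0 <= s' <= rho -> `|s - s'| * N x * K ^+ 2 <= 4^-1 ->
  forall k ze, rn ze = 1 -> exists F F',
    [/\ G (2 ^ k) (s%:C ^+ (2 ^ k) * ze) F, G (2 ^ k) (s'%:C ^+ (2 ^ k) * ze) F'
      & N (F - F') <= 4^-1].
Proof.
move=> KP /andP[s0 sr] /andP[s'0 s'r] ss; elim=> [|k IH] ze ze1.
  rewrite expn0 !expr1.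
  have [|F [GF FK]] := KP (s%:C * ze); first by rewrite rnM rnR ze1 mulr1 ger0_norm.
  have [|F' [GF' FK']] := KP (s'%:C * ze); first by rewrite rnM rnR ze1 mulr1 ger0_norm.
  (* The resolvent identity holds only modulo [J]; taking its right-hand side as the new
     representative makes the norm of the difference computable. *)
  exists F, (F - iota (s%:C * ze - s'%:C * ze) * x * F * F'); split => //.
    move: GF GF'; rewrite /G !expr1 rmorphB /=.
    move: (iota (s%:C * ze)) (iota (s'%:C * ze)) => t t' j j'.
    have -> : (1 - t' * x) * (F - (t - t') * x * F * F') - 1 =
      ((1 - t * x) * F - 1) + ((1 - t' * x) * F' - 1) * - ((t - t') * x * F).
      by ring.
    by apply: JD => //; exact: JM.
  rewrite (_ : F - (F - _) = iota (s%:C * ze - s'%:C * ze) * x * F * F'); last by ring.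
  apply: le_trans ss; rewrite expr2 mulrA.
  have i1 : N (iota (s%:C * ze - s'%:C * ze) * x) <= `|s - s'| * N x.
    apply: le_trans (N_M _ _) _; apply: ler_wpM2r => //.
    apply: le_trans (N_iota _) _.
    by rewrite -mulrBl rnM ze1 mulr1 -rmorphB rnR.
  apply: le_trans (N_M _ _) _; apply: ler_pM => //.
  by apply: le_trans (N_M _ _) _; apply: ler_pM.
pose w := sqrtC ze.
have w1 : rn w = 1.
  apply/eqP; rewrite -(@eqrXn2 _ 2)// ?rn_ge0// expr1n -rnX sqrtCK.
  by rewrite ze1.
have [F1 [F1' [G1 G1' N1]]] := IH w w1.
have [|F2 [F2' [G2 G2' N2]]] := IH (- w); first by rewrite rnN.
exists (iota 2^-1 * (F1 + F2)), (iota 2^-1 * (F1' + F2')); rewrite expnSr.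
have E (r : R) : r%:C ^+ (2 ^ k * 2) * ze = (r%:C ^+ (2 ^ k) * w) ^+ 2.
  by rewrite exprMn -exprM sqrtCK.
split; first by rewrite E; apply: halving; rewrite // -mulrN.
  by rewrite E; apply: halving; rewrite // -mulrN.
rewrite -mulrBr opprD addrACA (le_trans (N_M _ _))//.
have : N (iota 2^-1) <= 2^-1.
  by apply: le_trans (N_iota _) _; rewrite rnV rn_nat.
have := N_D (F1 - F1') (F2 - F2'); have := N_ge0 (iota 2^-1).
by have := N_ge0 ((F1 - F1') + (F2 - F2')); nra.
Qed.

(* [(s x)^(2^k)] tends to 0 modulo [J] *)
Let dies (s : R) := forall e : R, 0 < e -> exists k0, forall k, (k0 <= k)%N ->
  exists j, J j /\ N (iota s%:C ^+ (2 ^ k) * x ^+ (2 ^ k) - j) <= e.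

(** Where the powers die, the averaged resolvent is nearly 1 modulo [J]. By [radial] the one at
    radius [s'] is within 1/4 of it, hence invertible with inverse of norm at most 2, which bounds
    [(s' x)^(2^k)] by [1 + 2] modulo [J]. The ratio [(s''/s')^(2^k)] then sends it to 0. *)
Let dies_step (rho K s s'' s' : R) :
    (forall z, rn z <= rho -> exists F, G 1 z F /\ N F <= K) ->
    dies s -> 0 <= s -> s <= s'' -> s'' < s' -> s' <= rho ->
    (s' - s) * N x * K ^+ 2 <= 4^-1 -> dies s''.
Proof.
move=> KP Ps s0 ss'' s''s' s'r ss.
have [k0 hk0] : exists k0, forall k, (k0 <= k)%N ->
    exists j, J j /\ N (iota s'%:C ^+ (2 ^ k) * x ^+ (2 ^ k) - j) <= 3.
  have [|k0 hk0] := Ps 8^-1; first by rewrite invr_gt0.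
  exists k0 => k /hk0 [j [Jj Nj]].
  have [||| F [F' [GF GF' FF]]] := @radial rho K s s' KP _ _ _ k 1 rn1.
  - by rewrite s0 (le_trans ss'')// (le_trans (ltW s''s')).
  - by rewrite s'r andbT (le_trans s0)// (le_trans ss'')// ltW.
  - by rewrite distrC ger0_norm// subr_ge0 (le_trans ss'')// ltW.
  move: GF GF' Nj; rewrite /G !mulr1 !rmorphXn/=.
  move: (x ^+ _) (iota s%:C ^+ _) (iota s'%:C ^+ _) => u t t' GF GF' Nj.
  have [|w [w1 w2]] := @neumann (t * u - j); first lra.
  have Nw := N_ge0 w.
  (* [F] is congruent to [w = (1 - v)^-1], hence close to 1 *)
  pose g := - (w * (t * u - j)) - (F' - F).
  have Ng : N g <= 2^-1.
    apply: le_trans (N_D _ _) _; rewrite !N_opp -[N (F' - F)]N_opp opprB.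
    have := N_M w (t * u - j); have := N_ge0 (t * u - j); nra.
  have [|y [y1 y2]] := @neumann g; first lra.
  have Ny := N_ge0 y.
  pose j2 := w * ((1 - t * u) * F - 1 + j * F).
  have Jj2 : J j2 by rewrite /j2 mulrC; apply: JM; apply: JD => //; exact: JM.
  have F'E : F' = 1 - g + j2.
    rewrite /g /j2; transitivity (F' - F + F * 1 + (1 - (1 - (t * u - j)) * w)).
      by rewrite w1; ring.
    by rewrite -{1}w1; ring.
  pose j3 := y * ((1 - t' * u) * F' - 1) - y * (1 - t' * u) * j2.
  have Jj3 : J j3.
    apply: JD; first by rewrite mulrC; exact: JM.
    by apply: JN; rewrite mulrC; exact: JM.
  exists (- j3); split; first exact: JN.
  have -> : t' * u - - j3 = 1 - y.
    rewrite /j3 F'E; transitivity (1 - y + (1 - t' * u) * ((1 - g) * y - 1)).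
      by ring.
    by rewrite y1; ring.
  have Ny2 : N y <= 2 by nra.
  by apply: le_trans (N_D _ _) _; rewrite N_opp (le_trans (lerD N_1 Ny2))//; lra.
move=> e e0.
have s'0 : 0 < s' by lra.
have [|||N0 hN0] := @exprn_lt _ (s'' / s') (e / 3).
- by rewrite divr_ge0//; lra.
- by rewrite ltr_pdivrMr ?mul1r.
- by rewrite divr_gt0.
exists (maxn k0 N0) => k; rewrite geq_max => /andP[/hk0 [j [Jj Nj]] kN].
have {}hN0 := hN0 (2 ^ k)%N (leq_trans kN (ltnW (ltn_expl k (ltnSn 1)))).
exists (iota ((s'' / s') ^+ (2 ^ k))%:C * j); split; first by rewrite mulrC; exact: JM.
rewrite -[s'' in iota s''%:C](divfK (lt0r_neq0 s'0)).
move: hN0; set q := _ / s' => hN0.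
rewrite rmorphM rmorphM exprMn -mulrA -!rmorphXn -mulrBr !rmorphXn /=.
apply: le_trans (N_M _ _) _.
have : N (iota q%:C ^+ (2 ^ k)) <= q ^+ (2 ^ k).
  rewrite -rmorphXn -rmorphXn; apply: le_trans (N_iota _) _.
  by rewrite rnR ger0_norm// exprn_ge0// divr_ge0//; lra.
have := N_ge0 (iota q%:C ^+ (2 ^ k)).
move: Nj; set a := N _; set b := N _; set c := q ^+ _ in hN0 *.
by have : 0 <= a := N_ge0 _; nra.
Qed.

Let dies0 : dies 0.
Proof.
move=> e e0; exists 0 => k _; exists 0; split => //.
rewrite rmorph0 expr0n expn_eq0/= mul0r subr0 -(rmorph0 iota).
by rewrite (le_trans (N_iota _))// rn0 ltW.
Qed.

Let dies_all (s : R) : 0 <= s -> dies s.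
Proof.
move=> s0; have [->|sn0] := eqVneq s 0.
  exact: dies0.
have {sn0}s0 : 0 < s by rewrite lt_def sn0.
(* The interval from 0 to [s] is crossed in [M] steps of length [d]; each uses the auxiliary radius
   [(i + 2) d], which stays below [2 s]. [M] is so large that radii [2 d] apart satisfy the
   closeness condition of [dies_step]. *)
have [K K0 KP] := G_bounded (2 * s).
have [M M0 hM] : exists2 M : nat, (0 < M)%N & 2 * s * N x * K ^+ 2 * 4 <= M%:R.
  have [M hM] : exists M : nat, 2 * s * N x * K ^+ 2 * 4 < M%:R.
    exists (Num.bound `|2 * s * N x * K ^+ 2 * 4|).
    exact: le_lt_trans (ler_norm _) (archi_boundP (normr_ge0 _)).
  by exists M.+1 => //; rewrite ltW// (lt_trans hM)// ltr_nat.
have Mr : 0 < M%:R :> R by rewrite ltr0n.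
pose d := s / M%:R.
have dM : d * M%:R = s by rewrite divfK// gt_eqF.
have d0 : 0 < d by rewrite divr_gt0.
have P i : (i <= M)%N -> dies (i%:R * d).
  elim: i => [_|i IH iM].
    by rewrite mul0r; exact: dies0.
  have iM' : i.+1%:R <= M%:R :> R by rewrite ler_nat.
  have iE : i.+1%:R = i%:R + 1 :> R by rewrite -natr1.
  have i0 : 0 <= i%:R :> R by rewrite ler0n.
  have M1 : 1 <= M%:R :> R by rewrite ler1n.
  apply: (@dies_step (2 * s) K (i%:R * d) _ ((i%:R + 2) * d) KP (IH (ltnW iM))).
  - by rewrite mulr_ge0// ltW.
  - by rewrite iE; nra.
  - by rewrite iE; nra.
  - by rewrite -dM; nra.
  - rewrite -(ler_pM2r Mr).
    have -> : ((i%:R + 2) * d - i%:R * d) * N x * K ^+ 2 * M%:R =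
        2 * (d * M%:R) * N x * K ^+ 2 by ring.
    by rewrite dM; lra.
by rewrite -dM mulrC; exact: P.
Qed.

(** The powers of [s x] tend to 0 modulo [J] for every [s], but [x] has an inverse [c] modulo [J].
    For [s = N c + 1] the element [y = (c/s)^n ((s x)^n - j')] has norm at most 1/2 and is congruent
    to 1, so the invertible element [1 - y] lies in [J]. *)
Lemma no_resolvent : False.
Proof.
have [j [c [Jj jc]]] := resolvent 0.
have c0 := N_ge0 c.
have [||k0 hk0] := @dies_all (N c + 1) _ 2^-1; first by rewrite addr_ge0.
  by rewrite invr_gt0.
have [j' [Jj' Nj']] := hk0 k0 (leqnn _).
move: {k0 hk0}(2 ^ k0)%N Nj' => n; set v := _ - j' => Nv.
have s0 : 0 < N c + 1 by lra.
pose t := iota (N c + 1)^-1%:C.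
have tE : t * iota (N c + 1)%:C = 1.
  by rewrite -rmorphM -rmorphM/= mulVf ?gt_eqF// !rmorph1.
pose y := t ^+ n * c ^+ n * v.
have Jy : J (1 - y).
  have -> : 1 - y = t ^+ n * c ^+ n * j' - ((x * c) ^+ n - 1).
    rewrite /y /v mulrBr opprB addrCA; congr (_ + _).
    have -> : t ^+ n * c ^+ n * (iota (N c + 1)%:C ^+ n * x ^+ n) =
      (t * iota (N c + 1)%:C) ^+ n * (x * c) ^+ n by rewrite !exprMn; ring.
    by rewrite tE expr1n mul1r opprB.
  apply: JD; first by rewrite mulrC; exact: JM.
  apply: JN; rewrite subrX1; apply: JM.
  by move: jc; rewrite rmorph0 subr0 => <-; rewrite opprD addrCA subrr addr0; exact: JN.
have Nt : N t <= (N c + 1)^-1.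
  apply: le_trans (N_iota _) _.
  by rewrite rnR ger0_norm// invr_ge0 ltW.
have Ny : N y <= 2^-1.
  apply: le_trans (N_M _ _) _; rewrite -exprMn -[leRHS]mul1r ler_pM//.
  apply: le_trans (N_X _ _) _; apply: exprn_ile1 => //.
  apply: le_trans (N_M _ _) _; apply: le_trans (ler_wpM2r c0 Nt) _.
  by rewrite mulrC ler_pdivrMr// mul1r lerDl.
have [|w [w1 _]] := @neumann y; first lra.
by apply: J1; rewrite -w1; exact: JM.
Qed.

End Mazur.

(** * Joint spectra of commuting pairs and Drazin invertibility of products *)

Section JointSpectrum.
Local Open Scope complex_scope.
Context {R : realType} {E : completeNormedModType R[i]} (a b : blin E E)
  (ab : a * b = b * a).
Notation C := (bicomm ab).

Definition proper_ideal (J : C -> Prop) :=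
  [/\ J 0, forall u v, J u -> J v -> J (u + v),
      forall u v, J u -> J (u * v) & ~ J 1].

Lemma scalar_bicommutes (k : R[i]) : k *: (1 : blin E E) \in bicommutes a b.
Proof. by apply/asboolP => w _ _; exact: blin_cst_comm. Qed.

Definition scalar_bicomm (k : R[i]) : C := Bicomm ab (scalar_bicommutes k).

Lemma scalar_bicomm_additive : additive scalar_bicomm.
Proof. by move=> k l; apply: val_inj; exact: scalerBl. Qed.

Lemma scalar_bicomm_multiplicative : multiplicative scalar_bicomm.
Proof.
split; last by apply: val_inj; exact: scale1r.
move=> k l; apply: val_inj => /=.
change ((k * l) *: (1 : blin E E) = (k *: (1 : blin E E)) * (l *: (1 : blin E E))).
by rewrite -blin_scalerAl mul1r scalerA.
Qed.

HB.instance Definition _ :=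
  GRing.isAdditive.Build R[i] C scalar_bicomm scalar_bicomm_additive.
HB.instance Definition _ :=
  GRing.isMultiplicative.Build R[i] C scalar_bicomm scalar_bicomm_multiplicative.

(** If [J] and [x - al] generated the whole ring for every [al], then [x] would have a resolvent
    modulo [J] at every scalar, against [no_resolvent]. *)
Lemma ideal_extension (J : C -> Prop) (x : C) : proper_ideal J ->
  exists al J', [/\ proper_ideal J', forall u, J u -> J' u & J' (x - scalar_bicomm al)].
Proof.
move=> [J0 JD JM J1].
suff [al h] : exists al, forall j c, J j -> j + (x - scalar_bicomm al) * c <> 1.
  exists al, (fun u => exists j c, J j /\ j + (x - scalar_bicomm al) * c = u).
  split; first split.
  - by exists 0, 0; rewrite mulr0 addr0.
  - move=> _ _ [j [c [Jj <-]]] [j' [c' [Jj' <-]]]; exists (j + j'), (c + c').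
    by split; [exact: JD|ring].
  - move=> _ v [j [c [Jj <-]]]; exists (j * v), (c * v).
    by split; [exact: JM|ring].
  - by move=> [j [c [Jj jc]]]; exact: (h _ _ Jj jc).
  - by move=> u Ju; exists u, 0; rewrite mulr0 addr0.
  - by exists 0, 1; rewrite mulr1 add0r.
apply: contrapT => /forallNP h.
apply: (@no_resolvent R C scalar_bicomm (fun u => rn (bicomm_val u)) _ _ _ _ _ _ _
  J J0 JD JM x J1).
- by move=> u; exact: rn_ge0.
- by move=> u v; exact: ler_rnD.
- by move=> u v; exact: rn_blinM.
- by move=> u; exact: rnN.
- exact: rn_blin1.
- move=> k; change (rn (k *: (1 : blin E E)) <= rn k).
  rewrite rnZ; apply: le_trans (ler_wpM2l (rn_ge0 _) rn_blin1) _.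
  by rewrite mulr1.
- move=> v /neumann [w [w1 w2]].
  have [w' [w'1 w'2]] : exists w' : C, (1 - v) * w' = 1 /\
      inverse_pair (bicomm_val (1 - v)) (bicomm_val w').
    by apply: bicomm_inv; exists w.
  by exists w'; split => //; rewrite (inverse_unique w'2 w1).
- move=> al; have /existsNP [j /existsNP [c /not_implyP [Jj /contrapT jc]]] := h al.
  by exists j, c.
Qed.

Lemma joint_spectrum (J : C -> Prop) : proper_ideal J ->
  exists al be J', [/\ proper_ideal J', forall u, J u -> J' u,
    J' (bicomm_l ab - scalar_bicomm al), J' (bicomm_r ab - scalar_bicomm be)
    & spectrum a al /\ spectrum b be].
Proof.
move=> /(ideal_extension (bicomm_l ab)) [al [J' [J'P JJ' Ja]]].
have [be [J'' [J''P J'J'' Jb]]] := ideal_extension (bicomm_r ab) J'P.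
have [_ _ JM J1] := J''P.
have noinv (u : C) : J'' u -> ~ invertible (bicomm_val u).
  by move=> Ju /bicomm_inv [v [uv _]]; apply: J1; rewrite -uv; exact: JM.
exists al, be, J''; split => //; first by move=> u /JJ' /J'J''.
  exact: J'J''.
by split; [apply: (noinv _ (J'J'' _ Ja))|apply: (noinv _ Jb)].
Qed.

(* The elements [r] with [r c^k \in c^(k+1) C] for some [k] form an ideal, which
   is improper exactly when [c] is Drazin invertible.  Modulo a maximal ideal
   containing it, [a] and [b] are scalars [al] and [be] with [al be = lam]. *)
Lemma drazin_mul lam :
  (forall al be, spectrum a al -> spectrum b be -> al * be = lam ->
    drazin_invertible (a - al *: (1 : blin E E)) /\
    drazin_invertible (b - be *: (1 : blin E E))) ->
  drazin_invertible (a * b - lam *: (1 : blin E E)).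
Proof.
move=> h; pose c := bicomm_l ab * bicomm_r ab - scalar_bicomm lam.
apply/(bicomm_drazin c).
pose J (r : C) := exists k d, r * c ^+ k = c ^+ k.+1 * d.
suff [k [d]] : J 1 by rewrite mul1r => kd; exists d, k.
apply: contrapT => J1.
have JP : proper_ideal J.
  split => //.
  - by exists 0, 0; rewrite mul0r mulr0.
  - move=> u v [k [d kd]] [l [e le]]; exists (k + l)%N, (d + e).
    transitivity ((u * c ^+ k) * c ^+ l + (v * c ^+ l) * c ^+ k).
      by rewrite exprD; ring.
    by rewrite kd le !exprS exprD; ring.
  - move=> u v [k [d kd]]; exists k, (d * v).
    by rewrite mulrAC kd mulrA.
have [al [be [J' [J'P JJ' Ja Jb [sa sb]]]]] := joint_spectrum JP.
have [_ JD JM J'1] := J'P.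
have Jc : J' c by apply: JJ'; exists 0, 1; rewrite expr0 expr1.
pose x := bicomm_l ab - scalar_bicomm al; pose y := bicomm_r ab - scalar_bicomm be.
(* Modulo [J'] only the scalar [al be - lam] remains; as [c] is in [J'], this scalar must vanish. *)
have cE : c = x * bicomm_r ab + scalar_bicomm al * y +
    scalar_bicomm (al * be - lam).
  by rewrite /c /x /y rmorphB rmorphM /=; ring.
have albe : al * be = lam.
  apply/eqP; rewrite -subr_eq0; apply/negP => /negP ne; apply: J'1.
  have -> : 1 = (c + (x * - bicomm_r ab + y * - scalar_bicomm al)) *
      scalar_bicomm (al * be - lam)^-1.
    have : scalar_bicomm (al * be - lam) * scalar_bicomm (al * be - lam)^-1 = 1.
      by rewrite -rmorphM /= mulfV// rmorph1.
    rewrite cE; move: (scalar_bicomm (_ - _)) (scalar_bicomm _^-1) => u v <-.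
    by ring.
  by apply/JM/JD => //; apply: JD; exact: JM.
have [/(bicomm_drazin x) [d [k kd]] /(bicomm_drazin y) [e [l le]]] := h _ _ sa sb albe.
have {}cE : c = x * bicomm_r ab + scalar_bicomm al * y.
  by rewrite cE albe subrr rmorph0 addr0.
have xk n : x ^+ (k + n) * (1 - x * d) = 0.
  by rewrite exprD mulrAC mulrBr mulr1 mulrA -exprSr -kd subrr mul0r.
have yl n : y ^+ (l + n) * (1 - y * e) = 0.
  by rewrite exprD mulrAC mulrBr mulr1 mulrA -exprSr -le subrr mul0r.
(* In the binomial expansion of [c^(k+l)] every term contains [x^k], killed by [1 - x d], or [y^l],
   killed by [1 - y e]. *)
have Jpq : J ((1 - x * d) * (1 - y * e)).
  exists (k + l)%N, 0; rewrite mulr0 cE exprDn mulr_sumr big1// => i _.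
  rewrite mulrnAr; have [ik|ik] := leqP k (k + l - i).
    rewrite -(subnKC ik) !exprMn; set m := (_ - k)%N.
    transitivity ((x ^+ (k + m) * (1 - x * d)) * (bicomm_r ab ^+ (k + m) *
      (scalar_bicomm al ^+ i * y ^+ i) * (1 - y * e)) *+ 'C(k + l, i)); first by ring.
    by rewrite xk mul0r mul0rn.
  have il : (l <= i)%N.
    rewrite leqNgt; apply/negP => il; move: ik.
    by rewrite ltnNge -addnBA ?leq_addr// ltnW.
  rewrite !exprMn -(subnKC il).
  set m := (i - l)%N; set n := (_ - (l + m))%N.
  transitivity ((y ^+ (l + m) * (1 - y * e)) * (x ^+ n * bicomm_r ab ^+ n *
      scalar_bicomm al ^+ (l + m) * (1 - x * d)) *+ 'C(k + l, l + m)); first by ring.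
  by rewrite yl mul0r mul0rn.
apply: J'1.
have -> : 1 = (1 - x * d) * (1 - y * e) + (x * d + y * (e * (1 - x * d))) by ring.
by apply: (JD); [exact: JJ'|apply: (JD); exact: JM].
Qed.

(** If [c^m] is not 0, its annihilator is a proper ideal containing [1 - c d]. The enlarged ideal of
    [joint_spectrum] contains [a] itself, as [al = 0], hence [c d] and so 1. *)
Lemma quasinilpotent_drazin_mul : spectrum a `<=` [set 0] -> spectrum b `<=` [set 0] ->
  drazin_invertible (a * b) -> exists m, (a * b) ^+ m = 0.
Proof.
move=> sa sb; pose c := bicomm_l ab * bicomm_r ab.
move=> /(bicomm_drazin c) [d [m cm]]; exists m.
change (bicomm_val c ^+ m = 0); rewrite -bicomm_valX.
suff -> : c ^+ m = 0 by [].
apply: contrapT => cm0; pose J (r : C) := r * c ^+ m = 0.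
have JP : proper_ideal J.
  split; rewrite /J ?mul0r ?mul1r//.
    by move=> u v u0 v0; rewrite mulrDl u0 v0 addr0.
  by move=> u v u0; rewrite mulrAC u0 mul0r.
have [al [be [J' [J'P JJ' Ja Jb [/sa al0 /sb be0]]]]] := joint_spectrum JP.
have [_ JD JM J'1] := J'P.
apply: J'1; have -> : 1 = 1 - c * d + c * d by rewrite subrK.
apply: JD.
  by apply: JJ'; rewrite /J mulrBl mul1r mulrAC -exprS -cm subrr.
apply: (JM); move: Ja; rewrite al0 rmorph0 subr0.
exact: JM.
Qed.

End JointSpectrum.

(** [joint_spectrum] for the pair [(a, a)] and the zero ideal, which is proper unless the space is
    zero. *)
Lemma spectrum_neq0 {R : realType} {E : completeNormedModType R[i]} (a : blin E E) :
  spectrum a = set0 -> (1 : blin E E) = 0.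
Proof.
move=> sa; apply: contrapT => h.
pose J (u : bicomm (erefl (a * a))) := u = 0.
have JP : proper_ideal J.
  split; rewrite /J.
  - by [].
  - by move=> u v -> ->; rewrite addr0.
  - by move=> u v ->; rewrite mul0r.
  - by move=> /(congr1 bicomm_val); exact: h.
by have [al [be [J' [_ _ _ _ [+ _]]]]] := joint_spectrum JP; rewrite sa.
Qed.

(** * The Hahn-Banach theorem *)

Section HahnBanach.
Local Open Scope complex_scope.
Context {R : realType}.

Lemma le_inf_add (A B : set R) c : A !=set0 -> B !=set0 ->
  (forall a b, A a -> B b -> c <= a + b) -> c <= inf A + inf B.
Proof.
move=> A0 B0 h; rewrite -lerBlDr; apply: lb_le_inf => // a Aa.
rewrite lerBlDr -lerBlDl; apply: lb_le_inf => // b Bb.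
by rewrite lerBlDl h.
Qed.

Section Real.
Context {V : lmodType R[i]}.
Implicit Types (p q : V -> R) (x y : V).

(** One inequality for positive homogeneity is what infima yield directly; [sublinearZ] recovers
    equality. *)
Definition sublinear p :=
  [/\ p 0 = 0, forall x y, p (x + y) <= p x + p y
    & forall (t : R) x, 0 < t -> p (t%:C *: x) <= t * p x].

Lemma sublinearZ p (t : R) x : sublinear p -> 0 <= t -> p (t%:C *: x) = t * p x.
Proof.
move=> [p0 _ pZ]; rewrite le_eqVlt => /predU1P[<-|t0].
  by rewrite scale0r p0 mul0r.
apply/eqP; rewrite eq_le pZ//= -ler_pdivlMl//.
have := pZ t^-1 (t%:C *: x); rewrite invr_gt0 => /(_ t0).
by rewrite scalerA -rmorphM/= mulVf ?gt_eqF// scale1r.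
Qed.

Lemma sublinear_ge p q x : sublinear q -> (forall x, q x <= p x) -> - p (- x) <= q x.
Proof.
move=> [q0 qD _] qp; rewrite lerNl (le_trans _ (qp _))//.
by rewrite -subr_ge0 opprK addrC -q0 -[X in q X <= _](subrr x) qD.
Qed.

(* The largest sublinear minorant of [p] that is additive along [y]. *)
Lemma sublinear_shift p y : sublinear p -> exists q, [/\ sublinear q,
  forall x, q x <= p x & forall x, q x <= p (x + y) - p y].
Proof.
move=> ps; have [p0 pD pZ] := ps.
pose A x := [set p (x + t%:C *: y) - t * p y | t in [set t | 0 <= t]].
have A0 x : A x !=set0 by exists (p (x + 0%:C *: y) - 0 * p y); exists 0 => /=.
have Alb x : has_lbound (A x).
  exists (- p (- x)) => _ [t /= t0 <-].
  rewrite -(sublinearZ _ ps t0) lerBrDr addrC lerBlDr.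
  by have := pD (x + t%:C *: y) (- x); rewrite addrAC subrr add0r.
have Aq x t : 0 <= t -> inf (A x) <= p (x + t%:C *: y) - t * p y.
  by move=> t0; apply: ge_inf => //; exists t.
exists (fun x => inf (A x)); split; first split.
- apply/eqP; rewrite eq_le; apply/andP; split.
    by have := Aq 0 0 (lexx _); rewrite scale0r addr0 p0 mul0r subrr.
  by apply: lb_le_inf => // _ [t /= t0 <-]; rewrite add0r (sublinearZ _ ps t0) subrr.
- move=> x x'; apply: le_inf_add => // _ _ [t /= t0 <-] [t' /= t'0 <-].
  apply: le_trans (Aq _ (t + t') (addr_ge0 t0 t'0)) _.
  rewrite rmorphD /= scalerDl mulrDl opprD addrACA [leRHS]addrACA lerD2r.
  exact: pD.
- move=> t x t0; rewrite -ler_pdivrMl//; apply: lb_le_inf => // _ [s /= s0 <-].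
  rewrite ler_pdivrMl//; apply: le_trans (Aq _ (t * s) _) _; first exact/mulr_ge0/s0/ltW.
  rewrite rmorphM /= -scalerA -scalerDr sublinearZ ?(ltW t0)//.
  by rewrite mulrBr mulrA.
- by move=> x; have := Aq x 0 (lexx _); rewrite scale0r addr0 mul0r subr0.
- by move=> x; have := Aq x 1 ler01; rewrite scale1r mul1r.
Qed.

(** Instead of extending from subspaces, Zorn's lemma gives a minimal sublinear functional: it
    equals each of its own shifts, hence is additive. Starting below the shift [p1] of [p] along
    [x0] forces [g (- x0) <= - p x0], which is the equality at [x0]. *)
Lemma hahn_banach_real p x0 : sublinear p -> exists g : V -> R,
  [/\ forall x y, g (x + y) = g x + g y, forall (t : R) x, g (t%:C *: x) = t * g x,
      forall x, g x <= p x & g x0 = p x0].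
Proof.
move=> ps; have [p1 [p1s p1p p1x]] := sublinear_shift x0 ps.
pose T := {q : V -> R | sublinear q /\ forall x, q x <= p1 x}.
pose r (f g : T) := `[< forall x, sval g x <= sval f x >].
have [||||[g [gs gp]] /= gmin] := @Zorn T r.
- by move=> f; apply/asboolP.
- move=> f g h /asboolP fg /asboolP gh; apply/asboolP => x.
  exact: le_trans (gh x) (fg x).
- move=> [f fP] [g gP] /asboolP fg /asboolP gf; apply: eq_exist => /=.
  by apply/funext => x; apply/eqP; rewrite eq_le gf fg.
- move=> A Atot; have [[f0 Af0]|A0] := pselect (A !=set0); last first.
    by exists (exist _ p1 (conj p1s (fun x => lexx _))) => f Af; case: A0; exists f.
  pose B x := [set sval f x | f in A].
  have B0 x : B x !=set0 by exists (sval f0 x); exists f0.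
  have Blb x : has_lbound (B x).
    by exists (- p1 (- x)) => _ [[f [fs fp]] /= Af <-]; exact: sublinear_ge.
  have Bq f x : A f -> inf (B x) <= sval f x by move=> Af; apply: ge_inf => //; exists f.
  have qs : sublinear (fun x => inf (B x)).
    split.
    + rewrite (_ : B 0 = [set 0]) ?inf1//; apply/seteqP; split => [_ [f Af <-]|_ ->].
        by case: (svalP f) => -[].
      by exists f0 => //; case: (svalP f0) => -[].
    + move=> x y; apply: le_inf_add => // _ _ [f Af <-] [h Ah <-].
      have [/asboolP fh|/asboolP hf] := Atot _ _ Af Ah.
        apply: le_trans (Bq h _ Ah) _; case: (svalP h) => -[_ hD _] _.
        by apply: le_trans (hD _ _) _; rewrite lerD2r.
      apply: le_trans (Bq f _ Af) _; case: (svalP f) => -[_ fD _] _.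
      by apply: le_trans (fD _ _) _; rewrite lerD2l.
    + move=> t x t0; rewrite -ler_pdivrMl//; apply: lb_le_inf => // _ [f Af <-].
      rewrite ler_pdivrMl//; apply: le_trans (Bq f _ Af) _.
      by case: (svalP f) => -[_ _ fZ] _; exact: fZ.
  have qp x : inf (B x) <= p1 x.
    by apply: le_trans (Bq f0 _ Af0) _; case: (svalP f0) => _; apply.
  exists (exist _ (fun x => inf (B x)) (conj qs qp)) => f Af.
  by apply/asboolP => x; exact: Bq.
have {}gmin q : sublinear q -> (forall x, q x <= g x) -> q = g.
  move=> qs qg; have qp x : q x <= p1 x := le_trans (qg x) (gp x).
  by have := gmin (exist _ q (conj qs qp)) (asboolT qg) => /(congr1 sval).
have [g0 gD gZ] := gs.
have gA x y : g (x + y) = g x + g y.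
  apply/eqP; rewrite eq_le gD /=.
  have [q [qs qg qy]] := sublinear_shift y gs.
  by rewrite -{1}(gmin q qs qg) -lerBrDr.
have gN x : g (- x) = - g x.
  by apply/eqP; rewrite -subr_eq0 opprK -gA addNr g0.
exists g; split => //.
- move=> t x; have [t0|t0] := leP 0 t; first exact: sublinearZ.
  have := @sublinearZ g (- t) x gs; rewrite oppr_ge0 (ltW t0) => /(_ isT).
  by rewrite rmorphN scaleNr gN mulNr => /oppr_inj.
- by move=> x; exact: le_trans (gp x) (p1p x).
- apply/eqP; rewrite eq_le (le_trans (gp x0) (p1p x0)) /=.
  rewrite -lerN2 -gN (le_trans (gp _))// (le_trans (p1x _))//.
  by rewrite addNr; case: ps => -> _ _; rewrite sub0r.
Qed.

End Real.

Lemma hahn_banach {V : normedModType R[i]} (p : V -> R) (M : R) (x0 : V) :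
    (forall x y, p (x + y) <= p x + p y) ->
    (forall k x, p (k *: x) = rn k * p x) ->
    (forall x, p x <= M * rn x) ->
  exists f : blin V R[i], (forall x, rn (f x) <= p x) /\ rn (f x0) = p x0.
Proof.
move=> pD pZ pM.
have ps : sublinear p.
  split => //; first by have := pZ 0 0; rewrite scale0r rn0 mul0r.
  by move=> t x t0; rewrite pZ rnR ger0_norm// ltW.
have [g [gD gZ gp gx0]] := hahn_banach_real x0 ps.
have gN x : g (- x) = - g x.
  by have := gZ (-1) x; rewrite rmorphN1 scaleN1r mulN1r.
(* The complex-linear functional with real part [g]; its modulus is bounded by rotating [f x] onto
   the positive axis. *)
pose f x : R[i] := (g x)%:C - 'i%C * (g ('i%C *: x))%:C.
have ii : 'i%C * 'i%C = -1 :> R[i] by rewrite -expr2 sqr_i.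
have fD x y : f (x + y) = f x + f y.
  by rewrite /f scalerDr !gD !rmorphD /=; ring.
have fR (t : R) x : f (t%:C *: x) = t%:C * f x.
  by rewrite /f scalerA [_ * t%:C]mulrC -scalerA !gZ !rmorphM /=; ring.
have fi x : f ('i%C *: x) = 'i%C * f x.
  by rewrite /f scalerA ii scaleN1r gN rmorphN /= mulrBr mulrA ii; ring.
have fZ k x : f (k *: x) = k * f x.
  by rewrite [k]complexE scalerDl fD fR -scalerA fi fR; ring.
have fRe x : complex.Re (f x) = g x.
  by rewrite /f /= !mul0r !mul1r subrr oppr0 addr0.
have fp x : rn (f x) <= p x.
  have [->|fx0] := eqVneq (f x) 0.
    have := pD x (- x); rewrite subrr rn0.
    have -> : p 0 = 0 by case: ps.
    have -> : p (- x) = p x by rewrite -scaleN1r pZ rnN rn1 mul1r.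
    by rewrite -mulr2n pmulrn_lge0.
  have nf : (rn (f x))%:C != 0 by rewrite rnE normr_eq0.
  pose u := (rn (f x))%:C / f x.
  have fu : f (u *: x) = (rn (f x))%:C by rewrite fZ /u divfK.
  have := gp (u *: x); rewrite -fRe fu pZ /= (_ : rn u = 1) ?mul1r//.
  rewrite rnM rnV rnR ger0_norm ?rn_ge0// divff//.
  by apply: contra_neq nf => ->.
have fP : is_bounded_linear (f : V -> R[i]).
  split; first by move=> k x y; rewrite fD fZ.
  by exists M%:C => x; rewrite -!rnE -rmorphM lecR; exact: le_trans (fp x) (pM x).
exists (@Blin R V R[i] f (asboolT fP)); split => //=.
apply/eqP; rewrite eq_le fp /= -gx0 -fRe -lecR rnE.
apply: le_trans (normc_ge_Re _).
by rewrite lecR ler_norm.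
Qed.

Lemma norming_functional {V : normedModType R[i]} (x : V) :
  exists f : blin V R[i], (forall y, rn (f y) <= rn y) /\ rn (f x) = rn x.
Proof.
apply: (@hahn_banach V rn 1 x); first exact: ler_rnD.
  exact: rnZ.
by move=> y; rewrite mul1r.
Qed.

End HahnBanach.

(** * Approximate spectra *)

Section ApproximateSpectrum.
Local Open Scope complex_scope.
Context {R : realType}.

(** The strict inequality excludes [x = 0], so these are approximate null vectors without
    normalisation. *)
Definition not_bounded_below {U V : normedModType R[i]} (c : U -> V) :=
  forall e : R, 0 < e -> exists x, rn (c x) < e * rn x.

(** The Banach space adjoint of [c]. *)
Definition precomp {U V : normedModType R[i]} (c : blin U V) (f : blin V R[i]) :
  blin U R[i] := blin_comp f c.

Lemma bounded_below {U V : normedModType R[i]} (c : U -> V) :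
  ~ not_bounded_below c -> exists2 e : R, 0 < e & forall x, e * rn x <= rn (c x).
Proof.
move=> /existsNP [e /not_implyP [e0 /forallNP h]]; exists e => // x.
by rewrite leNgt; apply/negP/h.
Qed.

(** The distance to the range of [c] is a seminorm. Hahn-Banach gives a functional that vanishes on
    the range and attains this distance at [x]; the adjoint kills it, so it is 0 and the distance is
    too. *)
Lemma dense_range {E : normedModType R[i]} (c : blin E E) (x : E) (e : R) :
  ~ not_bounded_below (precomp c) -> 0 < e -> exists u, rn (x - c u) < e.
Proof.
move=> /bounded_below [d d0 cd] e0.
pose A x := [set rn (x - c u) | u in setT].
pose p x := inf (A x).
have A0 y : A y !=set0 by exists (rn (y - c 0)); exists 0.
have Alb y : has_lbound (A y) by exists 0 => _ [u _ <-]; exact: rn_ge0.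
have pA y u : p y <= rn (y - c u) by apply: ge_inf => //; exists u.
have p0 y : 0 <= p y by apply: lb_le_inf => // _ [u _ <-]; exact: rn_ge0.
have pZ1 k y : p (k *: y) <= rn k * p y.
  have [->|k0] := eqVneq k 0.
    by rewrite scale0r rn0 mul0r (le_trans (pA _ 0))// blin_app0 subrr rn0.
  rewrite -ler_pdivrMl ?rn_gt0//; apply: lb_le_inf => // _ [u _ <-].
  rewrite ler_pdivrMl ?rn_gt0// -rnZ scalerBr.
  by have := pA (k *: y) (k *: u); rewrite blin_appZ.
have pZ k y : p (k *: y) = rn k * p y.
  have [->|k0] := eqVneq k 0.
    by apply/eqP; rewrite rn0 mul0r eq_le p0 (le_trans (pZ1 _ _))// rn0 mul0r.
  apply/eqP; rewrite eq_le pZ1 /= -ler_pdivlMl ?rn_gt0// -rnV.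
  by have := pZ1 k^-1 (k *: y); rewrite scalerA mulVf// scale1r.
have pD y z : p (y + z) <= p y + p z.
  apply: le_inf_add => // _ _ [u _ <-] [v _ <-].
  apply: le_trans (pA _ (u + v)) _.
  by rewrite blin_appD opprD addrACA ler_rnD.
have pM y : p y <= 1 * rn y.
  by rewrite mul1r (le_trans (pA _ 0))// blin_app0 subr0.
have [f [fp fx]] := hahn_banach x pD pZ pM.
have fc : precomp c f = 0.
  apply: blinP => u; apply: rn0_eq0; apply/eqP; rewrite eq_le rn_ge0 andbT.
  by rewrite (le_trans (fp _))// (le_trans (pA _ u))// subrr rn0.
have f0 : rn f <= 0.
  by have := cd f; rewrite fc rn0 pmulr_rle0.
have px : p x = 0.
  apply/eqP; rewrite eq_le p0 andbT -fx (le_trans (rn_blin _ _))//.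
  by rewrite mulr_le0_ge0// rn_ge0.
apply: contrapT => /forallNP h; have : e <= p x.
  by apply: lb_le_inf => // _ [u _ <-]; rewrite leNgt; apply/negP/h.
by rewrite px leNgt e0.
Qed.

(** If [c] is bounded below, approximate preimages form Cauchy sequences, so its range is closed; if
    the adjoint is bounded below, the range is dense. Together they make [c] bijective, and the
    lower bound of [c] bounds the inverse. *)
Lemma not_invertible_cases {E : completeNormedModType R[i]} (c : blin E E) :
  ~ invertible c -> not_bounded_below c \/ not_bounded_below (precomp c).
Proof.
move=> ci; apply: contrapT => /not_orP [/bounded_below [d d0 cd] /dense_range cr].
apply: ci.
have cinj x y : c x = c y -> x = y.
  move=> cxy; apply/eqP; rewrite -subr_eq0; apply/eqP/rn0_eq0/eqP.
  rewrite eq_le rn_ge0 andbT -(ler_pM2l d0) mulr0 (le_trans (cd _))//.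
  by rewrite blin_appB cxy subrr rn0.
have csurj x : exists u, c u = x.
  have /choice [u uP] : forall n : nat, exists u, rn (x - c u) < n.+1%:R^-1.
    by move=> n; apply: cr; rewrite ?invr_gt0.
  have small e : 0 < e -> exists N : nat, forall n, (N <= n)%N -> rn (x - c (u n)) < e.
    move=> e0; exists (Num.bound e^-1) => n Nn.
    apply: lt_trans (uP n) _; rewrite invf_plt ?posrE//.
    apply: lt_le_trans (archi_boundP _) _; first by rewrite invr_ge0 ltW.
    by rewrite ler_nat (leq_trans Nn).
  have [|l ul] := @cauchy_rn_cvg R E u.
    move=> e e0; have [|N hN] := small (d * (e / 2)).
      by rewrite mulr_gt0// divr_gt0.
    exists N => m n Nm mn; rewrite -(ler_pM2l d0) (le_trans (cd _))// blin_appB.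
    rewrite (le_trans (rn_dist3 x _ _))// rnB [e]splitr mulrDr lerD// ltW//.
      exact/hN/(leq_trans Nm).
    exact: hN.
  exists l; apply: eq_rn_lt => e e0.
  have K0 : 0 < rn c + 1 by rewrite ltr_wpDl ?rn_ge0.
  have [|N1 h1] := ul (e / 2 / (rn c + 1)); first by rewrite !divr_gt0.
  have [|N2 h2] := small (e / 2); first by rewrite divr_gt0.
  have {}h1 := h1 _ (leq_maxl N1 N2); have {}h2 := h2 _ (leq_maxr N1 N2).
  move: (maxn N1 N2) h1 h2 => n h1 h2.
  apply: le_trans (rn_dist3 (c (u n)) _ _) _; rewrite [e]splitr lerD//.
    rewrite rnB -blin_appB (le_trans (rn_blin _ _))//.
    move: h1; rewrite ltr_pdivlMr// => /ltW; apply: le_trans.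
    by rewrite mulrC ler_wpM2l ?rn_ge0// lerDl.
  by rewrite rnB ltW.
have [g gP] := choice csurj.
have gl : is_bounded_linear (g : E -> E).
  split; first by move=> k x y; apply: cinj; rewrite blin_appD blin_appZ !gP.
  exists (d^-1)%:C => x; rewrite -!rnE -rmorphM lecR ler_pdivlMl//.
  by rewrite -{2}[x]gP cd.
exists (@Blin R E E g (asboolT gl)); split; apply: blinP => x.
  exact: gP.
by apply: cinj; exact: gP.
Qed.

(** Inverses [r] of [c - k] must blow up as [k] tends to 0, since otherwise perturbing by [- k]
    would invert [c]. Images under [r] of nearly extremal vectors are then nearly killed by [c];
    functionals composed with [r] do the same for the adjoint. *)
Lemma boundary_not_bounded_below {E : completeNormedModType R[i]} (c : blin E E) :
    ~ invertible c ->
    (forall e : R, 0 < e ->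
      exists2 k, rn k < e & invertible (c - k *: (1 : blin E E))) ->
  not_bounded_below c /\ not_bounded_below (precomp c).
Proof.
move=> ci cb.
(* The factor 3 is 2 + 1: in [c (r x) = x + k r x] the first summand has norm below [2 |k| |r x|],
   the second equals [|k| |r x|]. *)
suff H e : 0 < e -> exists k r, [/\ 0 < rn k, rn k * 3 < e,
    inverse_pair (c - k *: (1 : blin E E)) r & 1 < 2 * (rn k * rn r)].
  have E1 k x : c x = (c - k *: (1 : blin E E)) x + k *: x.
    by rewrite blinDE blinNE blinZE blin1E subrK.
  split => e /H [k [r [k0 ke [cr rc] kr]]].
    have [||x xr] := @rn_blin_lt _ _ _ r (2 * rn k)^-1.
    - by rewrite invr_ge0 mulr_ge0// ltW.
    - by rewrite -[ltLHS]mulr1 ltr_pdivrMl ?mulr_gt0// -mulrA.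
    exists (r x); rewrite (E1 k) -blinME cr blin1E.
    rewrite (le_lt_trans (ler_rnD _ _))// rnZ.
    move: xr; rewrite ltr_pdivrMl ?mulr_gt0// => xr.
    have := rn_ge0 x; have := rn_ge0 (r x); nra.
  have [||x xr] := @rn_blin_lt _ _ _ r (2 * rn k)^-1.
  - by rewrite invr_ge0 mulr_ge0// ltW.
  - by rewrite -[ltLHS]mulr1 ltr_pdivrMl ?mulr_gt0// -mulrA.
  have [f [f1 fr]] := norming_functional (r x).
  pose g := blin_comp f r; exists g.
  have gc : precomp c g = f + k *: g.
    apply: blinP => y; rewrite blinDE blinZE /= (E1 k).
    rewrite (blin_appD r) (blin_appD f) (blin_appZ r) (blin_appZ f).
    by rewrite -(blinME r) rc.
  rewrite gc (le_lt_trans (ler_rnD _ _))// rnZ.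
  have gk : 1 < 2 * rn k * rn g.
    move: xr; rewrite -fr ltr_pdivrMl ?mulr_gt0// => xr.
    have x0 : 0 < rn x.
      rewrite lt_def rn_ge0 andbT; apply/negP => /eqP /rn0_eq0 x0.
      by move: xr; rewrite x0 !blin_app0 !rn0 mulr0 ltxx.
    rewrite -(ltr_pM2r x0) mul1r (lt_le_trans xr)// -[leRHS]mulrA ler_wpM2l//.
      by rewrite mulr_ge0// ltW.
    exact: (rn_blin g x).
  have f1' : rn f <= 1 by apply: rn_blin_le => // y; rewrite mul1r.
  have := rn_ge0 g; nra.
move=> e0; have [|k ke [r cr]] := cb (e / 3); first by rewrite divr_gt0.
have k0 : 0 < rn k.
  rewrite rn_gt0; apply/negP => /eqP k0; apply: ci; exists r.
  by rewrite -[c]subr0 -(scale0r (1 : blin E E)) -k0.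
exists k, r; split => //; first by rewrite -ltr_pdivlMr.
rewrite ltNge; apply/negP => kr; apply: ci.
have [|r' [cr' _]] := @invertible_perturb _ _ _ _ (- k) cr; first by rewrite rnN.
by exists r'; move: cr'; rewrite scaleNr opprK subrK.
Qed.

End ApproximateSpectrum.

(** * Elementary operators *)

Section ElementaryOperators.
Local Open Scope complex_scope.
Context {R : realType}.

Lemma rank_one_subproof {U V : normedModType R[i]} (x : V) (f : blin U R[i]) :
  (fun y => f y *: x) \in @bounded_linear_pred R U V.
Proof.
apply/asboolP; split.
  by move=> k y z; rewrite blin_appD blin_appZ scalerDl scalerA.
exists (`|f| * `|x|) => y; rewrite normrZ mulrAC ler_wpM2r//.
exact: opnorm_bound.
Qed.

Definition rank_one {U V : normedModType R[i]} (x : V) (f : blin U R[i]) : blin U V :=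
  Blin (rank_one_subproof x f).

Lemma rn_rank_one {U V : normedModType R[i]} (x : V) (f : blin U R[i]) :
  rn (rank_one x f) = rn x * rn f.
Proof.
apply/eqP; rewrite eq_le; apply/andP; split.
  apply: rn_blin_le => [|y]; first by rewrite mulr_ge0// rn_ge0.
  by rewrite /= rnZ mulrC -mulrA ler_wpM2l ?rn_ge0// rn_blin.
have [->|x0] := eqVneq x 0; first by rewrite rn0 mul0r rn_ge0.
rewrite -rn_gt0 in x0; rewrite -ler_pdivlMl//; apply: rn_blin_le => [|y].
  by rewrite mulr_ge0 ?rn_ge0// invr_ge0 ltW.
rewrite -mulrA ler_pdivlMl// mulrC -rnZ.
exact: (rn_blin (rank_one x f) y).
Qed.

Section Tau.
Context {X Y : completeNormedModType R[i]}.
Implicit Types (S : blin X X) (T : blin Y Y) (A : blin Y X).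

Lemma elem_opE S T A y : elem_op S T A y = S (A (T y)).
Proof. by []. Qed.

Lemma elem_op_mul S S' T T' :
  elem_op S T * elem_op S' T' = elem_op (S * S') (T' * T).
Proof. by apply: blinP => A; apply: blinP => y. Qed.

Lemma elem_op1 : elem_op (1 : blin X X) (1 : blin Y Y) = 1.
Proof. by apply: blinP => A; apply: blinP => y. Qed.

Lemma elem_op_sub_l S T k :
  elem_op S T - k *: elem_op 1 T = elem_op (S - k *: (1 : blin X X)) T.
Proof. by apply: blinP => A; apply: blinP => y. Qed.

Lemma elem_op_sub_r S T k :
  elem_op S T - k *: elem_op S 1 = elem_op S (T - k *: (1 : blin Y Y)).
Proof.
apply: blinP => A; apply: blinP => y.
rewrite !(blinDE, blinNE, blinZE, elem_opE, blin1E) blin_appB blin_appZ.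
by rewrite blin_appB blin_appZ.
Qed.

Lemma elem_op_rank_one S T x f :
  elem_op S T (rank_one x f) = rank_one (S x) (precomp T f).
Proof. by apply: blinP => y; rewrite elem_opE /= blin_appZ. Qed.

Lemma elem_opC S T :
  elem_op S 1 * elem_op (1 : blin X X) T = elem_op 1 T * elem_op S (1 : blin Y Y).
Proof. by rewrite !elem_op_mul !mul1r !mulr1. Qed.

Lemma elem_opLR S T : elem_op S T = elem_op S 1 * elem_op 1 T.
Proof. by rewrite elem_op_mul !mulr1. Qed.

Lemma elem_op_expr S T n : elem_op S T ^+ n = elem_op (S ^+ n) (T ^+ n).
Proof.
elim: n => [|n IH]; first by rewrite !expr0 elem_op1.
by rewrite [LHS]exprS IH elem_op_mul -exprS -exprSr.
Qed.

Lemma elem_op_invertible_l S : invertible S -> invertible (elem_op S (1 : blin Y Y)).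
Proof.
move=> [V [SV VS]]; exists (elem_op V 1).
by split; rewrite elem_op_mul mul1r ?SV ?VS elem_op1.
Qed.

Lemma elem_op_invertible_r T : invertible T -> invertible (elem_op (1 : blin X X) T).
Proof.
move=> [V [TV VT]]; exists (elem_op 1 V).
by split; rewrite elem_op_mul mul1r ?TV ?VT elem_op1.
Qed.

Lemma elem_op_drazin S T : drazin_invertible S -> drazin_invertible T ->
  drazin_invertible (elem_op S T).
Proof.
move=> /drazin_invP [d [p [Sd Sp _ _]]] /drazin_invP [e [q [Te Tq _ _]]].
have pow (A : pzRingType) (x z : A) n : x * z = z * x -> x ^+ n = x ^+ n.+1 * z ->
    forall m, x ^+ (n + m) = x ^+ (n + m).+1 * z.
  by move=> _ xn m; rewrite addnC exprD xn mulrA -exprD addnS.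
apply: (@drazin_criterion _ _ (elem_op d e) (p + q)).
  by rewrite !elem_op_mul Sd Te.
rewrite !elem_op_expr elem_op_mul -(pow _ _ _ _ Sd Sp).
congr elem_op; rewrite addnC {1}(pow _ _ _ _ Te Tq).
by apply/commr_sym/commrX/commr_sym; rewrite /GRing.comm Te.
Qed.

End Tau.

(* On [B x w] with [a x] small, [c] acts like [b] on [w]: power bounds for [c]
   pass to [b]. *)
Lemma power_bound_transfer {U W G : normedModType R[i]} (B : U -> W -> G)
    (a : U -> U) (b b' : W -> W) (c : blin G G) p (M : R) (w : W) :
    (forall u v, rn (B u v) = rn u * rn v) ->
    (forall u v, c (B u v) = B (a u) (b' v) + B u (b v)) ->
    not_bounded_below a -> 0 <= M ->
    (forall g, rn ((c ^+ p) g) <= M * rn ((c ^+ p.+1) g)) ->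
  rn (iter p b w) <= M * rn (iter p.+1 b w).
Proof.
move=> BE cB aS M0 cM.
(* [c^n (B u w)] equals [B u (b^n w)] up to an error linear in [|a u|], with a constant independent
   of [u]. *)
have approx n : exists2 K : R, 0 <= K & forall u,
    rn ((c ^+ n) (B u w) - B u (iter n b w)) <= K * rn (a u).
  elim: n => [|n [K K0 hK]].
    by exists 0 => // u; rewrite expr0 blin1E subrr rn0 mul0r.
  exists (rn c * K + rn (b' (iter n b w))) => [|u].
    by rewrite addr_ge0 ?mulr_ge0 ?rn_ge0.
  have -> : (c ^+ n.+1) (B u w) - B u (iter n.+1 b w) =
      c ((c ^+ n) (B u w) - B u (iter n b w)) + B (a u) (b' (iter n b w)).
    by rewrite exprS blinME blin_appB cB iterS opprD addrA addrAC subrK.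
  rewrite (le_trans (ler_rnD _ _))// mulrDl lerD//.
    by rewrite (le_trans (rn_blin _ _))// -mulrA ler_wpM2l// rn_ge0.
  by rewrite BE mulrC.
have [K K0 hK] := approx p; have [L L0 hL] := approx p.+1.
(* A positive defect [d] would exceed the errors as soon as [|a u|] is small compared with
   [d |u|]. *)
rewrite leNgt; apply/negP; rewrite -subr_gt0; set d := _ - _ => d0.
have KL : 0 < K + M * L + 1 by rewrite ltr_wpDl// addr_ge0// mulr_ge0.
have [|u ue] := aS (d / (K + M * L + 1)); first by rewrite divr_gt0.
have u0 : 0 < rn u.
  have := le_lt_trans (rn_ge0 _) ue; rewrite pmulr_rgt0// divr_gt0//.
have h1 : rn (B u (iter p b w)) <= rn ((c ^+ p) (B u w)) + K * rn (a u).
  rewrite addrC -(subrK ((c ^+ p) (B u w)) (B u _)) (le_trans (ler_rnD _ _))//.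
  by rewrite lerD2r rnB hK.
have h2 : rn ((c ^+ p.+1) (B u w)) <= rn (B u (iter p.+1 b w)) + L * rn (a u).
  rewrite addrC -[in leLHS](subrK (B u (iter p.+1 b w)) ((c ^+ _) _)).
  rewrite (le_trans (ler_rnD _ _))//.
  by rewrite lerD2r hL.
have h3 := cM (B u w).
have : d * rn u <= (K + M * L) * rn (a u).
  rewrite BE in h1; rewrite BE in h2; have := ler_wpM2l M0 h2.
  by rewrite /d; lra.
have : rn (a u) * (K + M * L + 1) < d * rn u.
  by move: ue; rewrite mulrAC ltr_pdivlMr.
have := rn_ge0 (a u); nra.
Qed.

End ElementaryOperators.

(** * Drazin invertibility through resolvents near 0 *)

Section LimitsOfInvertibles.
Local Open Scope complex_scope.
Context {R : realType} {E : completeNormedModType R[i]}.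
Implicit Types c : blin E E.

Lemma bicomm_inverse_pair (a b : blin E E) (ab : a * b = b * a) (u v : bicomm ab) :
  u * v = 1 -> inverse_pair (bicomm_val u) (bicomm_val v).
Proof.
move=> uv; split; first exact: (congr1 bicomm_val uv).
by apply: (congr1 bicomm_val (_ : v * u = 1)); rewrite mulrC.
Qed.

Lemma drazin_punctured c : drazin_invertible c ->
  exists2 d : R, 0 < d & forall k, 0 < rn k -> rn k < d ->
    invertible (c - k *: (1 : blin E E)).
Proof.
pose u := bicomm_l (erefl (c * c)); pose i := scalar_bicomm (erefl (c * c)).
move=> /(bicomm_drazin u) [d [p up]].
have D0 : 0 < rn (bicomm_val d) + 1 by rewrite ltr_wpDl// rn_ge0.
exists (rn (bicomm_val d) + 1)^-1; first by rewrite invr_gt0.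
move=> k k0 kd.
have [|w0 [w01 _]] := @neumann _ E (k *: bicomm_val d).
  rewrite rnZ (le_lt_trans (y := rn k * (rn (bicomm_val d) + 1)))//.
    by rewrite ler_wpM2l ?rn_ge0// lerDl.
  by rewrite -ltr_pdivlMr// mul1r.
have [w [w1 _]] : exists w, (1 - i k * d) * w = 1 /\
    inverse_pair (bicomm_val (1 - i k * d)) (bicomm_val w).
  apply: bicomm_inv; exists w0.
  suff -> : bicomm_val (1 - i k * d) = 1 - k *: bicomm_val d by [].
  change (1 - (k *: (1 : blin E E)) * bicomm_val d = 1 - k *: bicomm_val d).
  by rewrite -blin_scalerAl mul1r.
have kk : i k^-1 ^+ p * i k ^+ p = 1.
  rewrite -exprMn -rmorphM/= mulVf ?rmorph1 ?expr1n//.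
  by rewrite -rn_gt0.
suff [v uv] : exists v, (u - i k) * v = 1.
  by exists (bicomm_val v); exact: (bicomm_inverse_pair uv).
have := subrXX u (i k) p; set q := \sum_(_ < p) _ => hq.
(* Multiplying [d w] by [u - k] gives [1 - (1 - u d) w]. As [u^p (1 - u d) = 0], the finite
   geometric sum [q] divided by [- k^p] inverts [u - k] on multiples of [1 - u d] and removes the
   error. *)
exists (d * w - w * (i k^-1 ^+ p * q * (1 - u * d))).
transitivity ((1 - i k * d) * w - (1 - u * d) * w -
  w * i k^-1 ^+ p * ((u - i k) * q) * (1 - u * d)); first by ring.
rewrite -hq w1; transitivity (1 + (i k^-1 ^+ p * i k ^+ p - 1) * (w * (1 - u * d)) -
  w * i k^-1 ^+ p * (u ^+ p - u ^+ p.+1 * d)); first by rewrite exprS; ring.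
by rewrite kk -up !subrr mul0r mulr0 addr0 subr0.
Qed.

Lemma spectrum_bounded c k : rn c < rn k -> invertible (c - k *: (1 : blin E E)).
Proof.
move=> ck; have k0 : 0 < rn k := le_lt_trans (rn_ge0 _) ck.
have kn0 : k != 0 by rewrite -rn_gt0.
have [|w [[w1 w2] _]] := @neumann _ E (k^-1 *: c).
  by rewrite rnZ rnV mulrC ltr_pdivrMr// mul1r.
have -> : c - k *: (1 : blin E E) = - k *: (1 - k^-1 *: c).
  by rewrite scalerBr scalerA mulNr mulfV// scaleN1r opprK scaleNr addrC.
exists (- k^-1 *: w); split.
  by rewrite -blin_scalerAl -blin_scalerAr w1 scalerA mulrNN mulfV// scale1r.
by rewrite -blin_scalerAl -blin_scalerAr w2 scalerA mulrNN mulVf// scale1r.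
Qed.

Lemma invertible_open c : invertible c ->
  exists2 e : R, 0 < e & forall k, rn k < e -> invertible (c - k *: (1 : blin E E)).
Proof.
move=> [r cr]; have r0 := rn_ge0 r.
have r1 : 0 < 2 * (rn r + 1) by rewrite mulr_gt0// ltr_wpDl.
exists (2 * (rn r + 1))^-1; first by rewrite invr_gt0.
move=> k kr; have [|r' [cr' _]] := @invertible_perturb _ _ _ _ k cr; last by exists r'.
have : rn k * (2 * (rn r + 1)) < 1 by rewrite -ltr_pdivlMr// mul1r.
have := rn_ge0 k; nra.
Qed.

(* The bound makes [c^p (c - k)^(-m)] bounded as [k] tends to 0, hence Cauchy;
   for [m = p + 1] the limit [g] satisfies [c^p = c^(p+1) g]. *)
Lemma drazin_of_bound c p (M : R) : 0 <= M ->
    (forall u, c * u = u * c -> rn (c ^+ p * u) <= M * rn (c ^+ p.+1 * u)) ->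
    (exists2 d : R, 0 < d & forall k, 0 < rn k -> rn k < d ->
      invertible (c - k *: (1 : blin E E))) ->
  drazin_invertible c.
Proof.
move=> M0 cM [d d0 cd].
pose C := bicomm (erefl (c * c)); pose N (u : C) := rn (bicomm_val u).
pose x : C := bicomm_l _; pose i : R[i] -> C := scalar_bicomm _.
have N_D u v : N (u + v) <= N u + N v by exact: ler_rnD.
have N_M u v : N (u * v) <= N u * N v by exact: rn_blinM.
have N_ge0 u : 0 <= N u by exact: rn_ge0.
have N_Z k u : N (i k * u) = rn k * N u.
  rewrite -rnZ; congr rn.
  change ((k *: (1 : blin E E)) * bicomm_val u = k *: bicomm_val u).
  by rewrite -blin_scalerAl mul1r.
have {}cM (u : C) : N (x ^+ p * u) <= M * N (x ^+ p.+1 * u).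
  rewrite /N !bicomm_valM !bicomm_valX; apply: cM.
  by apply/esym/bicommP.
(* [e < d] keeps every [c - k n] invertible; [M e <= 1/2] permits the absorption in [step]. *)
have [e [e0 ed eM]] : exists e : R, [/\ 0 < e, e < d & M * e <= 2^-1].
  exists (Num.min (d / 2) (2 * (M + 1))^-1).
  have m0 : 0 < 2 * (M + 1) by rewrite mulr_gt0// ltr_wpDl.
  split; first by rewrite lt_min divr_gt0// invr_gt0.
    by rewrite gt_min ltr_pdivrMr// mulr_natr mulr2n ltrDl d0.
  apply: le_trans (ler_wpM2l M0 (_ : _ <= (2 * (M + 1))^-1)) _.
    by rewrite ge_min lexx orbT.
  by rewrite ler_pdivrMr// mulrA mulVf// mul1r lerDl.
pose k n : R[i] := (e / n.+1%:R)%:C.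
have ke n : rn (k n) = e / n.+1%:R by rewrite rnR ger0_norm// divr_ge0// ltW.
have k0 n : 0 < rn (k n) by rewrite ke divr_gt0.
have k1 n : rn (k n) <= e by rewrite ke ler_pdivrMr// ler_peMr ?(ltW e0)// ler1n.
have ksmall (a : R) : 0 < a -> exists n0, forall n, (n0 <= n)%N -> rn (k n) < a.
  move=> a0; exists (Num.bound (e / a)) => n n0.
  rewrite ke ltr_pdivrMr// mulrC -ltr_pdivrMr//.
  apply: lt_le_trans (archi_boundP _) _; first by rewrite divr_ge0// ltW.
  by rewrite ler_nat ltnW.
have /choice [r rP] n : exists r : C, (x - i (k n)) * r = 1.
  have [|v [xv _]] := @bicomm_inv _ _ _ _ (x - i (k n)); last by exists v.
  apply: cd => //; exact: le_lt_trans (k1 n) ed.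
have xr n u : x * r n * u = u + i (k n) * (r n * u).
  transitivity ((x - i (k n)) * r n * u + i (k n) * (r n * u)); first by ring.
  by rewrite rP mul1r.
(* As [x r = 1 + k r], the hypothesis bounds [N (x^p r u)] by [M N (x^p u) + M |k| N (x^p r u)], and
   the last term is at most half the left-hand side. *)
have step n u : N (x ^+ p * (r n * u)) <= 2 * M * N (x ^+ p * u).
  have := cM (r n * u); have -> : x ^+ p.+1 * (r n * u) =
      x ^+ p * u + i (k n) * (x ^+ p * (r n * u)).
    transitivity (x ^+ p * (x * r n * u)); first by rewrite exprS; ring.
    by rewrite xr; ring.
  have := ler_wpM2l M0 (N_D (x ^+ p * u) (i (k n) * (x ^+ p * (r n * u)))).
  rewrite N_Z; move: (N_ge0 (x ^+ p * (r n * u))); set Z := N (x ^+ p * (r n * u)) => Z0.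
  have h3 : M * rn (k n) <= 2^-1 := le_trans (ler_wpM2l M0 (k1 n)) eM.
  by have := ler_wpM2r Z0 h3; lra.
pose xp := N (x ^+ p).
have bnd n m : N (x ^+ p * r n ^+ m) <= (2 * M) ^+ m * xp.
  elim: m => [|m IH]; first by rewrite !expr0 mulr1 mul1r.
  rewrite [r n ^+ _]exprS [(2 * M) ^+ _]exprS -[leRHS]mulrA.
  by rewrite (le_trans (step _ _))// ler_wpM2l// mulr_ge0.
(* By the resolvent identity [r n - r n' = (k n - k n') r n r n'], with the products controlled by
   [step]. *)
have lip m : exists2 L, 0 <= L & forall n n',
    N (x ^+ p * (r n ^+ m - r n' ^+ m)) <= L * (rn (k n) + rn (k n')).
  elim: m => [|m [L L0 IH]].
    exists 0 => // n n'; rewrite !expr0 subrr mulr0 mul0r /N.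
    by rewrite (_ : bicomm_val 0 = 0)// rn0.
  exists (2 * M * L + (2 * M) ^+ 2 * ((2 * M) ^+ m * xp)) => [|n n'].
    have M2 : 0 <= 2 * M by rewrite mulr_ge0.
    by rewrite addr_ge0// !mulr_ge0// ?exprn_ge0// N_ge0.
  have rr : r n - r n' = i (k n - k n') * (r n * r n').
    have -> : i (k n - k n') = i (k n) - i (k n') by exact: rmorphB.
    transitivity (r n * ((x - i (k n')) * r n') - r n' * ((x - i (k n)) * r n)).
      by rewrite !rP !mulr1.
    by ring.
  have -> : x ^+ p * (r n ^+ m.+1 - r n' ^+ m.+1) =
      x ^+ p * (r n' * (r n ^+ m - r n' ^+ m)) +
      i (k n - k n') * (x ^+ p * (r n * (r n' * r n ^+ m))).
    transitivity (x ^+ p * (r n' * (r n ^+ m - r n' ^+ m)) +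
        x ^+ p * ((r n - r n') * r n ^+ m)).
      by rewrite !exprS; ring.
    by rewrite rr; ring.
  apply: le_trans (N_D _ _) _; rewrite mulrDl N_Z lerD//.
    by rewrite -[leRHS]mulrA (le_trans (step _ _))// ler_wpM2l ?mulr_ge0.
  rewrite mulrC ler_pM ?rn_ge0 ?ler_rnB//.
  have M2 : 0 <= 2 * M by rewrite mulr_ge0.
  rewrite expr2 -[leRHS]mulrA (le_trans (step _ _))// ler_wpM2l//.
  by rewrite (le_trans (step _ _))// ler_wpM2l.
(* [x r n] differs from 1 by [k n r n], and [x^p r n] is bounded. *)
have near1 m : exists2 L, 0 <= L & forall n,
    N (x ^+ p * ((x * r n) ^+ m - 1)) <= L * rn (k n).
  elim: m => [|m [L L0 IH]].
    exists 0 => // n; rewrite !expr0 subrr mulr0 mul0r /N.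
    by rewrite (_ : bicomm_val 0 = 0)// rn0.
  exists (L + e * (2 * M) * L + 2 * M * xp) => [|n].
    have M2 : 0 <= 2 * M by rewrite mulr_ge0.
    by rewrite addr_ge0 ?addr_ge0 ?mulr_ge0 ?(ltW e0) ?N_ge0.
  pose t := (x * r n) ^+ m - 1.
  have -> : x ^+ p * ((x * r n) ^+ m.+1 - 1) =
      x ^+ p * t + (i (k n) * (x ^+ p * (r n * t)) + i (k n) * (x ^+ p * (r n * 1))).
    have : (x * r n) ^+ m = t + 1 by rewrite subrK.
    rewrite exprS; move: (_ ^+ m) t => v t ->.
    transitivity (x ^+ p * (x * r n * t + (x * r n * 1 - 1))); first by ring.
    by rewrite !xr; ring.
  have h1 := IH n; have h2 := step n t; have h3 := step n 1.
  apply: le_trans (N_D _ _) _.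
  have := N_D (i (k n) * (x ^+ p * (r n * t))) (i (k n) * (x ^+ p * (r n * 1))).
  rewrite !N_Z -/t in h1 *.
  have := k1 n; have kn := k0 n; have M2 : 0 <= 2 * M by rewrite mulr_ge0.
  have h4 := le_trans h2 (ler_wpM2l M2 h1).
  have h5 := ler_wpM2l (ltW kn) h4; have h6 := ler_wpM2l (ltW kn) h3; move=> h7 h8.
  apply: le_trans (lerD h1 h8) _; apply: le_trans (lerD (lexx _) (lerD h5 h6)) _.
  have h9 : rn (k n) * (2 * M * (L * rn (k n))) <= e * (2 * M * (L * rn (k n))).
    by rewrite ler_wpM2r// !mulr_ge0// ltW.
  rewrite [leRHS]mulrDl [(L + _) * _]mulrDl -addrA lerD2l.
  apply: lerD; last by rewrite [x ^+ p * 1]mulr1 mulrC.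
  by apply: le_trans h9 _; rewrite !mulrA.
pose g n := x ^+ p * r n ^+ p.+1.
have [L L0 hL] := lip p.+1.
have [|l gl] := @cauchy_rn_cvg R (blin E E) (fun n => bicomm_val (g n)).
  move=> a a0; have L1 : 0 < 2 * (L + 1) by rewrite mulr_gt0// ltr_wpDl.
  have [|n0 hn0] := ksmall (a / (2 * (L + 1))); first by rewrite divr_gt0.
  exists n0 => m n n0m mn; change (N (g n - g m) <= a).
  have -> : g n - g m = x ^+ p * (r n ^+ p.+1 - r m ^+ p.+1) by rewrite mulrBr.
  rewrite (le_trans (hL _ _))//.
  have := hn0 _ n0m; have := hn0 _ (leq_trans n0m mn); rewrite !ltr_pdivlMr//.
  have := rn_ge0 (k m); have := rn_ge0 (k n); nra.
(* Used twice: to see that [l] commutes with [c], and that [c^(p+1) l = c^p]. *)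
have lim (F : blin E E -> blin E E) (K : R) : 0 <= K ->
    (forall u v, rn (F u - F v) <= K * rn (u - v)) ->
    (forall a : R, 0 < a -> exists n0, forall n, (n0 <= n)%N ->
      rn (F (bicomm_val (g n))) < a) ->
    F l = 0.
  move=> K0 FK Fs; apply: eq_rn_lt => a a0; rewrite subr0.
  have K1 : 0 < K + 1 by rewrite ltr_wpDl.
  have [|n1 h1] := gl (a / 2 / (K + 1)); first by rewrite !divr_gt0.
  have [|n2 h2] := Fs (a / 2); first by rewrite divr_gt0.
  have {}h1 := h1 _ (leq_maxl n1 n2); have {}h2 := h2 _ (leq_maxr n1 n2).
  move: (maxn n1 n2) h1 h2 => n h1 h2.
  have -> : F l = (F l - F (bicomm_val (g n))) + F (bicomm_val (g n)) by rewrite subrK.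
  rewrite (le_trans (ler_rnD _ _))// [a]splitr lerD ?(ltW h2)// (le_trans (FK _ _))//.
  move: h1; rewrite ltr_pdivlMr// rnB mulrDr mulr1 mulrC => /ltW; apply: le_trans.
  by rewrite lerDl rn_ge0.
have cl : c * l = l * c.
  apply/eqP; rewrite -subr_eq0; apply/eqP.
  apply: (lim (fun u => c * u - u * c) (rn c * 2)).
  - by rewrite mulr_ge0// rn_ge0.
  - move=> u v.
    have -> : c * u - u * c - (c * v - v * c) = c * (u - v) - (u - v) * c.
      by rewrite mulrBr mulrBl !opprB [LHS]addrACA [RHS]addrACA [- _ - _]addrC.
    rewrite (le_trans (ler_rnB _ _))// mulrAC mulr_natr mulr2n lerD ?rn_blinM//.
    by rewrite mulrC rn_blinM.
  - move=> a a0; exists 0 => n _.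
    have -> : c * bicomm_val (g n) = bicomm_val (g n) * c by apply/esym/bicommP.
    by rewrite subrr rn0.
apply: (drazin_criterion cl (p := p)).
apply/esym/eqP; rewrite -subr_eq0; apply/eqP.
apply: (lim (fun u => c ^+ p.+1 * u - c ^+ p) (rn (c ^+ p.+1))).
- exact: rn_ge0.
- by move=> u v; rewrite opprB addrA subrK -mulrBr rn_blinM.
have [L1 L10 hL1] := near1 p.+1.
have L11 : 0 < L1 + 1 by rewrite ltr_wpDl.
move=> a a0; have [|n0 hn0] := ksmall (a / (L1 + 1)); first by rewrite divr_gt0.
exists n0 => n /hn0; rewrite ltr_pdivlMr// => kn.
have E1 : x ^+ p.+1 * g n - x ^+ p = x ^+ p * ((x * r n) ^+ p.+1 - 1).
  by rewrite /g exprMn; ring.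
have -> : c ^+ p.+1 * bicomm_val (g n) - c ^+ p = bicomm_val (x ^+ p.+1 * g n - x ^+ p).
  transitivity (bicomm_val (x ^+ p.+1) * bicomm_val (g n) - bicomm_val (x ^+ p)) => //.
  by rewrite !bicomm_valX.
rewrite E1; apply: le_lt_trans (hL1 n) _; apply: le_lt_trans kn.
by rewrite mulrDr mulr1 mulrC lerDl rn_ge0.
Qed.

End LimitsOfInvertibles.

(** * Action on rank-one operators: factors of Drazin invertible and of invertible elements *)

Section SpectraOfElementaryOperators.
Local Open Scope complex_scope.
Context {R : realType} {X Y : completeNormedModType R[i]}.
Variables (S : blin X X) (T : blin Y Y).
Notation tau := (elem_op S T).


Lemma rank_oneE {U V : normedModType R[i]} (x : V) (f : blin U R[i]) y :
  rank_one x f y = f y *: x.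
Proof. by []. Qed.

Lemma precompE {U V : normedModType R[i]} (c : blin U V) f y : precomp c f y = f (c y).
Proof. by []. Qed.

Lemma subZE {E : normedModType R[i]} (c : blin E E) k x :
  (c - k *: (1 : blin E E)) x = c x - k *: x.
Proof. by []. Qed.

(** The term inserted is [rank_one (mu u) (f T)], and [rank_one (nu S u) f] in [tau_rank_one_r]. In
    each case one summand contains a factor that approximate eigenvectors make small and the other
    moves a single tensor factor, as [power_bound_transfer] requires. *)
Lemma tau_rank_one_l mu nu (u : X) (f : blin Y R[i]) :
  (tau - (mu * nu) *: (1 : blin (blin Y X) (blin Y X))) (rank_one u f) =
  rank_one ((S - mu *: (1 : blin X X)) u) (precomp T f) +
  rank_one u (mu *: precomp (T - nu *: (1 : blin Y Y)) f).
Proof.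
rewrite blinDE blinNE blinZE blin1E elem_op_rank_one; apply: blinP => y.
rewrite !(blinDE, blinNE, blinZE, rank_oneE, precompE, subZE) blin_appB blin_appZ.
rewrite scalerBr !scalerA -addrA -!scaleNr -scalerDl; congr (_ + _ *: _).
by rewrite /GRing.scale /=; ring.
Qed.

Lemma tau_rank_one_r mu nu (u : X) (f : blin Y R[i]) :
  (tau - (mu * nu) *: (1 : blin (blin Y X) (blin Y X))) (rank_one u f) =
  rank_one (S u) (precomp (T - nu *: (1 : blin Y Y)) f) +
  rank_one (nu *: (S - mu *: (1 : blin X X)) u) f.
Proof.
rewrite blinDE blinNE blinZE blin1E elem_op_rank_one; apply: blinP => y.
rewrite !(blinDE, blinNE, blinZE, rank_oneE, precompE, subZE) blin_appB blin_appZ.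
rewrite scalerBl !scalerBr !scalerA -addrA; congr (_ + _).
rewrite (_ : nu *: f y = f y * nu); last by rewrite /GRing.scale /= mulrC.
by rewrite addKr; congr (- (_ *: _)); ring.
Qed.

Lemma drazin_power_bound {E : normedModType R[i]} (c : blin E E) :
  drazin_invertible c -> exists p (M : R),
    0 <= M /\ forall x, rn ((c ^+ p) x) <= M * rn ((c ^+ p.+1) x).
Proof.
move=> /drazin_invP [d [p [cd cp _ _]]]; exists p, (rn d); split; first exact: rn_ge0.
move=> x; have -> : c ^+ p = d * c ^+ p.+1.
  by rewrite cp; apply/commr_sym/commrX.
by rewrite blinME rn_blin.
Qed.

Lemma iter_scale_precomp mu (c : blin Y Y) n (f : blin Y R[i]) :
  iter n (fun f => mu *: precomp c f) f = mu ^+ n *: precomp (c ^+ n) f.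
Proof.
elim: n => [|n IH]; first by rewrite expr0 scale1r; apply: blinP => y.
rewrite iterS IH exprS -scalerA exprSr; congr (mu *: _).
exact: blinP.
Qed.

Lemma iter_scale (nu : R[i]) (c : blin X X) n (x : X) :
  iter n (fun x => nu *: c x) x = nu ^+ n *: (c ^+ n) x.
Proof.
elim: n => [|n IH]; first by rewrite !expr0 scale1r.
by rewrite iterS IH blin_appZ scalerA !exprS blinME.
Qed.

(** Up to small errors [tau - mu nu] acts on [rank_one u f] as [mu] times the adjoint of [T - nu] on
    [f]; cancelling [mu^p] requires [mu != 0]. The value [nu = 0] is allowed and serves at
    [lam = 0]. *)
Lemma drazin_factor_r mu nu :
    not_bounded_below (S - mu *: (1 : blin X X)) -> mu != 0 ->
    (exists2 d : R, 0 < d & forall k, 0 < rn k -> rn k < d ->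
      invertible (T - nu *: (1 : blin Y Y) - k *: (1 : blin Y Y))) ->
    drazin_invertible (tau - (mu * nu) *: (1 : blin (blin Y X) (blin Y X))) ->
  drazin_invertible (T - nu *: (1 : blin Y Y)).
Proof.
move=> Smu mu0 Tp /drazin_power_bound [p [M [M0 hM]]].
set c := T - _ in Tp *.
have fb (f : blin Y R[i]) :
    rn (precomp (c ^+ p) f) <= M * rn mu * rn (precomp (c ^+ p.+1) f).
  have := @power_bound_transfer R _ _ _ rank_one _ _ _ _ p M f rn_rank_one
    (tau_rank_one_l mu nu) Smu M0 hM.
  rewrite !iter_scale_precomp !rnZ !rnX [rn mu ^+ p.+1]exprS.
  have mup : 0 < rn mu ^+ p by rewrite exprn_gt0// rn_gt0.
  by move=> h; rewrite -(ler_pM2l mup); lra.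
apply: (drazin_of_bound (p := p) (M := M * rn mu) _ _ Tp).
  by rewrite mulr_ge0// rn_ge0.
move=> u cu.
(* The bound for functionals controls [f u c^p], with the power of [c] on the right; commutation
   brings it to the form [c^p u]. *)
have cuX n : c ^+ n * u = u * c ^+ n by apply/commr_sym/commrX/commr_sym.
rewrite !cuX; apply: rn_blin_le => [|y]; first by rewrite !mulr_ge0// rn_ge0.
have [f [f1 fy]] := norming_functional ((u * c ^+ p) y).
have f1' : rn f <= 1 by apply: rn_blin_le => // z; rewrite mul1r.
rewrite -fy; apply: (@le_trans _ _ (rn (precomp (c ^+ p) (precomp u f)) * rn y)).
  exact: (rn_blin (precomp (c ^+ p) (precomp u f)) y).
rewrite ler_wpM2r ?rn_ge0// (le_trans (fb _))// ler_wpM2l ?mulr_ge0 ?rn_ge0//.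
have -> : precomp (c ^+ p.+1) (precomp u f) = precomp (u * c ^+ p.+1) f by exact: blinP.
by rewrite (le_trans (rn_comp _ _))// ler_piMl// rn_ge0.
Qed.

Lemma drazin_factor_l mu nu :
    not_bounded_below (precomp (T - nu *: (1 : blin Y Y))) -> nu != 0 ->
    (exists2 d : R, 0 < d & forall k, 0 < rn k -> rn k < d ->
      invertible (S - mu *: (1 : blin X X) - k *: (1 : blin X X))) ->
    drazin_invertible (tau - (mu * nu) *: (1 : blin (blin Y X) (blin Y X))) ->
  drazin_invertible (S - mu *: (1 : blin X X)).
Proof.
move=> Tnu nu0 Sp /drazin_power_bound [p [M [M0 hM]]].
set c := S - _ in Sp *.
have fb (x : X) : rn ((c ^+ p) x) <= M * rn nu * rn ((c ^+ p.+1) x).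
  have := @power_bound_transfer R _ _ _ (fun f x => rank_one x f) _ _ _ _ p M x
    (fun f x => etrans (rn_rank_one x f) (mulrC _ _))
    (fun f u => tau_rank_one_r mu nu u f) Tnu M0 hM.
  rewrite !iter_scale !rnZ !rnX [rn nu ^+ p.+1]exprS.
  have nup : 0 < rn nu ^+ p by rewrite exprn_gt0// rn_gt0.
  by move=> h; rewrite -(ler_pM2l nup); lra.
apply: (drazin_of_bound (p := p) (M := M * rn nu) _ _ Sp).
  by rewrite mulr_ge0// rn_ge0.
move=> u _; apply: rn_blin_le => [|x]; first by rewrite !mulr_ge0// rn_ge0.
rewrite blinME (le_trans (fb _))// -[leRHS]mulrA ler_wpM2l ?mulr_ge0 ?rn_ge0//.
exact: (rn_blin (c ^+ p.+1 * u) x).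
Qed.

(** The transfer with [p = 0]: a left inverse of [tau - mu nu] would bound the adjoint of [T - nu]
    from below. *)
Lemma product_spectrum_l mu nu :
    not_bounded_below (S - mu *: (1 : blin X X)) ->
    not_bounded_below (precomp (T - nu *: (1 : blin Y Y))) ->
  spectrum tau (mu * nu).
Proof.
move=> Smu Tnu [V [_ Vt]].
have hM A : rn (((tau - (mu * nu) *: (1 : blin (blin Y X) (blin Y X))) ^+ 0) A) <=
    rn V * rn (((tau - (mu * nu) *: (1 : blin (blin Y X) (blin Y X))) ^+ 1) A).
  rewrite expr0 blin1E expr1; apply: le_trans (rn_blin _ _).
  by rewrite -blinME Vt.
have fb (f : blin Y R[i]) := @power_bound_transfer R _ _ _ rank_one _ _ _ _ 0 _ f
  rn_rank_one (tau_rank_one_l mu nu) Smu (rn_ge0 V) hM.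
have K0 : 0 < rn V * rn mu + 1 by rewrite ltr_wpDl ?mulr_ge0 ?rn_ge0.
have [|f fT] := Tnu (rn V * rn mu + 1)^-1; first by rewrite invr_gt0.
have := fb f; rewrite /= rnZ => h.
move: fT; rewrite ltr_pdivlMl//.
have := rn_ge0 (precomp (T - nu *: (1 : blin Y Y)) f); nra.
Qed.

(** The final contradiction of [product_spectrum_r]: [e] is the approximation error, [v], [t], [m],
    [f], [z], [y] are the norms of [V], [T], [mu], [ph], [z], [y], and [q] is [|ph z|]. *)
Lemma product_estimate (e v t m f z y q a b : R) :
  0 < f -> 0 <= z -> 0 < y -> e * (v * (t + m)) * 2 < 1 -> f / 2 * z < q ->
  y * q <= a + b -> a <= e * f * (v * z * (t * y)) ->
  b <= m * (f * (v * z * (e * y))) -> False.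
Proof.
move=> f0 z0 y0 eK hq hab ha hb.
have fzy : 0 <= f * z * y by rewrite !mulr_ge0// ltW.
have : y * (f / 2 * z) < y * q by rewrite ltr_pM2l.
have : e * (v * (t + m)) * 2 * (f * z * y) <= 1 * (f * z * y) by rewrite ler_wpM2r// ltW.
lra.
Qed.

(** Dual to [product_spectrum_l]: [A |-> ph (A y)] is an approximate eigenfunctional, small on the
    range of [tau - mu nu]. A right inverse [V] puts [rank_one z g] into that range, although its
    value [g(y) ph(z)] is large. *)
Lemma product_spectrum_r mu nu :
    not_bounded_below (precomp (S - mu *: (1 : blin X X))) ->
    not_bounded_below (T - nu *: (1 : blin Y Y)) ->
  spectrum tau (mu * nu).
Proof.
move=> Smu Tnu [V [tV _]].
have K0 : 0 <= rn V * (rn T + rn mu) by rewrite mulr_ge0 ?addr_ge0 ?rn_ge0.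
have [e e0 eK] : exists2 e : R, 0 < e & e * (rn V * (rn T + rn mu)) * 2 < 1.
  move: (rn V * _) K0 => K K0.
  have K1 : 0 < 2 * (K + 1) by rewrite mulr_gt0// ltr_wpDl.
  exists (2 * (K + 1))^-1; first by rewrite invr_gt0.
  by rewrite -mulrA mulrC ltr_pdivrMr// mul1r; lra.
have [ph hph] := Smu e e0; have [y hy] := Tnu e e0.
have ph0 : 0 < rn ph by have := le_lt_trans (rn_ge0 _) hph; rewrite pmulr_rgt0.
have y0 : 0 < rn y by have := le_lt_trans (rn_ge0 _) hy; rewrite pmulr_rgt0.
have [||z hz] := @rn_blin_lt _ _ _ ph (rn ph / 2).
- by rewrite divr_ge0// ltW.
- by rewrite ltr_pdivrMr// ltr_pMr// ltr1n.
have [g [g1 gy]] := norming_functional y.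
have g1' : rn g <= 1 by apply: rn_blin_le => // w; rewrite mul1r.
pose A := V (rank_one z g).
have AV : rn A <= rn V * rn z.
  rewrite (le_trans (rn_blin _ _))// ler_wpM2l ?rn_ge0// rn_rank_one.
  by rewrite ler_piMr// rn_ge0.
have phE : ph (rank_one z g y) =
    precomp (S - mu *: (1 : blin X X)) ph (A (T y)) +
    mu * ph (A ((T - nu *: (1 : blin Y Y)) y)).
  have -> : rank_one z g = tau A - (mu * nu) *: A.
    by rewrite -[RHS]/((tau - (mu * nu) *: (1 : blin (blin Y X) (blin Y X))) A) /A -blinME tV.
  change (ph (S (A (T y)) - (mu * nu) *: A y) =
    ph (S (A (T y)) - mu *: A (T y)) + mu * ph (A (T y - nu *: y))).
  rewrite (blin_appB A) (blin_appZ A) !(blin_appB ph) !(blin_appZ ph).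
  by rewrite /GRing.scale /=; ring.
have : rn (ph (rank_one z g y)) = rn y * rn (ph z).
  by rewrite rank_oneE blin_appZ rnM gy.
rewrite phE => E1.
have := ler_rnD (precomp (S - mu *: (1 : blin X X)) ph (A (T y)))
  (mu * ph (A ((T - nu *: (1 : blin Y Y)) y))).
rewrite E1 rnM.
have h1 : rn (precomp (S - mu *: (1 : blin X X)) ph (A (T y))) <=
    e * rn ph * (rn V * rn z * (rn T * rn y)).
  apply: le_trans (rn_blin _ _) _; apply: ler_pM; rewrite ?rn_ge0 ?(ltW hph)//.
  apply: le_trans (rn_blin _ _) _; apply: ler_pM; rewrite ?rn_ge0//.
  exact: rn_blin.
have h2 : rn (ph (A ((T - nu *: (1 : blin Y Y)) y))) <=
    rn ph * (rn V * rn z * (e * rn y)).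
  apply: le_trans (rn_blin _ _) _; apply: ler_wpM2l; rewrite ?rn_ge0//.
  apply: le_trans (rn_blin _ _) _; apply: ler_pM; rewrite ?rn_ge0//.
  exact: ltW.
move=> h3; exact: (product_estimate ph0 (rn_ge0 z) y0 eK hz h3 h1
  (ler_wpM2l (rn_ge0 mu) h2)).
Qed.

End SpectraOfElementaryOperators.

(** * Boundary points of the spectrum and products of spectral points *)

Section BoundaryPoints.
Local Open Scope complex_scope.
Context {R : realType}.

Lemma closed_has_max (A : set R) : A !=set0 -> has_ubound A ->
    (forall s, (forall e : R, 0 < e -> exists2 t, A t & `|t - s| < e) -> A s) ->
  exists2 s, A s & forall t, A t -> t <= s.
Proof.
move=> A0 Aub Acl; exists (sup A); last by move=> t At; exact: ub_le_sup.
apply: Acl => e e0; have [t At st] := sup_adherent e0 (conj A0 Aub).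
exists t => //; rewrite distrC ger0_norm; first by rewrite ltrBlDr addrC -ltrBlDr.
by rewrite subr_ge0 ub_le_sup.
Qed.

Section Spectrum.
Context {E : completeNormedModType R[i]} (c : blin E E).

Definition spectral_boundary z := spectrum c z /\
  forall e : R, 0 < e -> exists2 z', rn (z' - z) < e & ~ spectrum c z'.

Lemma spectrum_closed z :
  (forall e : R, 0 < e -> exists2 z', spectrum c z' & rn (z' - z) < e) -> spectrum c z.
Proof.
move=> h /invertible_open [e e0 eo]; have [z' sz' zz'] := h e e0; apply: sz'.
have := eo _ zz'; rewrite -addrA -opprD -scalerDl addrC.
by rewrite addrC subrKC.
Qed.

Lemma not_spectrum z : ~ spectrum c z <-> invertible (c - z *: (1 : blin E E)).
Proof. by split => [/contrapT//|]; move=> ? ?. Qed.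

Lemma spectrum_le z : spectrum c z -> rn z <= rn c.
Proof. by move=> sz; rewrite leNgt; apply/negP => /spectrum_bounded. Qed.

Lemma spectral_boundary_not_bounded_below z : spectral_boundary z ->
  not_bounded_below (c - z *: (1 : blin E E)) /\
  not_bounded_below (precomp (c - z *: (1 : blin E E))).
Proof.
move=> [sz bz]; apply: boundary_not_bounded_below => // e /bz [z' zz' /not_spectrum iz'].
exists (z' - z) => //.
by rewrite -addrA -opprD -scalerDl addrC addrC subrKC.
Qed.

Definition punctured z := exists2 d : R, 0 < d & forall k, 0 < rn k -> rn k < d ->
  invertible (c - z *: (1 : blin E E) - k *: (1 : blin E E)).

Lemma punctured_boundary z : spectrum c z -> punctured z -> spectral_boundary z.
Proof.
move=> sz [d d0 dP]; split => // e e0.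
pose r := Num.min d e / 2.
have r0 : 0 < r by rewrite divr_gt0// lt_min d0.
have rr : rn r%:C = r by rewrite rnR ger0_norm// ltW.
have rm : r < Num.min d e by rewrite ltr_pdivrMr// ltr_pMr ?ltr1n// lt_min d0.
exists (z + r%:C).
  by rewrite addrAC subrr add0r rr (lt_le_trans rm)// ge_min lexx orbT.
apply/not_spectrum; rewrite scalerDl opprD addrA; apply: dP; rewrite rr//.
by rewrite (lt_le_trans rm)// ge_min lexx.
Qed.

(** The last spectral point on the ray through [z], going away from 0, is on the boundary. *)
Lemma nonzero_boundary z : spectrum c z -> z != 0 ->
  exists2 z', spectral_boundary z' & z' != 0.
Proof.
move=> sz z0; have rz : 0 < rn z by rewrite rn_gt0.
have [|||t [t1 st] tmax] := @closed_has_max [set t : R | 1 <= t /\ spectrum c (t%:C * z)].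
- by exists 1; split => //=; rewrite mul1r.
- exists (rn c / rn z) => t [t1 /spectrum_le]; rewrite rnM rnR ger0_norm ?(le_trans ler01)//.
  by rewrite ler_pdivlMr.
- move=> s h; split.
    rewrite leNgt; apply/negP => s1; have [|t [t1 _]] := h (1 - s); first by rewrite subr_gt0.
    by rewrite ltNge ler_normr lerD2r t1.
  apply: spectrum_closed => e e0; have [|t [t1 st] ts] := h (e / rn z).
    by rewrite divr_gt0.
  exists (t%:C * z) => //.
  by rewrite -mulrBl rnM -rmorphB rnR -ltr_pdivlMr.
have t0 : 0 < t by rewrite (lt_le_trans ltr01).
exists (t%:C * z); last first.
  by rewrite -rn_gt0 rnM rnR mulr_gt0// normr_gt0 gt_eqF.
split=> // e e0; exists ((t + e / (2 * rn z))%:C * z).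
  rewrite -mulrBl -rmorphB addrAC subrr add0r rnM rnR ger0_norm ?divr_ge0 ?mulr_ge0 ?ltW//.
  by rewrite invfM mulrA divfK ?gt_eqF// ltr_pdivrMr// ltr_pMr// ltr1n.
have ez : 0 < e / (2 * rn z) by rewrite divr_gt0// mulr_gt0.
have t1' : 1 <= t + e / (2 * rn z) by rewrite (le_trans t1)// lerDl ltW.
by move=> st'; have := tmax _ (conj t1' st'); rewrite gerDl leNgt ez.
Qed.

End Spectrum.

Section Tau.
Context {X Y : completeNormedModType R[i]} (S : blin X X) (T : blin Y Y).
Notation tau := (elem_op S T).

(** At a boundary point [S] and its adjoint both have approximate eigenvectors, so whichever kind
    [T] has at [nu] finds its partner. *)
Lemma boundary_product_l mu nu : spectral_boundary S mu -> spectrum T nu ->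
  spectrum tau (mu * nu).
Proof.
move=> /spectral_boundary_not_bounded_below [S1 S2] /not_invertible_cases [T1|T1].
  exact: product_spectrum_r.
exact: product_spectrum_l.
Qed.

Lemma boundary_product_r mu nu : spectrum S mu -> spectral_boundary T nu ->
  spectrum tau (mu * nu).
Proof.
move=> /not_invertible_cases [S1|S1] /spectral_boundary_not_bounded_below [T1 T2].
  exact: product_spectrum_l.
exact: product_spectrum_r.
Qed.

(* Move along [(t mu, nu / t)] until one of the two points is about to leave its
   spectrum, hence lies on the boundary. *)
Lemma product_spectrum mu nu : spectrum S mu -> spectrum T nu -> mu * nu != 0 ->
  spectrum tau (mu * nu).
Proof.
move=> sS sT; rewrite mulf_eq0 negb_or => /andP[mu0 nu0].
have rmu : 0 < rn mu by rewrite rn_gt0.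
have rnu : 0 < rn nu by rewrite rn_gt0.
(* Inversion is 1-Lipschitz on [t >= 1]. *)
have inv_lip (s t : R) : 1 <= s -> 1 <= t ->
    rn (s^-1%:C * nu - t^-1%:C * nu) <= `|s - t| * rn nu.
  move=> s1 t1; rewrite -mulrBl rnM -rmorphB rnR ler_wpM2r ?rn_ge0//.
  have s0 : 0 < s by rewrite (lt_le_trans ltr01).
  have t0 : 0 < t by rewrite (lt_le_trans ltr01).
  have -> : s^-1 - t^-1 = (t - s) / (s * t) by field; rewrite !gt_eqF.
  rewrite normrM [`|t - s|]distrC ler_piMr// normfV invf_le1 ?normr_gt0 ?gt_eqF ?mulr_gt0//.
  by rewrite ger0_norm ?mulr_ege1// mulr_ge0// ltW.
have [|||t [t1 [stS stT]] tmax] := @closed_has_max [set t : R | 1 <= t /\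
    (spectrum S (t%:C * mu) /\ spectrum T (t^-1%:C * nu))].
- by exists 1; split => //=; rewrite invr1 !mul1r.
- exists (rn S / rn mu) => t [t1 [/spectrum_le]]; rewrite rnM rnR ger0_norm ?(le_trans ler01)//.
  by rewrite ler_pdivlMr.
- move=> s h.
  have s1 : 1 <= s.
    rewrite leNgt; apply/negP => s1; have [|t [t1 _]] := h (1 - s); first by rewrite subr_gt0.
    by rewrite ltNge ler_normr lerD2r t1.
  split => //; split.
    apply: spectrum_closed => e e0; have [|t [t1 [st _]] ts] := h (e / rn mu).
      by rewrite divr_gt0.
    exists (t%:C * mu) => //.
    by rewrite -mulrBl rnM -rmorphB rnR -ltr_pdivlMr.
  apply: spectrum_closed => e e0; have [|t [t1 [_ st]] ts] := h (e / rn nu).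
    by rewrite divr_gt0.
  exists (t^-1%:C * nu) => //.
  by rewrite (le_lt_trans (inv_lip _ _ _ _))// -ltr_pdivlMr.
have t0 : 0 < t by rewrite (lt_le_trans ltr01).
have -> : mu * nu = (t%:C * mu) * (t^-1%:C * nu).
  by rewrite mulrACA -rmorphM mulfV ?gt_eqF// mul1r.
(* At the maximal [t], either [s mu] leaves the spectrum of [S] for some [s] arbitrarily close above
   [t], or it stays in it for a while; then maximality expels [nu / s] from the spectrum of [T]. *)
have [bS|/existsNP [e /not_implyP [e0 he]]] := pselect (forall e : R, 0 < e ->
    exists2 s, t < s < t + e & ~ spectrum S (s%:C * mu)).
  apply: boundary_product_l => //; split => // e e0.
  have [|s /andP[ts se] sS'] := bS (e / rn mu); first by rewrite divr_gt0.
  exists (s%:C * mu) => //.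
  rewrite -mulrBl rnM -rmorphB rnR ger0_norm ?subr_ge0 ?ltW//.
  by rewrite -ltr_pdivlMr// ltrBlDl.
apply: boundary_product_r => //; split => // d d0.
pose s := t + Num.min e (d / rn nu) / 2.
have m0 : 0 < Num.min e (d / rn nu) by rewrite lt_min e0 divr_gt0.
have ts : t < s by rewrite ltrDl divr_gt0.
have sm : s - t < Num.min e (d / rn nu).
  by rewrite /s addrAC subrr add0r ltr_pdivrMr// ltr_pMr// ltr1n.
have s1 : 1 <= s by rewrite (le_trans t1)// ltW.
exists (s^-1%:C * nu).
  rewrite (le_lt_trans (inv_lip _ _ _ _))// ger0_norm ?subr_ge0 ?ltW//.
  by rewrite -ltr_pdivlMr// (lt_le_trans sm)// ge_min lexx orbT.
move=> sT'; apply: he; exists s.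
  by rewrite ts /= -ltrBlDl (lt_le_trans sm)// ge_min lexx.
by move=> sS'; have := tmax s (conj s1 (conj sS' sT')); rewrite leNgt ts.
Qed.

(** By [product_spectrum] a punctured disc free of [sigma(tau)] gives one around [mu] and one around
    [nu]; their radii also keep the shifted points away from 0. These discs make both points
    boundary points and supply the last hypothesis of [drazin_of_bound]. *)
Lemma drazin_both mu nu : spectrum S mu -> spectrum T nu -> mu * nu != 0 ->
    drazin_invertible (tau - (mu * nu) *: (1 : blin (blin Y X) (blin Y X))) ->
  drazin_invertible (S - mu *: (1 : blin X X)) /\
  drazin_invertible (T - nu *: (1 : blin Y Y)).
Proof.
move=> sS sT munu dt; have := munu; rewrite mulf_eq0 negb_or => /andP[mu0 nu0].
have rmu : 0 < rn mu by rewrite rn_gt0.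
have rnu : 0 < rn nu by rewrite rn_gt0.
have [d d0 dP] := drazin_punctured dt.
have neq (a k : R[i]) : rn k < rn a -> a + k != 0.
  by move=> ka; apply/eqP => /eqP; rewrite addr_eq0 => /eqP ak; move: ka; rewrite ak rnN ltxx.
have pS : punctured S mu.
  exists (Num.min (rn mu) (d / rn nu)); first by rewrite lt_min rmu divr_gt0.
  move=> k k0; rewrite lt_min ltr_pdivlMr// => /andP[kmu knu].
  rewrite -addrA -opprD -scalerDl; apply: contrapT => sk.
  have /product_spectrum := sk => /(_ _ sT); rewrite mulf_neq0 ?neq// => /(_ isT); apply.
  rewrite mulrDl scalerDl opprD addrA; apply: dP; rewrite rnM//.
  exact: mulr_gt0.
have pT : punctured T nu.
  exists (Num.min (rn nu) (d / rn mu)); first by rewrite lt_min rnu divr_gt0.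
  move=> k k0; rewrite lt_min ltr_pdivlMr// => /andP[knu kmu].
  rewrite -addrA -opprD -scalerDl; apply: contrapT => sk.
  have /(product_spectrum sS) := sk; rewrite mulf_neq0 ?neq// => /(_ isT); apply.
  rewrite mulrDr scalerDl opprD addrA; apply: dP; rewrite rnM//.
    exact: mulr_gt0.
  by rewrite mulrC.
have [S1 _] := spectral_boundary_not_bounded_below (punctured_boundary sS pS).
have [_ T2] := spectral_boundary_not_bounded_below (punctured_boundary sT pT).
split; first exact: (drazin_factor_l T2 nu0 pS dt).
exact: (drazin_factor_r S1 mu0 pT dt).
Qed.

(** The case [nu = 0] of [drazin_factor_r], at a non-zero boundary point [m]. A spectral point [k]
    of [T] close to 0 but different from it would put [m k] into the punctured disc free of
    [sigma(tau)]. *)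
Lemma drazin_right_factor mu : spectrum S mu -> mu != 0 ->
  drazin_invertible tau -> drazin_invertible T.
Proof.
move=> sS mu0 dt; have [m mb {mu0 sS}mu0] := nonzero_boundary sS mu0.
have [S1 _] := spectral_boundary_not_bounded_below mb.
have [d d0 dP] := drazin_punctured dt.
rewrite -[T]subr0 -(scale0r (1 : blin Y Y)); apply: (drazin_factor_r S1 mu0).
  exists (d / rn m); first by rewrite divr_gt0// rn_gt0.
  move=> k k0; rewrite ltr_pdivlMr ?rn_gt0// => kd.
  rewrite scale0r subr0; apply: contrapT => sk.
  apply: (boundary_product_l mb sk); apply: dP; rewrite rnM ?mulr_gt0 ?rn_gt0//.
    by rewrite -rn_gt0.
  by rewrite mulrC.
by rewrite mulr0 scale0r subr0.
Qed.

Lemma drazin_left_factor nu : spectrum T nu -> nu != 0 ->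
  drazin_invertible tau -> drazin_invertible S.
Proof.
move=> sT nu0 dt; have [m mb {nu0 sT}nu0] := nonzero_boundary sT nu0.
have [_ T2] := spectral_boundary_not_bounded_below mb.
have [d d0 dP] := drazin_punctured dt.
rewrite -[S]subr0 -(scale0r (1 : blin X X)); apply: (drazin_factor_l T2 nu0).
  exists (d / rn m); first by rewrite divr_gt0// rn_gt0.
  move=> k k0; rewrite ltr_pdivlMr ?rn_gt0// => kd.
  rewrite scale0r subr0; apply: contrapT => sk.
  apply: (boundary_product_r sk mb); apply: dP; rewrite rnM ?mulr_gt0 ?rn_gt0//.
  by rewrite -rn_gt0.
by rewrite mul0r scale0r subr0.
Qed.

End Tau.
End BoundaryPoints.

(** * Poles of the resolvent *)

Section PowerSeries.
Local Open Scope complex_scope.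
Context {R : realType}.

Lemma cvg_lipschitz {U V : normedModType R[i]} (F : U -> V) (K : R) (u : nat -> U) (l : U) :
  (forall x y, rn (F x - F y) <= K * rn (x - y)) -> u @ \oo --> l ->
  (fun n => F (u n)) @ \oo --> F l.
Proof.
move=> FK /cvg_rnP ul; apply/cvg_rnP => e e0.
have K1 : 0 < `|K| + 1 by rewrite ltr_wpDl.
have [|N hN] := ul (e / (`|K| + 1)); first by rewrite divr_gt0.
exists N => n /hN; rewrite ltr_pdivlMr// => h.
apply: le_lt_trans (FK _ _) _; have := ler_norm K; have := rn_ge0 (u n - l); nra.
Qed.

Lemma power_series_eq0 {V : normedModType R[i]} (h : nat -> V) (d : R) : 0 < d ->
    (forall w : R[i], 0 < rn w -> rn w < d ->
      series (fun n => w ^+ n *: h n) @ \oo --> (0 : V)) ->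
  forall n, h n = 0.
Proof.
move=> d0 hw.
have [r r0 rd] : exists2 r : R, 0 < r & r < d.
  by exists (d / 2); rewrite ?divr_gt0// ltr_pdivrMr// ltr_pMr// ltr1n.
have rr : rn r%:C = r by rewrite rnR ger0_norm// ltW.
(* Beyond [N] a term is the difference of two partial sums of norm below 1, whence the 2; the finite
   sum covers the earlier terms. *)
have [C C0 hC] : exists2 C : R, 0 <= C & forall m, r ^+ m * rn (h m) <= C.
  have /cvg_rnP/(_ 1 ltr01) [N hN] : series (fun n => r%:C ^+ n *: h n) @ \oo --> (0 : V).
    by apply: hw; rewrite rr.
  have S0 m : 0 <= \sum_(i < m) r ^+ i * rn (h i).
    by apply: sumr_ge0 => i _; rewrite mulr_ge0 ?exprn_ge0 ?rn_ge0// ltW.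
  exists (2 + \sum_(i < N) r ^+ i * rn (h i)); first by rewrite addr_ge0.
  move=> m; have [Nm|mN] := leqP N m.
    rewrite -[leLHS]addr0 lerD//.
    have := hN _ Nm; have := hN _ (leqW Nm); rewrite !subr0.
    rewrite (_ : _ * _ = rn (series (fun n => r%:C ^+ n *: h n) m.+1 -
        series (fun n => r%:C ^+ n *: h n) m)).
      by move=> h1 h2; rewrite (le_trans (ler_rnB _ _))//; lra.
    by rewrite seriesSB rnZ rnX rr.
  rewrite -[leLHS]add0r lerD// (bigD1 (Ordinal mN))//= lerDl.
  by apply: sumr_ge0 => i _; rewrite mulr_ge0 ?exprn_ge0 ?rn_ge0// ltW.
move=> n; elim/ltn_ind: n => n IH.
(* The coefficients before [n] vanish, so [w^n h n] is minus the tail of a series with sum 0, which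
   is [O(q^(n+1))]; cancel [q^n]. *)
have key (q : R) : 0 < q -> q <= 2^-1 -> r ^+ n * rn (h n) <= 2 * C * q.
  move=> q0 q2; pose w := (q * r)%:C.
  have wr : rn w = q * r by rewrite rnR ger0_norm// mulr_ge0// ltW.
  (* The factor [1 - q^j] makes the induction close, and [q <= 1/2] accounts for the 2. *)
  have tail j : rn (series (fun n => w ^+ n *: h n) (n.+1 + j)%N - w ^+ n *: h n) <=
      2 * C * q ^+ n.+1 * (1 - q ^+ j).
    elim: j => [|j IHj].
      rewrite addn0 expr0 subrr mulr0 seriesSr addrK seriesEord /= big1 ?rn0//.
      by move=> i _; rewrite IH ?scaler0.
    rewrite addnS seriesSr addrAC (le_trans (ler_rnD _ _))//.
    have : rn (w ^+ (n.+1 + j) *: h (n.+1 + j)%N) <= C * q ^+ n.+1 * q ^+ j.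
      rewrite rnZ rnX wr exprMn -mulrA -mulrA -exprD mulrC.
      by rewrite ler_wpM2r ?exprn_ge0 ?hC// ltW.
    have qj : 0 <= C * q ^+ n.+1 * q ^+ j by rewrite !mulr_ge0 ?exprn_ge0// ltW.
    have : C * q ^+ n.+1 * q ^+ j * q <= C * q ^+ n.+1 * q ^+ j * 2^-1 by rewrite ler_wpM2l.
    rewrite [q ^+ j.+1]exprSr; move: IHj; move: (q ^+ n.+1) => a; move: (q ^+ j) => b; lra.
  have /cvg_rnP lim0 : series (fun n => w ^+ n *: h n) @ \oo --> (0 : V).
    apply: hw; rewrite wr; first exact: mulr_gt0.
    by rewrite (le_lt_trans _ rd)// ler_piMl ?(ltW r0)//; lra.
  have : q ^+ n * (r ^+ n * rn (h n)) <= q ^+ n * (2 * C * q).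
    apply/ler_addgt0Pr => e e0; have [N hN] := lim0 e e0.
    have := hN _ (leq_addl n.+1 N); rewrite subr0 => /ltW h1.
    have h2 := tail N.
    rewrite mulrA -exprMn -wr -rnX -rnZ.
    rewrite -[_ *: _]opprK rnN -[- _](addKr (series (fun n => w ^+ n *: h n) (n.+1 + N)%N)).
    rewrite addrC (le_trans (ler_rnB _ _))// lerD// (le_trans h2)//.
    rewrite [q ^+ n * _]mulrC -[2 * C * q * _]mulrA -exprS ler_piMr//.
      by rewrite !mulr_ge0 ?exprn_ge0// ltW.
    by rewrite gerBl exprn_ge0// ltW.
  by rewrite ler_pM2l// exprn_gt0.
apply: rn0_eq0; apply/eqP; rewrite eq_le rn_ge0 andbT leNgt; apply/negP => hn.
have rn0 : 0 < r ^+ n * rn (h n) by rewrite mulr_gt0// exprn_gt0.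
have C1 : 0 < 2 * C + 1 by rewrite ltr_wpDl// mulr_ge0.
pose q := Num.min 2^-1 (r ^+ n * rn (h n) / (2 * C + 1)) / 2.
have m0 : 0 < Num.min 2^-1 (r ^+ n * rn (h n) / (2 * C + 1)).
  by rewrite lt_min invr_gt0 ltr0n divr_gt0.
have q0 : 0 < q by rewrite divr_gt0.
have qm : q < Num.min 2^-1 (r ^+ n * rn (h n) / (2 * C + 1)).
  by rewrite ltr_pdivrMr// ltr_pMr// ltr1n.
move: qm; rewrite lt_min => /andP[/ltW q2]; rewrite ltr_pdivlMr// => h1.
have := key q q0 q2; lra.
Qed.


Lemma power_series_shift {V : normedModType R[i]} (G : nat -> V) (w : R[i]) (l : V) :
  series (fun n => w ^+ n *: G n) @ \oo --> l ->
  series (fun n => w ^+ n *: (if n is m.+1 then G m else 0)) @ \oo --> w *: l.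
Proof.
move=> Gl; rewrite -cvg_shiftS /=.
rewrite (_ : (fun n => _) = fun n => w *: series (fun n => w ^+ n *: G n) n).
  by apply: (@cvg_lipschitz V V ( *:%R w) (rn w)) => // x y; rewrite -scalerBr rnZ.
apply/funext => n; rewrite !seriesEord /= big_ord_recl scaler0 add0r scaler_sumr.
by apply: eq_bigr => i _; rewrite scalerA -exprS.
Qed.

Lemma power_series_monomial {V : normedModType R[i]} (w : R[i]) (p : nat) (v : V) :
  series (fun n => w ^+ n *: (if n == p then v else 0)) @ \oo --> w ^+ p *: v.
Proof.
apply/cvg_rnP => e e0; exists p.+1 => n pn.
rewrite seriesEord /= (bigD1 (Ordinal pn))//= eqxx big1 ?addr0 ?subrr ?rn0//.
by move=> i; rewrite -val_eqE /= => /negbTE ->; rewrite scaler0.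
Qed.

(* Comparison of the coefficients of [w^k] in [w G(w) - F(G(w)) = w^p v]. *)
Lemma power_series_equation {V : normedModType R[i]} (F : {linear V -> V}) (K : R)
    (G : nat -> V) (p : nat) (v : V) (d : R) : 0 < d ->
    (forall x, rn (F x) <= K * rn x) ->
    (forall w : R[i], 0 < rn w -> rn w < d ->
      exists2 l, series (fun n => w ^+ n *: G n) @ \oo --> l & w *: l - F l = w ^+ p *: v) ->
  forall k, F (G k) = (if k is m.+1 then G m else 0) - (if k == p then v else 0).
Proof.
move=> d0 FK Gw k.
pose h k := (if k is m.+1 then G m else 0) - F (G k) - (if k == p then v else 0).
suff : h k = 0.
  by rewrite /h => /eqP; rewrite subr_eq0 subr_eq => /eqP ->; rewrite addrAC subrr add0r.
apply: (power_series_eq0 d0) => w w0 wd.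
have [l Gl lE] := Gw w w0 wd.
rewrite -(subrr (w ^+ p *: v)) -{1}lE.
rewrite (_ : series _ = fun n => series (fun n => w ^+ n *: (if n is m.+1 then G m else 0)) n -
   F (series (fun n => w ^+ n *: G n) n) -
   series (fun n => w ^+ n *: (if n == p then v else 0)) n).
  apply: cvgB; last exact: power_series_monomial.
  apply: cvgB; first exact: power_series_shift.
  by apply: (cvg_lipschitz (K := K)) Gl => x y; rewrite -linearB; exact: FK.
apply/funext => n; rewrite !seriesEord /= linear_sum /= -!sumrB.
by apply: eq_bigr => i _; rewrite /h linearZ_LR !scalerBr.
Qed.

End PowerSeries.

Section Poles.
Local Open Scope complex_scope.
Context {R : realType}.

Lemma nbhs_rnP (z : R[i]) (A : set R[i]) :
  nbhs z A <-> exists2 d : R, 0 < d & forall z', rn (z' - z) < d -> A z'.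
Proof.
split => [/nbhs_ballP [e /= e0 eA]|[d d0 dA]].
  have eE : (complex.Re e)%:C = e.
    by rewrite [RHS]complexE (ger0_Im (ltW e0)) /= mulr0 addr0.
  exists (complex.Re e); first by rewrite -ltcR eE.
  by move=> z' zz'; apply: eA; rewrite -ball_normE /= -rnE -eE ltcR rnB.
apply/nbhs_ballP; exists d%:C => /=; first by rewrite ltcR.
by move=> z'; rewrite -ball_normE /= -rnE ltcR rnB => /dA.
Qed.

Context {E : completeNormedModType R[i]} (c : blin E E).

Lemma isolated_spectrum z : isolated (spectrum c) z <->
  spectrum c z /\ exists2 d : R, 0 < d &
    forall k, 0 < rn k -> rn k < d -> ~ spectrum c (z + k).
Proof.
split.
  move=> [/set_mem sz [V /nbhs_rnP [d d0 dV] VE]]; split => //; exists d => //.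
  move=> k k0 kd sk; have : (V `&` spectrum c) (z + k).
    by split => //; apply: dV; rewrite addrAC subrr add0r.
  rewrite VE => /= /eqP; rewrite -subr_eq0 addrAC subrr add0r => /eqP kE.
  by move: k0; rewrite kE rn0 ltxx.
move=> [sz [d d0 dP]]; split; first exact/mem_set.
exists [set z' | rn (z' - z) < d]; first by apply/nbhs_rnP; exists d.
apply/seteqP; split => [z' /= [zz' sz']|_ ->]; last by rewrite /= subrr rn0.
apply/eqP; rewrite -subr_eq0 -[_ == _]negbK -rn_gt0; apply/negP => k0.
by apply: (dP _ k0 zz'); rewrite addrC subrK.
Qed.

Lemma resolventP z w : rn w != 0 -> ~ spectrum c (z + w) ->
  inverse_pair (w *: (1 : blin E E) - (c - z *: (1 : blin E E))) (resolvent c (z + w)).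
Proof.
move=> w0 /not_spectrum [r rP]; rewrite /resolvent.
have -> : w *: (1 : blin E E) - (c - z *: (1 : blin E E)) = (z + w) *: (1 : blin E E) - c.
  by rewrite opprB scalerDl addrCA addrA.
apply: xgetPex; exists (- r); case: rP => r1 r2.
by split; rewrite -[_ - c]opprB mulrNN.
Qed.

Lemma blin_exprZn k (f : blin E E) n : (k *: f) ^+ n = k ^+ n *: f ^+ n.
Proof.
elim: n => [|n IH]; first by rewrite !expr0 scale1r.
by rewrite !exprS IH -blin_scalerAl -blin_scalerAr scalerA.
Qed.

(** Multiplied by [w^p], the Laurent series becomes the power series with coefficients
    [G = b_p, ..., b_1, a_0, a_1, ...]. Comparing coefficients in [(w - x) R = 1] gives
    [x G_k = G_(k-1)] for [k <> p] and [x G_p = G_(p-1) - 1]. Hence [x^p G_(p-1) = 0], and [- G_p],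
    which is [- a_0], satisfies the criterion with exponent [p]. *)
Lemma poles_drazin z : poles c z -> drazin_invertible (c - z *: (1 : blin E E)).
Proof.
move=> [/isolated_spectrum [sz [d d0 dP]] [p p1 [a [b [lau bp bm]]]]].
have [d' d'0 lau'] : exists2 d' : R, 0 < d' & forall w, 0 < rn w -> rn w < d' ->
    exists u v : blin E E, [/\ series (fun n => w ^+ n *: a n) @ \oo --> u,
      series (fun n => w ^- n.+1 *: b n.+1) @ \oo --> v & resolvent c (z + w) = u + v].
  have [d' d'0 h] := iffLR (nbhs_rnP _ _) lau; exists d' => // w w0 wd.
  have := h (z + w); rewrite addrAC subrr add0r => /(_ wd); apply.
  by apply/eqP => /eqP; rewrite -subr_eq0 addrAC subrr add0r -[_ == _]negbK -rn_gt0 w0.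
set x := c - z *: (1 : blin E E).
pose G k := if (k < p)%N then b (p - k)%N else a (k - p)%N.
pose D := Num.min d d'.
have D0 : 0 < D by rewrite lt_min d0.
have Gser (w : R[i]) : 0 < rn w -> rn w < D ->
    series (fun n => w ^+ n *: G n) @ \oo --> w ^+ p *: resolvent c (z + w).
  move=> w0; rewrite lt_min => /andP[wd /(lau' _ w0) [u [v [au bv ->]]]].
  have wn0 : w != 0 by rewrite -rn_gt0.
  have vE : v = \sum_(n < p) w ^- n.+1 *: b n.+1.
    apply: (@cvg_unique _ (@norm_hausdorff _ (blin E E)) _ _ _ _ bv).
    apply/cvg_rnP => e e0; exists p => n /subnKC <-.
    rewrite seriesEord /= big_split_ord /= [X in _ + X - _]big1 ?addr0 ?subrr ?rn0//.
    by move=> i _; rewrite bm ?scaler0// ltnS leq_addr.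
  rewrite -(cvg_shiftn p) /=.
  rewrite (_ : (fun n => _) = fun n => w ^+ p *: (series (fun n => w ^+ n *: a n) n + v)).
    apply: (cvg_lipschitz (F := fun t => w ^+ p *: (t + v)) (K := rn (w ^+ p))) au.
    by move=> s t; rewrite -scalerBr rnZ opprD addrACA subrr addr0.
  apply/funext => n; rewrite addnC !seriesEord /= big_split_ord /= addrC scalerDr; congr (_ + _).
    rewrite scaler_sumr; apply: eq_bigr => i _.
    by rewrite /G ltnNge leq_addr /= addKn exprD scalerA.
  rewrite vE scaler_sumr (reindex_inj rev_ord_inj) /=; apply: eq_bigr => i _.
  rewrite scalerA -[X in w ^+ X / _](subnK (ltn_ord i)) exprD mulfK ?expf_neq0//.
  rewrite /G ifT; last by rewrite ltn_subrL /= (leq_trans _ (ltn_ord i)).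
  by rewrite subKn.
(* [F] is left or right multiplication by [x]; both obey the same recursion, so [G p] commutes with
   [x]. *)
have Geq (F : blin (blin E E) (blin E E)) :
    (forall w r, inverse_pair (w *: (1 : blin E E) - x) r -> w *: r - F r = 1) ->
    forall k, F (G k) = (if k is m.+1 then G m else 0) - (if k == p then 1 else 0).
  move=> Fr; apply: (@power_series_equation _ _ F (rn F) G p 1 D) => //.
    by move=> y; exact: rn_blin.
  move=> w w0 wD; exists (w ^+ p *: resolvent c (z + w)); first exact: Gser.
  have /Fr <- : inverse_pair (w *: (1 : blin E E) - x) (resolvent c (z + w)).
    apply: resolventP; first by rewrite gt_eqF.
    by apply: dP => //; rewrite (lt_le_trans wD)// ge_min lexx.
  rewrite [RHS]scalerBr !scalerA [w * _]mulrC; congr (_ - _).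
  exact: (blin_appZ F).
have L k : x * G k = (if k is m.+1 then G m else 0) - (if k == p then 1 else 0).
  have -> : x * G k = elem_op x (1 : blin E E) (G k) by exact: blinP.
  apply: Geq => w r [wr _]; rewrite -[RHS]wr mulrBl -blin_scalerAl mul1r; congr (_ - _).
  exact: blinP.
have Rr k : G k * x = (if k is m.+1 then G m else 0) - (if k == p then 1 else 0).
  have -> : G k * x = elem_op (1 : blin E E) x (G k) by exact: blinP.
  apply: Geq => w r [_ rw]; rewrite -[RHS]rw mulrBr -blin_scalerAr mulr1; congr (_ - _).
  exact: blinP.
have Gk k : (k < p)%N -> x ^+ k.+1 * G k = 0.
  elim: k => [|k IH] kp; rewrite exprSr -mulrA L (ltn_eqF kp) subr0 ?mulr0//.
  by rewrite IH// ltnW.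
apply: (@drazin_criterion _ x (- G p) p); first by rewrite mulrN mulNr L Rr.
have [q pE] : exists q, p = q.+1 by exists p.-1; rewrite prednK.
have qp : (q < p)%N by rewrite pE.
have := L q.+1; rewrite /= -[in _ == p]pE eqxx => LE.
by rewrite pE mulrN [x ^+ q.+2]exprSr -mulrA LE mulrBr mulr1 opprB Gk// subr0.
Qed.

(* Laurent coefficients at [z] in terms of the Drazin inverse [d] of
   [x = c - z]: [a_n = - d^(n+1)] and [b_(n+1) = x^n (1 - x d)]. *)
Lemma drazin_poles z : spectrum c z -> drazin_invertible (c - z *: (1 : blin E E)) ->
  poles c z.
Proof.
move=> sz dz; have [r r0 rP] := drazin_punctured dz.
split.
  apply/isolated_spectrum; split => //; exists r => // k k0 kr.
  by apply/not_spectrum; rewrite scalerDl opprD addrA; exact: rP.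
set x := c - z *: (1 : blin E E) in dz rP.
have [d [m [xd xm dxd _]]] := drazin_invP dz.
pose e := 1 - x * d.
have em : `[< x ^+ m * e = 0 >].
  by apply/asboolP; rewrite mulrBr mulr1 mulrA -exprSr -xm subrr.
pose P n := `[< x ^+ n * e = 0 >].
have exP : exists n, P n by exists m.
(* [q] is the order of the pole: minimality becomes [b q <> 0], and [q = 0] would make [x]
   invertible. *)
case: (ex_minnP exP) => q /asboolP qe qmin.
have eX n k : x ^+ n * e = 0 -> x ^+ (k + n) * e = 0.
  by move=> h; rewrite exprD -mulrA h mulr0.
have q0 : (0 < q)%N.
  rewrite lt0n; apply/eqP => q0; apply: sz.
  move: qe; rewrite q0 expr0 mul1r => /eqP; rewrite subr_eq0 => /eqP xd1.
  by exists d; split; rewrite -?xd -xd1.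
exists q => //.
pose a n : blin E E := - d ^+ n.+1.
pose b n : blin E E := if n is k.+1 then x ^+ k * e else 0.
exists a, b; split; last first.
- by move=> [//|k]; rewrite ltnS => qk /=; rewrite -(subnK qk); exact: eX.
- rewrite /b; case: q q0 qe qmin => // k _ _ qmin ke.
  by have := qmin k; rewrite ltnn => /(_ (asboolT ke)).
have d1 : 0 < rn d + 1 by rewrite ltr_wpDl// rn_ge0.
apply/nbhs_rnP; exists (Num.min r (rn d + 1)^-1); first by rewrite lt_min r0 invr_gt0.
move=> z'; rewrite lt_min => /andP[zr zd] /eqP z'z.
pose w := z' - z; have z'E : z' = z + w by rewrite addrC subrK.
have w0 : w != 0 by rewrite subr_eq0; apply/eqP.
have rw : 0 < rn w by rewrite rn_gt0.
have wd : rn (w *: d) < 1.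
  rewrite rnZ (le_lt_trans (y := rn w * (rn d + 1)))//.
    by rewrite ler_wpM2l ?rn_ge0// lerDl.
  by rewrite -ltr_pdivlMr// mul1r.
have [W [[W1 W2] _]] := neumann wd.
have ddx : x * d * d = d by rewrite xd.
(* On the range of the idempotent [x d] the resolvent is [- d (1 - w d)^-1]; on that of [e] it is a
   finite sum, as [x^q e = 0]. *)
exists (- (d * W)), (\sum_(n < q) w ^- n.+1 *: (x ^+ n * e)); split.
- apply/cvg_rnP => eps eps0.
  have K0 : 0 < rn d * rn W + 1 by rewrite ltr_wpDl// mulr_ge0// rn_ge0.
  have [|||N hN] := @exprn_lt _ (rn (w *: d)) (eps / (rn d * rn W + 1)) => //.
  - exact: rn_ge0.
  - by rewrite divr_gt0.
  exists N => n /hN; rewrite ltr_pdivlMr// => h.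
  have sE : series (fun n => w ^+ n *: a n) n = - (d * (1 - (w *: d) ^+ n) * W).
    elim: {h} n => [|n IH].
      by rewrite seriesEord /= big_ord0 expr0 subrr mulr0 mul0r oppr0.
    rewrite seriesSr IH /a scalerN -opprD; congr (- _).
    have -> : w ^+ n *: d ^+ n.+1 = d * (w *: d) ^+ n * ((1 - w *: d) * W).
      by rewrite W1 mulr1 blin_exprZn -blin_scalerAr exprS.
    rewrite mulrA -mulrDl; congr (_ * _).
    by rewrite -mulrA -mulrDr mulrBr mulr1 -exprSr addrA subrK.
  rewrite sE opprK addrC mulrBr mulr1 mulrBl opprB addrC subrK.
  apply: le_lt_trans (rn_blinM _ _) _.
  apply: le_lt_trans (ler_wpM2r (rn_ge0 _) (rn_blinM _ _)) _.
  apply: le_lt_trans h; rewrite mulrAC mulrC.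
  apply: ler_pM; rewrite ?mulr_ge0 ?rn_ge0 ?rn_blinX//.
  by rewrite lerDl.
- apply/cvg_rnP => eps eps0; exists q => n /subnKC <-.
  rewrite seriesEord /= big_split_ord /= [X in _ + X - _]big1 ?addr0 ?subrr ?rn0//.
  by move=> i _; rewrite addnC eX ?scaler0.
- have [r1 r2] : inverse_pair (w *: (1 : blin E E) - x) (resolvent c z').
    rewrite z'E; apply: resolventP; first by rewrite gt_eqF.
    by apply/not_spectrum; rewrite scalerDl opprD addrA; exact: rP.
  suff h : (w *: (1 : blin E E) - x) *
      (- (d * W) + \sum_(n < q) w ^- n.+1 *: (x ^+ n * e)) = 1.
    by rewrite -[LHS]mulr1 -h mulrA r2 mul1r.
  have hN N : (w *: (1 : blin E E) - x) * (\sum_(n < N) w ^- n.+1 *: (x ^+ n * e)) =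
      e - w ^- N *: (x ^+ N * e).
    elim: N => [|N IH]; first by rewrite big_ord0 mulr0 !expr0 invr1 scale1r mul1r subrr.
    rewrite big_ord_recr /= mulrDr IH -addrA; congr (_ + _).
    rewrite mulrBl -blin_scalerAl mul1r -blin_scalerAr scalerA.
    have -> : w * w ^- N.+1 = w ^- N by rewrite exprS invfM mulrA mulfV// mul1r.
    by rewrite mulrA -exprS addKr.
  rewrite mulrDr hN qe scaler0 subr0 mulrN -mulNr opprB mulrA mulrBl.
  have -> : x * d - w *: (1 : blin E E) * d = x * d * (1 - w *: d).
    by rewrite mulrBr mulr1 -blin_scalerAr ddx -blin_scalerAl mul1r.
  by rewrite -[_ * _ * W]mulrA W1 mulr1 /e addrC subrK.
Qed.

End Poles.

(** * The Drazin spectrum of an elementary operator *)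

Section DrazinSpectrumOfElementaryOperators.
Context {R : realType} {X Y : completeNormedModType R[i]}.

Lemma drazin_spectrum_sub {E : completeNormedModType R[i]} (c : blin E E) :
  drazin_spectrum c `<=` spectrum c.
Proof. by move=> z h /invertible_drazin. Qed.

Lemma drazin_spectrum_at0 {E : completeNormedModType R[i]} (c : blin E E) :
  drazin_spectrum c 0 <-> ~ drazin_invertible c.
Proof. by rewrite /drazin_spectrum /= scale0r subr0. Qed.

Lemma drazin_resolvent_at0 {E : completeNormedModType R[i]} (c : blin E E) :
  drazin_resolvent_set c 0 <-> drazin_invertible c.
Proof.
by split => [rc|dc /drazin_spectrum_at0 //]; apply: contrapT => /drazin_spectrum_at0.
Qed.

Lemma spectrum_at0 {E : completeNormedModType R[i]} (c : blin E E) :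
  spectrum c 0 <-> ~ invertible c.
Proof. by rewrite /spectrum /= scale0r subr0. Qed.

Lemma polar_drazin_spectrum {E : completeNormedModType R[i]} (c : blin E E) :
  spectrum c = poles c -> drazin_spectrum c = set0.
Proof.
move=> cp; rewrite -subset0 => z dz; have := drazin_spectrum_sub dz.
by rewrite cp => /poles_drazin.
Qed.

Lemma elem_op_eq0 (S : blin X X) (T : blin Y Y) :
  elem_op S T = 0 -> S = 0 \/ T = 0.
Proof.
move=> t0; apply: contrapT => /not_orP [S0 T0].
have [x Sx] : exists x, S x <> 0.
  by apply: contrapT => /forallNP h; apply: S0; apply: blinP => x; apply: contrapT; exact: h.
have [y Ty] : exists y, T y <> 0.
  by apply: contrapT => /forallNP h; apply: T0; apply: blinP => y; apply: contrapT; exact: h.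
have [f [_ fT]] := norming_functional (T y).
have : elem_op S T (rank_one x f) y = 0 by rewrite t0.
rewrite elem_op_rank_one rank_oneE precompE => /eqP; rewrite scaler_eq0.
case/orP => /eqP // fTy; apply: Ty; apply: rn0_eq0.
by rewrite -fT fTy rn0.
Qed.

Variables (S : blin X X) (T : blin Y Y).
Notation tau := (elem_op S T).
Let D := set_mul (spectrum S) (drazin_spectrum T) `|`
         set_mul (drazin_spectrum S) (spectrum T).

Lemma spectrum_elem_op_l : spectrum (elem_op S (1 : blin Y Y)) `<=` spectrum S.
Proof.
by move=> al h sS; apply: h; rewrite -elem_op1 elem_op_sub_l; exact: elem_op_invertible_l.
Qed.

Lemma spectrum_elem_op_r : spectrum (elem_op (1 : blin X X) T) `<=` spectrum T.
Proof.
by move=> al h sT; apply: h; rewrite -elem_op1 elem_op_sub_r; exact: elem_op_invertible_r.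
Qed.

(** [drazin_mul] for left multiplication by [S] and right multiplication by [T], which commute, have
    product [tau], and have spectra inside those of [S] and [T]. *)
Lemma elem_op_drazin_sub lam :
  (forall mu nu, spectrum S mu -> spectrum T nu -> mu * nu = lam ->
    drazin_invertible (S - mu *: (1 : blin X X)) /\
    drazin_invertible (T - nu *: (1 : blin Y Y))) ->
  drazin_invertible (tau - lam *: (1 : blin (blin Y X) (blin Y X))).
Proof.
have d1 (E : normedModType R[i]) : drazin_invertible (1 : blin E E).
  by apply: invertible_drazin; exists 1; split; rewrite mulr1.
move=> h; rewrite elem_opLR; apply: (drazin_mul (elem_opC S T)) => al be.
move=> /spectrum_elem_op_l sa /spectrum_elem_op_r sb ab.
have [dS dT] := h _ _ sa sb ab.
by split; rewrite -elem_op1;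
  [rewrite elem_op_sub_l|rewrite elem_op_sub_r]; exact: elem_op_drazin.
Qed.

Lemma drazin_spectrum_elem_op lam : lam != 0 -> drazin_spectrum tau lam <-> D lam.
Proof.
move=> lam0; split.
  move=> dt; apply: contrapT => nD; apply: dt; apply: elem_op_drazin_sub => mu nu sS sT munu.
  split; apply: contrapT => dd; apply: nD; first by right; exists mu => //; exists nu.
  by left; exists mu => //; exists nu.
move=> [[mu sS [nu dT munu]]|[mu dS [nu sT munu]]] dt; rewrite -munu in dt lam0.
  by have [_] := drazin_both sS (drazin_spectrum_sub dT) lam0 dt; exact: dT.
by have [] := drazin_both (drazin_spectrum_sub dS) sT lam0 dt.
Qed.

Lemma elem_op_trivial_l : spectrum S = set0 -> drazin_invertible tau.
Proof.
move=> /spectrum_neq0 X0; exists 0, 1.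
have t0 : tau = 0.
  apply: blinP => A; apply: blinP => y; rewrite elem_opE.
  by rewrite -[S _]blin1E X0.
by rewrite t0 expr1 !mul0r.
Qed.

Lemma elem_op_trivial_r : spectrum T = set0 -> drazin_invertible tau.
Proof.
move=> /spectrum_neq0 Y0; exists 0, 1.
have t0 : tau = 0.
  apply: blinP => A; apply: blinP => y; rewrite elem_opE.
  by rewrite -[T y]blin1E Y0 blin0E !blin_app0.
by rewrite t0 expr1 !mul0r.
Qed.

(** If both spectra are non-empty and 0 is not in [D], then [S] and [T] are Drazin invertible and
    the product rule applies. An empty spectrum means a zero space, on which [tau = 0]. *)
Lemma drazin_spectrum_elem_op_at0 :
  drazin_spectrum S <> set0 \/ drazin_spectrum T <> set0 ->
  drazin_spectrum tau 0 -> D 0.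
Proof.
move=> h /drazin_spectrum_at0 nt; apply: contrapT => nD; apply: nt.
have [sS0|/set0P [mu sS]] := eqVneq (spectrum S) set0; first exact: elem_op_trivial_l.
have [sT0|/set0P [nu sT]] := eqVneq (spectrum T) set0; first exact: elem_op_trivial_r.
apply: elem_op_drazin; apply: contrapT => dd.
  by apply: nD; right; exists 0; [exact/drazin_spectrum_at0|exists nu; rewrite // mul0r].
by apply: nD; left; exists mu => //; exists 0; [exact/drazin_spectrum_at0|rewrite /= mulr0].
Qed.

(** Equality can fail only at 0, and only by 0 lying in [D] alone; (iii), (iv) and (v) all reduce to
    this. *)
Lemma drazin_spectrum_elem_op_eq :
    drazin_spectrum S <> set0 \/ drazin_spectrum T <> set0 ->
  drazin_spectrum tau = D <-> (D 0 -> ~ drazin_invertible tau).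
Proof.
move=> h; split=> [<- /drazin_spectrum_at0 //|D0]; apply/seteqP; split => z.
  have [->|z0] := eqVneq z 0; first exact: drazin_spectrum_elem_op_at0.
  by case: (drazin_spectrum_elem_op z0).
have [->|z0] := eqVneq z 0; first by move=> /D0; case: (drazin_spectrum_at0 tau).
by case: (drazin_spectrum_elem_op z0).
Qed.

Lemma nonzero_spectrum {E : completeNormedModType R[i]} (c : blin E E) :
  ~ spectrum c `<=` [set 0] -> exists2 z, spectrum c z & z != 0.
Proof.
move=> h; apply: contrapT => hn; apply: h => z sz; apply: contrapT => z0.
by apply: hn; exists z => //; apply/eqP.
Qed.

Lemma quasinilpotent_not_drazin {E : completeNormedModType R[i]} (c : blin E E) :
  spectrum c `<=` [set 0] -> drazin_spectrum c <> set0 -> ~ drazin_invertible c.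
Proof.
move=> c0 /eqP/set0P [z dz]; apply/drazin_spectrum_at0.
by rewrite -(c0 _ (drazin_spectrum_sub dz)).
Qed.

Lemma nilpotent_drazin {A : pzRingType} (x : A) m : x ^+ m = 0 -> drazin_invertible x.
Proof.
by move=> xm; apply: (@drazin_criterion _ x 0 m); rewrite mulr0 ?mul0r.
Qed.

(** Here [tau] is nilpotent, and since [tau^m] is built from [S^m] and [T^m], one of these
    vanishes. *)
Lemma quasinilpotent_elem_op : spectrum S `<=` [set 0] -> spectrum T `<=` [set 0] ->
  drazin_invertible tau -> drazin_invertible S \/ drazin_invertible T.
Proof.
move=> S0 T0; rewrite elem_opLR => /(quasinilpotent_drazin_mul (elem_opC S T)).
case=> [z /spectrum_elem_op_l /S0 //|z /spectrum_elem_op_r /T0 //|m].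
by rewrite -elem_opLR elem_op_expr => /elem_op_eq0 [] /nilpotent_drazin; [left|right].
Qed.

Lemma not_product_at0 : invertible S -> invertible T -> ~ D 0.
Proof.
move=> iS iT [[mu sS [nu /drazin_spectrum_sub sT]]|[mu /drazin_spectrum_sub sS [nu sT]]];
  move=> /= /eqP; rewrite mulf_eq0 => /orP[] /eqP z0.
- by move: sS; rewrite z0 => /spectrum_at0.
- by move: sT; rewrite z0 => /spectrum_at0.
- by move: sS; rewrite z0 => /spectrum_at0.
- by move: sT; rewrite z0 => /spectrum_at0.
Qed.

End DrazinSpectrumOfElementaryOperators.

Theorem theorem5p3 (R : realType) (X Y : completeNormedModType R[i])
    (S : blin X X) (T : blin Y Y) :
  let tau : blin (blin Y X) (blin Y X) := elem_op S T in
  let D := set_mul (spectrum S) (drazin_spectrum T) `|`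
           set_mul (drazin_spectrum S) (spectrum T) in
  [/\
   (* (i) *)
   spectrum S = poles S -> spectrum T = poles T ->
     D = set0 /\ drazin_spectrum tau = set0,
   (* (ii) *)
   drazin_spectrum S <> set0 \/ drazin_spectrum T <> set0 ->
     [/\ drazin_spectrum tau `\` [set 0] = D `\` [set 0],
         drazin_spectrum tau `<=` D
       & drazin_spectrum tau `<` D ->
           D = drazin_spectrum tau `|` [set 0] /\ ~ drazin_spectrum tau 0],
   (* (iii) *)
   spectrum S = poles S -> poles S <> [set 0] -> drazin_spectrum T <> set0 ->
     (drazin_spectrum tau = D <->
      ~ poles S 0 \/ ~ drazin_resolvent_set T 0),
   (* (iv) *)
   drazin_spectrum S <> set0 -> spectrum T = poles T -> poles T <> [set 0] ->
     (drazin_spectrum tau = D <->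
      ~ drazin_resolvent_set S 0 \/ ~ poles T 0)
   & (* (v) *)
   drazin_spectrum S <> set0 -> drazin_spectrum T <> set0 ->
     [<-> D = drazin_spectrum tau;
          invertible S /\ invertible T \/ ~ drazin_invertible tau;
          invertible S /\ invertible T \/
            ~ ((poles S `&` drazin_resolvent_set T) `|`
               (drazin_resolvent_set S `&` poles T)) 0]].
Proof.
move=> tau D.
have drazinC : drazin_invertible S -> drazin_invertible T -> drazin_invertible tau.
  exact: elem_op_drazin.
split.
- move=> /polar_drazin_spectrum S0 /polar_drazin_spectrum T0.
  have D0 : D = set0.
    rewrite -subset0 => z [[mu _ [nu]]|[mu]]; first by rewrite T0.
    by rewrite S0.
  split=> //; rewrite -subset0 => z; have [->|z0] := eqVneq z 0.
    move=> /drazin_spectrum_at0; apply; apply: drazinC; apply: contrapT => dd.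
      by have /drazin_spectrum_at0 := dd; rewrite S0.
    by have /drazin_spectrum_at0 := dd; rewrite T0.
  by move=> /(drazin_spectrum_elem_op S T z0); rewrite -/D D0.
- move=> h; have h0 := drazin_spectrum_elem_op_at0 h.
  have sub : drazin_spectrum tau `<=` D.
    move=> z; have [->//|z0] := eqVneq z 0.
    by move=> /(drazin_spectrum_elem_op S T z0).
  split=> //.
    apply/seteqP; split => z [dz /eqP z0]; split; try exact/eqP.
      exact: sub.
    exact/(drazin_spectrum_elem_op S T z0).
  move=> [_ nsub].
  have [z Dz dz] : exists2 z, D z & ~ drazin_spectrum tau z.
    by apply: contrapT => hn; apply: nsub => z Dz; apply: contrapT => dz; apply: hn; exists z.
  have z0 : z = 0.
    by apply: contrapT => /eqP z0; apply: dz; apply/(drazin_spectrum_elem_op S T z0).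
  split; last by rewrite -z0.
  apply/seteqP; split => [y Dy|y [/sub //|->]]; last by rewrite -z0.
  have [->|y0] := eqVneq y 0; first by right.
  by left; apply/(drazin_spectrum_elem_op S T y0).
- move=> Sp Sn0 /[dup] Tn0 /eqP/set0P [t dt]; have S0 := polar_drazin_spectrum Sp.
  apply: (iff_trans (drazin_spectrum_elem_op_eq (or_intror Tn0))); split.
    move=> h; apply: contrapT => /not_orP [/contrapT p0 /contrapT rT].
    apply: h; last first.
      apply: drazinC; first by have := poles_drazin p0; rewrite scale0r subr0.
      exact/drazin_resolvent_at0.
    by left; exists 0; [rewrite Sp|exists t => //=; rewrite mul0r].
  move=> h D0 dtau.
  (* [D 0] supplies a point of the spectrum of [S], so without a non-zero point that spectrum would
     be exactly [{0}], which is excluded. *)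
  have [mu sS mu0] : exists2 mu, spectrum S mu & mu != 0.
    apply: nonzero_spectrum => S00; apply: Sn0.
    apply/seteqP; split => [z|_ ->]; first by rewrite -Sp => /S00.
    case: D0 => [[mu sS _]|[mu]]; last by rewrite S0.
    by rewrite -(S00 _ sS) -Sp.
  have dT := drazin_right_factor sS mu0 dtau.
  have {}h : ~ spectrum S 0.
    by rewrite Sp; case: h => // h; case: h; exact/drazin_resolvent_at0.
  case: D0 => [[m sm [n dn] /= /eqP]|[m]]; last by rewrite S0.
  rewrite mulf_eq0 => /orP[] /eqP z0; first by apply: h; rewrite -z0.
  by move: dn; rewrite z0 => /drazin_spectrum_at0.
- move=> /[dup] Sn0 /eqP/set0P [s ds] Tp Tn0; have T0 := polar_drazin_spectrum Tp.
  apply: (iff_trans (drazin_spectrum_elem_op_eq (or_introl Sn0))); split.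
    move=> h; apply: contrapT => /not_orP [/contrapT rS /contrapT p0].
    apply: h; last first.
      apply: drazinC; last by have := poles_drazin p0; rewrite scale0r subr0.
      exact/drazin_resolvent_at0.
    by right; exists s => //; exists 0; [rewrite Tp|rewrite /= mulr0].
  move=> h D0 dtau.
  have [nu sT nu0] : exists2 nu, spectrum T nu & nu != 0.
    apply: nonzero_spectrum => T00; apply: Tn0.
    apply/seteqP; split => [z|_ ->]; first by rewrite -Tp => /T00.
    case: D0 => [[mu _ [nu]]|[mu _ [nu sT _]]]; first by rewrite T0.
    by rewrite -(T00 _ sT) -Tp.
  have dS := drazin_left_factor sT nu0 dtau.
  have {}h : ~ spectrum T 0.
    by rewrite Tp; case: h => // h; case: h; exact/drazin_resolvent_at0.
  case: D0 => [[m _ [n]]|[m dm [n sn] /= /eqP]]; first by rewrite T0.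
  rewrite mulf_eq0 => /orP[] /eqP z0; last by apply: h; rewrite -z0.
  by move: dm; rewrite z0 => /drazin_spectrum_at0.
- move=> /[dup] Sn0 /eqP/set0P [s ds] /[dup] Tn0 /eqP/set0P [t dt].
  have eqD := drazin_spectrum_elem_op_eq (or_introl Sn0 : _ \/ drazin_spectrum T <> set0).
  tfae.
  + move=> /esym/eqD h; apply: contrapT => /not_orP [ni /contrapT dtau].
    apply: (h _ dtau); have [iS|niS] := pselect (invertible S); last first.
      by left; exists 0; [exact/spectrum_at0|exists t => //=; rewrite mul0r].
    right; exists s => //; exists 0; last by rewrite /= mulr0.
    by apply/spectrum_at0 => iT; apply: ni.
  + case=> [|ntau]; first by left.
    right=> -[[p0 rT]|[rS p0]]; apply: ntau; apply: drazinC.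
    * by have := poles_drazin p0; rewrite scale0r subr0.
    * exact/drazin_resolvent_at0.
    * exact/drazin_resolvent_at0.
    * by have := poles_drazin p0; rewrite scale0r subr0.
  + move=> h; apply/esym/eqD => D0 dtau.
    (* A quasinilpotent operator with non-empty Drazin spectrum is not Drazin invertible, whereas a
       non-zero spectral point of one factor makes the other Drazin invertible. Only the case of
       non-zero points on both sides survives; there a non-invertible factor has a pole at 0. *)
    have [S0|/nonzero_spectrum [mu sS mu0]] := pselect (spectrum S `<=` [set 0]);
    have [T0|/nonzero_spectrum [nu sT nu0]] := pselect (spectrum T `<=` [set 0]).
    * have nS := quasinilpotent_not_drazin S0 Sn0.
      have nT := quasinilpotent_not_drazin T0 Tn0.
      by case: (quasinilpotent_elem_op S0 T0 dtau).
    * exact: (quasinilpotent_not_drazin S0 Sn0 (drazin_left_factor sT nu0 dtau)).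
    * exact: (quasinilpotent_not_drazin T0 Tn0 (drazin_right_factor sS mu0 dtau)).
    have dS := drazin_left_factor sT nu0 dtau.
    have dT := drazin_right_factor sS mu0 dtau.
    have [iS iT] : invertible S /\ invertible T.
      case: h => // h; split; apply: contrapT => /spectrum_at0 s0; apply: h.
        left; split; last exact/drazin_resolvent_at0.
        by apply: drazin_poles => //; rewrite scale0r subr0.
      right; split; first exact/drazin_resolvent_at0.
      by apply: drazin_poles => //; rewrite scale0r subr0.
    exact: (not_product_at0 iS iT D0).
Qed.
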